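(* Let $K$ be an $SL$ disk of $\mathbb{R}^2$ and let $f:\partial K\to\mathbb{R}^2$ be an $SL$ embedding such that the $SL$ circle $f(\partial K)$ is convex. If $f(\partial K)$ is strictly convex, or more generally if $K$ has no $f$-obstructive spanning 1-simplex, then $f$ extends to an $SL$ embedding $K\to\mathbb{R}^2$.
   Context: An $SL$ disk $K$ of $\mathbb{R}^2$ is a subset homeomorphic to the closed 2-disk together with a (finite) triangulation by affine simplices of $\mathbb{R}^2$. Its boundary $\partial K$, with the induced triangulation, is called an $SL$ circle of $\mathbb{R}^2$. A map from $K$ (or $\partial K$) to $\mathbb{R}^2$ is $SL$ (simplexwise linear) if it is continuous and affine on each simplex of the given triangulation; an $SL$ embedding is an injective $SL$ map. If $f:\partial K\to\mathbb{R}^2$ is an $SL$ embedding, $f(\partial K)$ is an $SL$ circle whose vertices and 1-simplices are the images of those of $\partial K$. An $SL$ circle is convex if the disk it bounds is convex, and strictly convex if in addition it is never flat at a vertex (the two 1-simplices adjacent to any vertex are not collinear). A 1-simplex $\sigma$ of $K$ is spanning if $\partial\sigma=\sigma\cap\partial K$, where $\partial\sigma$ is the set of its two end points. Given an $SL$ embedding $f:\partial K\to\mathbb{R}^2$ with convex image, a spanning 1-simplex $\sigma$ is $f$-obstructive if the $f$-image of one of the two arcs that $\partial\sigma$ bounds in $\partial K$ is flat (contained in a straight line). *)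

(* Defs.v *)
From HB Require Import structures.
From mathcomp Require Import all_boot all_order all_algebra finmap.
From mathcomp Require Import all_classical all_reals all_analysis.

Set Implicit Arguments.
Unset Strict Implicit.
Unset Printing Implicit Defensive.

Import Order.TTheory GRing.Theory Num.Theory.
Import numFieldNormedType.Exports.

Local Open Scope classical_set_scope.
Local Open Scope ring_scope.

Definition frontier (T : topologicalType) (A : set T) : set T :=
  closure A `\` interior A.

Definition homeomorphic (T U : topologicalType) (A : set T) (B : set U) : Prop :=
  exists (h : T -> U) (k : U -> T),
    [/\ set_fun A B h /\ set_fun B A k,
        {within A, continuous h}, {within B, continuous k},
        (forall x, A x -> k (h x) = x) & (forall y, B y -> h (k y) = y)].

Section SL.
Variable R : realType.
Notation plane := 'rV[R]_2.

(* Euclidean: the norm `|x| on 'rV[R]_2 is the sup norm. *)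
Definition unit_disk : set plane := [set x | \sum_i x 0 i ^+ 2 <= 1].

Definition is_disk (D : set plane) : Prop := homeomorphic D unit_disk.

Definition hull (s : {fset plane}) : set plane :=
  [set x | exists w : plane -> R,
     [/\ forall v, v \in s -> 0 <= w v,
         \sum_(v <- s) w v = 1 &
         x = \sum_(v <- s) w v *: v]].

Definition affinely_independent (s : {fset plane}) : Prop :=
  forall w : plane -> R,
    \sum_(v <- s) w v = 0 -> \sum_(v <- s) w v *: v = 0 ->
    forall v, v \in s -> w v = 0.

(* A simplex is given by its set of vertices and a triangulation by the finite
   set of its (nonempty) simplices. [hull fset0] is empty, so the last clause
   says that two simplices are disjoint or meet in a common face. *)
Definition triangulation (K : {fset {fset plane}}) : Prop :=
  [/\ forall s, s \in K -> s <> fset0 /\ affinely_independent s,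
      forall s t : {fset plane},
        s \in K -> (t `<=` s)%fset -> t <> fset0 -> t \in K &
      forall s t : {fset plane}, s \in K -> t \in K ->
        hull s `&` hull t = hull (s `&` t)%fset].

Definition polyhedron (K : {fset {fset plane}}) : set plane :=
  [set x | exists2 s, s \in K & hull s x].

Definition SL_disk (K : {fset {fset plane}}) : Prop :=
  triangulation K /\ is_disk (polyhedron K).

(* The topological boundary of the polyhedron in the plane, which for a disk is the
   image of the unit circle, with the induced triangulation. *)
Definition bd (K : {fset {fset plane}}) : {fset {fset plane}} :=
  [fset s in K | `[< (hull s `<=` frontier (polyhedron K))%classic >]]%fset.

Definition affine_on (A : set plane) (f : plane -> plane) : Prop :=
  exists (M : 'M[R]_2) (b : plane), forall x, A x -> f x = x *m M + b.

(* Only the values of f on the polyhedron of L matter. *)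
Definition SL_map (L : {fset {fset plane}}) (f : plane -> plane) : Prop :=
  {within polyhedron L, continuous f} /\
  forall s, s \in L -> affine_on (hull s) f.

Definition SL_embedding (L : {fset {fset plane}}) (f : plane -> plane) : Prop :=
  SL_map L f /\ set_inj (polyhedron L) f.

Definition image_triangulation (f : plane -> plane) (L : {fset {fset plane}}) :
    {fset {fset plane}} :=
  [fset [fset f v | v in s] | s : {fset plane} in L]%fset.

Definition flat (A : set plane) : Prop :=
  exists p d : plane, d != 0 /\ A `<=` [set p + t *: d | t in [set: R]].

Definition convex_circle (C : {fset {fset plane}}) : Prop :=
  exists D : set plane,
    [/\ is_disk D, frontier D = polyhedron C & convex_set D].

Definition strictly_convex_circle (C : {fset {fset plane}}) : Prop :=
  convex_circle C /\
  forall (v : plane) (s t : {fset plane}),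
    s \in C -> t \in C -> #|` s| = 2%N -> #|` t| = 2%N -> s <> t ->
    v \in s -> v \in t -> ~ flat (hull s `|` hull t).

Definition spanning (K : {fset {fset plane}}) (s : {fset plane}) : Prop :=
  [/\ s \in K, #|` s| = 2%N & [set` s] = hull s `&` polyhedron (bd K)].

Definition is_arc (a b : plane) (A : set plane) : Prop :=
  exists c : R -> plane,
    [/\ {within `[0, 1], continuous c}, set_inj `[0, 1] c,
        c 0 = a, c 1 = b & A = c @` `[0, 1]].

(* As the polyhedron of bd K is a circle, it contains exactly two arcs with given
   distinct end points: the two arcs that these bound in it. *)
Definition obstructive (K : {fset {fset plane}}) (f : plane -> plane)
    (s : {fset plane}) : Prop :=
  spanning K s /\
  exists (a b : plane) (A : set plane),
    [/\ s = [fset a; b]%fset, is_arc a b A, A `<=` polyhedron (bd K) &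
        flat (f @` A)].

End SL.

(* Main.v *)
(* The extension is built from positions of the vertices, by induction on the
   number of triangles, for an abstract triangulated disk (T, c) whose boundary
   cycle c is placed in weakly convex position. If some edge joins two vertices of
   c without lying on c, it cuts the disk into two smaller ones, whose boundaries
   are again in convex position because the edge is not obstructive. Otherwise
   take consecutive vertices a, v, b of c that are not collinear: the triangles at
   v form a fan over a path from a to b through interior vertices; placing these
   on a parabolic arc that is tangent to av and vb makes the boundary of the rest
   of the disk convex without new flat arcs, so that the induction hypothesis
   applies to it. The outcome is stated as a separation property: any two distinct
   triangles lie on two sides of a line, on which they have at most one common
   edge, so the piecewise affine extension is injective.

   To apply this to K, the only facts about disks in the plane that are needed are
   that a disk is compact and that two of its points never separate it. The second
   one shows that each simplex lies in a triangle. An edge of exactly one triangle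
   lies in the frontier, and the frontier is a cycle because f maps it to the
   frontier of a convex disk, whose vertices are ordered by following the
   edges that leave an interior point on the left. That the mod 2 boundary operator
   of K is injective, and onto the cycles, is proved by counting the crossings of a
   vertical ray with a mod 2 cycle. *)
Require Import Defs.
From HB Require Import structures.
From mathcomp Require Import all_boot all_order all_algebra finmap.
From mathcomp Require Import ring lra.
Set Implicit Arguments.
Unset Strict Implicit.
Unset Printing Implicit Defensive.
Import Order.TTheory GRing.Theory Num.Theory.

(** * Triangulated disks, combinatorially *)

(** The obstacle is that the boundary polygon may be flat at vertices: an inner edge whose ends lie
    on one straight piece of it would be crushed onto that piece. Strict convexity is therefore not
    what the induction carries. It carries that every inner edge between boundary vertices has
    boundary vertices strictly on both sides. A cut along a chord preserves this, and the parabola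
    provides it for the new boundary vertices: no three of its points are collinear, and every sign
    that is needed is that of a polynomial in the parameters, so an ordered field is enough for this
    half of the proof.

    Disks are described by mod 2 chains because these pass to pieces without any topology or
    orientation: every cycle of edges bounds exactly one set of triangles. Both properties survive a
    cut along a simple path, since a simple path carries no nonzero cycle. They also yield the local
    structure, such as connected stars, that would otherwise come from planarity. Topology enters
    only when the given triangulation is shown to satisfy the combinatorial definition. *)

Section Parity.
Variable V : finType.
Implicit Types (u v w x y : V) (s c : seq V) (t : {set V}) (S T A : {set {set V}}).
Implicit Types (z : V -> V -> bool).

Lemma big_addb_card (I : finType) (P : pred I) :
  \big[addb/false]_i P i = odd #|[set i | P i]|.
Proof.
rewrite -sum1_card (big_morph odd oddD (erefl _)) [RHS]big_mkcond /=.
by apply: eq_bigr => i _; rewrite inE; case: (P i).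
Qed.

Lemma big_addb1 (x : V) (P : pred V) :
  (forall u, u != x -> P u = false) -> \big[addb/false]_u P u = P x.
Proof. by move=> h; rewrite (bigD1 x) //= big1 ?addbF. Qed.

(** Mod 2 cycles: [z] is read as a set of edges, in which every vertex has even degree. *)
Definition evenrel z := forall v, \big[addb/false]_u z v u = false.

(* Sets of edges are symmetric relations, added mod 2 with (+): a single edge, the
   path x :: s (see pe) and the cycle c (see ce). *)
Definition ed x y u v := ((u == x) && (v == y)) (+) ((u == y) && (v == x)).

Lemma edC x y u v : ed x y u v = ed y x u v.
Proof. by rewrite /ed addbC. Qed.

Lemma ed_sym x y u v : ed x y u v = ed x y v u.
Proof. by rewrite /ed addbC andbC [X in _ (+) X]andbC. Qed.

Lemma edP x y u v : ed x y u v -> (u = x /\ v = y) \/ (u = y /\ v = x).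
Proof.
rewrite /ed; case: (boolP ((u == x) && (v == y))) => [/andP[/eqP-> /eqP->]|_ /=]; first by left.
by case/andP=> /eqP-> /eqP->; right.
Qed.

Lemma ed_id x y : x != y -> ed x y x y.
Proof. by move=> h; rewrite /ed !eqxx (negbTE h). Qed.

Lemma deg_ed x y v : \big[addb/false]_u ed x y v u = (v == x) (+) (v == y).
Proof.
rewrite /ed big_split /=; congr (_ (+) _).
  by rewrite (@big_addb1 y) ?eqxx ?andbT // => u /negbTE->; rewrite andbF.
by rewrite (@big_addb1 x) ?eqxx ?andbT // => u /negbTE->; rewrite andbF.
Qed.

Fixpoint pe x s u v := if s is y :: s' then ed x y u v (+) pe y s' u v else false.

Definition ce c := if c is x :: s then pe x (rcons s x) else fun _ _ => false.

Lemma pe_cat x s1 s2 u v : pe x (s1 ++ s2) u v = pe x s1 u v (+) pe (last x s1) s2 u v.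
Proof. by elim: s1 x => //= y s1 IH x; rewrite IH addbA. Qed.

Lemma pe_rcons x s y u v : pe x (rcons s y) u v = pe x s u v (+) ed (last x s) y u v.
Proof. by rewrite -cats1 pe_cat /= addbF. Qed.

Lemma pe_sym x s u v : pe x s u v = pe x s v u.
Proof. by elim: s x => //= y s IH x; rewrite IH ed_sym. Qed.

Lemma pe_irr x s v : pe x s v v = false.
Proof. by elim: s x => //= y s IH x; rewrite IH addbF /ed [X in _ (+) X]andbC addbb. Qed.

Lemma pe_rev x s y u v : pe y (rcons (rev s) x) u v = pe x (rcons s y) u v.
Proof.
elim: s x => [|w s IH] x /=; first by rewrite !addbF edC.
by rewrite rev_cons pe_rcons last_rcons IH addbC edC.
Qed.

Lemma deg_pe x s v : \big[addb/false]_u pe x s v u = (v == x) (+) (v == last x s).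
Proof.
elim: s x => [|y s IH] x /=; first by rewrite big1 ?addbb.
by rewrite big_split /= deg_ed IH addbA; congr (_ (+) _); rewrite -addbA addbb addbF.
Qed.

Lemma pe_in x s u v : pe x s u v -> (u \in x :: s) /\ (v \in x :: s).
Proof.
elim: s x => //= y s IH x; rewrite !inE.
case h: (ed x y u v) => /= h2.
  by case/edP: h => -[-> ->]; rewrite !eqxx ?orbT.
by case: (IH _ h2); rewrite !inE => -> ->; rewrite !orbT.
Qed.

Lemma pe_path (e : rel V) x s u v :
  symmetric e -> path e x s -> pe x s u v -> e u v.
Proof.
move=> es; elim: s x => //= y s IH x /andP[exy /IH{}IH].
case h: (ed x y u v) => /= h2; last exact: IH.
by case/edP: h => -[-> ->] //; rewrite es.
Qed.

Lemma ce_sym c u v : ce c u v = ce c v u.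
Proof. by case: c => //= x s; rewrite pe_sym. Qed.

Lemma ce_even c : evenrel (ce c).
Proof.
by case: c => [|x s] v /=; [rewrite big1|rewrite deg_pe last_rcons addbb].
Qed.

Lemma ce_in c u v : ce c u v -> (u \in c) /\ (v \in c).
Proof.
case: c => //= x s /pe_in [].
by rewrite !inE !mem_rcons !inE !orbA !orbb.
Qed.

Lemma ce_rot s1 s2 u v : ce (s1 ++ s2) u v = ce (s2 ++ s1) u v.
Proof.
case: s1 s2 => [|x s1] [|y s2]; rewrite ?cats0 //=.
rewrite !rcons_cat !pe_cat /= !pe_rcons.
by case: (pe x s1 u v); case: (pe y s2 u v); do 2!case: (ed _ _ u v).
Qed.

(** The first vertex of a simple path has only one possible neighbour, so evenness there removes the
    first edge; the rest follows by induction. *)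
Lemma pe_even_false x s z : uniq (x :: s) -> (forall u v, z u v = z v u) ->
  evenrel z -> (forall u v, z u v -> pe x s u v) -> forall u v, z u v = false.
Proof.
move=> + zs ze; elim: s x => [|y s IH] x.
  by move=> _ h u v; apply/negP=> /h.
move=> /= /andP[xs us] h.
have hx u : z x u -> u = y.
  move=> /h /=; case e1: (ed x y x u) => /= h2.
    by case/edP: e1 => -[e2 e3] //; rewrite e2 mem_head in xs.
  by case: (pe_in h2) => h3; rewrite h3 in xs.
have zxy : z x y = false.
  rewrite -(ze x) (@big_addb1 y) // => u uy; apply/negP=> /hx e; by rewrite e eqxx in uy.
apply: (IH y us) => u v zuv; move: (h _ _ zuv) => /=.
case e1: (ed x y u v) => //= _.
by case/edP: e1 zuv => -[-> ->]; rewrite ?zxy // zs zxy.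
Qed.

Lemma evenD z1 z2 : evenrel z1 -> evenrel z2 -> evenrel (fun u v => z1 u v (+) z2 u v).
Proof. by move=> h1 h2 v; rewrite big_split /= h1 h2. Qed.

Lemma even_subcycle c z : uniq c -> (forall u v, z u v = z v u) ->
  evenrel z -> (forall u v, z u v -> ce c u v) ->
  (forall u v, z u v = false) \/ (forall u v, z u v = ce c u v).
Proof.
case: c => [|x s]; first by move=> _ _ _ h; left=> u v; apply/negP=> /h.
move=> us zs ze h.
(* A cycle that misses the closing edge lies in a simple path, so it is zero. *)
have key z' : (forall u v, z' u v = z' v u) -> evenrel z' ->
    (forall u v, z' u v -> ce (x :: s) u v) -> z' (last x s) x = false ->
    forall u v, z' u v = false.
  move=> zs' ze' h' zl; apply: (pe_even_false us zs' ze') => u v zuv.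
  move: (h' _ _ zuv); rewrite /= pe_rcons; case e1: (ed _ _ _ _); last by rewrite addbF.
  by case/edP: e1 zuv => -[-> ->]; rewrite ?zl // zs' zl.
case zl: (z (last x s) x); last by left; apply: key.
(* [z] contains the closing edge, so its sum with the whole cycle misses that edge and is zero. *)
right=> u v.
have : z u v (+) ce (x :: s) u v = false.
  apply: (key (fun u v => z u v (+) ce (x :: s) u v)) => [a b||a b|].
  - by rewrite zs ce_sym.
  - exact: evenD ze (@ce_even _).
  - by case zab: (z a b); first by rewrite (h _ _ zab).
  - by rewrite zl (h _ _ zl).
by case: (z u v); case: (ce _ _ _).
Qed.

Lemma ce_split a b (B C : seq V) u v :
  ce (a :: B ++ b :: C) u v = pe a (rcons B b) u v (+) pe b (rcons C a) u v.
Proof. by rewrite /= rcons_cat rcons_cons -cat_rcons pe_cat last_rcons. Qed.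

(** In a theta graph the middle path [P] belongs to both inner cycles and cancels mod 2. *)
Lemma ce_theta a b (P A1 A2 : seq V) u v :
  ce (a :: A1 ++ b :: A2) u v
  = ce (a :: A1 ++ b :: rev P) u v (+) ce (a :: P ++ b :: A2) u v.
Proof.
rewrite !ce_split pe_rev; set p := pe a (rcons P b) u v.
by rewrite -addbA; congr (_ (+) _); rewrite addbA addbb.
Qed.

Definition te t u v := [&& u != v, u \in t & v \in t].

Lemma te_sym t u v : te t u v = te t v u.
Proof. by rewrite /te eq_sym [(u \in t) && _]andbC. Qed.

Lemma te_even t : #|t| = 3 -> evenrel (te t).
Proof.
move=> t3 v; rewrite big_addb_card.
have [vt|vt] := boolP (v \in t); last first.
  rewrite (_ : [set _ | _] = set0) ?cards0 //; apply/setP=> u.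
  by rewrite !inE /te (negbTE vt) andbF.
rewrite (_ : [set _ | _] = t :\ v); last first.
  by apply/setP=> u; rewrite !inE /te vt eq_sym.
by have := cardsD1 v t; rewrite vt t3 add1n => -[<-].
Qed.

(** The mod 2 boundary operator from sets of triangles to sets of edges. *)
Definition bdT S u v := \big[addb/false]_(t in S) te t u v.

Lemma bdT_card S u v : bdT S u v = odd #|[set t in S | te t u v]|.
Proof.
rewrite /bdT big_mkcond -big_addb_card; apply: eq_bigr => t _ /=.
by case: (t \in S).
Qed.

Lemma bdT_sym S u v : bdT S u v = bdT S v u.
Proof. by apply: eq_bigr => t _; rewrite te_sym. Qed.

Lemma bdT_even S : (forall t, t \in S -> #|t| = 3) -> evenrel (bdT S).
Proof.
by move=> h v; rewrite exchange_big /= big1 // => t tS; apply: te_even; apply: h.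
Qed.

Lemma bdT_ID S A u v : bdT S u v = bdT (S :&: A) u v (+) bdT (S :\: A) u v.
Proof. by rewrite /bdT (big_setID A). Qed.

Lemma bdT_te S u v : bdT S u v -> exists2 t, t \in S & te t u v.
Proof.
move=> h; case: (pickP [pred t in S | te t u v]) => [t /andP[tS tt]|n].
  by exists t.
move: h; rewrite /bdT big1 // => t tS; apply/negP=> tt.
by move: (n t); rewrite /= tS tt.
Qed.

Lemma eq_bdT S1 S2 u v : (forall t, te t u v -> (t \in S1) = (t \in S2)) ->
  bdT S1 u v = bdT S2 u v.
Proof.
move=> h; rewrite !bdT_card; congr (odd #|pred_of_set _|); apply/setP=> t; rewrite !inE.
by case tt: (te t u v); rewrite ?andbF // (h t tt).
Qed.

Definition edge T u v := (u != v) && [exists t in T, (u \in t) && (v \in t)].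

Lemma edgeP T u v : reflect (exists2 t, t \in T & te t u v) (edge T u v).
Proof.
apply: (iffP andP) => [[uv /existsP[t /and3P[tT ut vt]]]|[t tT /and3P[uv ut vt]]].
  by exists t => //; apply/and3P.
by split=> //; apply/existsP; exists t; apply/and3P.
Qed.

Lemma edge_sym T u v : edge T u v = edge T v u.
Proof. by apply/edgeP/edgeP => -[t tT]; rewrite te_sym => h; exists t. Qed.

Lemma edge_sub S T u v : S \subset T -> edge S u v -> edge T u v.
Proof. by move=> /subsetP sST /edgeP[t /sST tT h]; apply/edgeP; exists t. Qed.

(* A combinatorial disk: the last two fields say that the boundary map from
   sets of triangles to even sets of edges (mod 2 cycles) is onto, resp.
   one-to-one. *)
Record disk T c : Prop := Disk {
  d_uniq : uniq c;
  d_size : 2 < size c;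
  d_card : forall t, t \in T -> #|t| = 3;
  d_two : forall u v, #|[set t in T | te t u v]| <= 2;
  d_bd : forall u v, bdT T u v = ce c u v;
  d_bd_onto : forall z, (forall u v, z u v = z v u) ->
    (forall u v, z u v -> edge T u v) -> evenrel z ->
    exists2 S : {set {set V}}, S \subset T & forall u v, z u v = bdT S u v;
  d_bd_inj : forall S : {set {set V}}, S \subset T -> (forall u v, bdT S u v = false) -> S = set0 }.

Lemma disk_rot T s1 s2 : disk T (s1 ++ s2) -> disk T (s2 ++ s1).
Proof.
case=> h1 h2 h3 h4 h5 h6 h7; split=> //; first by rewrite uniq_catC.
  by rewrite size_cat addnC -size_cat.
by move=> u v; rewrite h5 ce_rot.
Qed.

(** * Connectedness of a combinatorial disk and of its stars *)

Section Disk.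
Variables (T : {set {set V}}) (c : seq V).
Hypothesis D : disk T c.

(** A boundary edge lies in an odd number of triangles, hence in one, as [d_two] allows at most
    two. *)
Lemma bd_one t u v : t \in T -> te t u v -> bdT T u v ->
  forall t', t' \in T -> te t' u v -> t' = t.
Proof.
move=> tT tt; rewrite bdT_card => o t' t'T tt'.
have c1 : #|[set t in T | te t u v]| = 1.
  by move: o (d_two D u v); case: #|_| => [|[|[|]]].
have /cards1P[x ex] : #|[set t in T | te t u v]| == 1 by rewrite c1.
have : t \in [set x] by rewrite -ex inE tT.
have : t' \in [set x] by rewrite -ex inE t'T.
by rewrite !inE => /eqP-> /eqP->.
Qed.

Lemma bd_two t1 t2 A u v : t1 \in T -> t2 \in T -> t1 != t2 ->
  te t1 u v -> te t2 u v -> A \subset T -> bdT A u v = (t1 \in A) (+) (t2 \in A).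
Proof.
move=> t1T t2T n12 e1 e2 sA.
have E : [set t in T | te t u v] = [set t1; t2].
  apply/esym/eqP; rewrite eqEcard cards2 n12 (d_two D) andbT.
  by apply/subsetP=> t; rewrite !inE => /orP[] /eqP->; apply/andP.
have : [set t in A | te t u v] = A :&: [set t1; t2].
  rewrite -E; apply/setP=> t; rewrite !inE.
  by case tA: (t \in A) => //=; rewrite (subsetP sA).
rewrite bdT_card => ->.
have -> : A :&: [set t1; t2] =
    (if t1 \in A then [set t1] else set0) :|: (if t2 \in A then [set t2] else set0).
  apply/setP=> t; rewrite !inE !(fun_if (fun B : {set {set V}} => t \in B)) !inE.
  have [->|n1] := eqVneq t t1; first by rewrite (negbTE n12) if_same orbF andbT; case: (t1 \in A).
  rewrite if_same /=; have [->|n2] := eqVneq t t2; first by rewrite andbT; case: (t2 \in A).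
  by rewrite andbF if_same.
case: (t1 \in A); case: (t2 \in A); rewrite ?cards0 ?set0U ?setU0 ?cards1 ?cards2 ?n12 //=.
by rewrite cards0.
Qed.

(** The boundary of such an [S] lies in that of [T], which is a simple cycle, so it is empty or all
    of it. Injectivity of the boundary operator then determines [S]. This says that the disk is
    connected through edges. *)
Lemma adjacency_closed S : S \subset T ->
  (forall u v t t', t \in S -> t' \in T -> te t u v -> te t' u v -> t' \in S) ->
  S = set0 \/ S = T.
Proof.
move=> sS cl.
have sub u v : bdT S u v -> bdT S u v = bdT T u v.
  case/bdT_te=> t tS tt; apply: eq_bdT => t' tt'; apply/idP/idP => [/(subsetP sS)//|t'T].
  exact: cl tS t'T tt tt'.
case: (@even_subcycle c (bdT S) (d_uniq D)) => [u v||u v h|h|h].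
- exact: bdT_sym.
- by apply: bdT_even => t /(subsetP sS); apply: (d_card D).
- by rewrite -(d_bd D) -(sub _ _ h).
- by left; apply: (d_bd_inj D).
right; apply/eqP; rewrite eqEsubset sS -setD_eq0 /=; apply/eqP.
apply: (d_bd_inj D); first exact: subsetDl.
move=> u v; have := bdT_ID T S u v.
by rewrite (setIidPr sS) h (d_bd D); case: (ce _ _ _); case: (bdT _ _ _).
Qed.

(** No vertex pinches the disk: the star of [v] is connected through the edges at [v]. A triangle
    [t1] of the star outside [A] contradicts either the evenness at [v] of a boundary or the
    connectedness of the disk, according to whether the rest of the link edges can be joined away
    from [v]. *)
Lemma star_connected v (A : {set {set V}}) : A \subset T -> A != set0 ->
  (forall t, t \in A -> v \in t) ->
  (forall u t t', t \in A -> t' \in T -> te t v u -> te t' v u -> t' \in A) ->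
  forall t, t \in T -> v \in t -> t \in A.
Proof.
move=> sA /set0Pn[t0 t0A] Av cl t1 t1T vt1; apply/negPn/negP=> t1A.
have t0T := subsetP sA _ t0A.
have other t : t \in T -> v \in t -> exists2 a, a != v & te t v a.
  move=> tT vt; have := d_card D tT; rewrite (cardsD1 v) vt add1n => -[h].
  have : 0 < #|t :\ v| by rewrite h.
  by case/card_gt0P=> a; rewrite !inE => /andP[av at_]; exists a; rewrite // /te eq_sym av vt.
have [a0 a0v ta0] := other _ t0T (Av _ t0A).
have [b0 b0v tb0] := other _ t1T vt1.
pose e := [rel x y | [&& edge T x y, x != v & y != v]].
have es : symmetric e.
  by move=> x y; rewrite /= edge_sym [(y != v) && _]andbC.
pose linkA u := [exists t in A, te t v u].
have linkP u : reflect (exists2 t, t \in A & te t v u) (linkA u) by apply: exists_inP.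
have lb : linkA b0 = false.
  apply/idP=> /linkP[t tA tt].
  by rewrite (cl b0 t t1) in t1A.
(* Neighbours [a0] and [b0] of [v] are taken in [t0] and in [t1]. If a path avoiding [v] joins them,
   it closes up through [v] to a cycle, which bounds some [X]. *)
have [co|nco] := boolP (connect e a0 b0).
  case/connectP: co => p' pp' ep'; case: (shortenP pp') ep' => p pp up _ eb {p' pp'}.
  have vp : v \notin a0 :: p.
    rewrite inE negb_or eq_sym a0v /=.
    elim: p a0 {up eb ta0 a0v} pp => //= y p IH a /andP[/and3P[_ _ yv] pp].
    by rewrite inE negb_or eq_sym yv (IH y).
  pose z := ce (v :: a0 :: p).
  have zE u w : z u w = ed v a0 u w (+) pe a0 p u w (+) ed b0 v u w.
    by rewrite /z /= pe_rcons -eb addbA.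
  have [X sX zX] : exists2 X : {set {set V}}, X \subset T & forall u w, z u w = bdT X u w.
    apply: (d_bd_onto D) => [u w|u w|]; [exact: ce_sym| |exact: ce_even].
    rewrite zE; case h1: (ed v a0 u w) => /=.
      move=> _; apply/edgeP; exists t0 => //.
      by case/edP: h1 => -[-> ->] //; rewrite te_sym.
    case h2: (pe a0 p u w) => /=.
      by move=> _; have /andP[] := pe_path es pp h2.
    move=> h3; apply/edgeP; exists t1 => //.
    by case/edP: h3 => -[-> ->] //; rewrite te_sym.
  have zv u : z v u = (u == a0) (+) (u == b0).
    rewrite zE; case h2: (pe a0 p v u).
      by case: (pe_in h2) => h3; rewrite h3 in vp.
    by rewrite addbF /ed eqxx [v == a0]eq_sym (negbTE a0v) [v == b0]eq_sym (negbTE b0v) /= addbF.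
  (* At [v] the boundary of [X :&: A] consists of those edges of the cycle that lie in a triangle of
     [A]. Of the two edges [v a0] and [v b0] only the first does, so [v] would have degree one. *)
  have : \big[addb/false]_u bdT (X :&: A) v u = false.
    by apply: bdT_even => t /setIP[/(subsetP sX) tT _]; apply: (d_card D).
  rewrite (@eq_bigr _ _ _ _ _ _ _ (fun u => linkA u && z v u)); last first.
    move=> u _; case l: (linkA u) => /=.
      rewrite zX; apply: eq_bdT => t tt; rewrite inE.
      case tX: (t \in X) => //=.
      case/linkP: l => t' t'A tt'.
      exact: (cl u t' t t'A (subsetP sX _ tX) tt' tt).
    apply/negP=> /bdT_te[t]; rewrite inE => /andP[tX tA tt].
    by case/negP: (negbT l); apply/linkP; exists t.
  have la : linkA a0 by apply/linkP; exists t0.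
  rewrite (@big_addb1 a0) => [|u ua]; rewrite zv; last first.
    rewrite (negbTE ua) /=; case: eqP => [->|]; rewrite ?andbF //.
    by rewrite lb.
  rewrite la eqxx; case: eqP => // ab; by rewrite -ab la in lb.
(* No such path exists: the triangles reached from [a0] away from [v] form a set closed under
   adjacency that contains [t0] but not [t1]. *)
pose S := [set t in T | [exists u, [&& u \in t, u != v & connect e a0 u]]].
have SP t : t \in T -> forall u, u \in t -> u != v -> (t \in S) = connect e a0 u.
  move=> tT u ut uv; rewrite inE tT /=; apply/existsP/idP => [[w /and3P[wt wv aw]]|h].
    have [<-//|wu] := eqVneq w u.
    apply: (connect_trans aw); apply: connect1; rewrite /= uv wv !andbT.
    by apply/edgeP; exists t => //; rewrite /te wu wt.
  by exists u; rewrite ut uv.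
have : S = set0 \/ S = T.
  apply: adjacency_closed; first by apply/subsetP=> t; rewrite inE => /andP[].
  move=> u w t t' tS t'T.
  have tT : t \in T by move: tS; rewrite inE => /andP[].
  case/and3P=> uw ut wt /and3P[_ ut' wt'].
  have [e1|uv] := eqVneq u v.
    have wv : w != v by rewrite -e1 eq_sym.
    by rewrite (SP _ t'T w) // -(SP _ tT w).
  by rewrite (SP _ t'T u) // -(SP _ tT u).
case=> E.
  have : t0 \in S by rewrite (SP _ t0T a0) //; case/and3P: ta0.
  by rewrite E inE.
have : t1 \in S by rewrite E.
by rewrite (SP _ t1T b0) ?(negbTE nco) //; case/and3P: tb0.
Qed.


(** Such an edge has exactly two triangles, one on each side, so it counts once in [S] and twice in
    [T]. *)
Lemma common_edge S u v : S \subset T -> edge S u v -> edge (T :\: S) u v ->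
  bdT S u v /\ ~~ bdT T u v.
Proof.
move=> sS /edgeP[t tS tt] /edgeP[t' ]; rewrite inE => /andP[t'S t'T] tt'.
have tT := subsetP sS _ tS.
have n : t != t' by apply: contraNneq t'S => <-.
by rewrite !(@bd_two t t' _ u v) // tS t'T tT (negbTE t'S).
Qed.

Lemma two_only t1 t2 t u v : t1 \in T -> t2 \in T -> t1 != t2 -> t \in T ->
  te t1 u v -> te t2 u v -> te t u v -> t = t1 \/ t = t2.
Proof.
move=> t1T t2T n12 tT e1 e2 e.
have E : [set t in T | te t u v] = [set t1; t2].
  apply/esym/eqP; rewrite eqEcard cards2 n12 (d_two D) andbT.
  by apply/subsetP=> t'; rewrite !inE => /orP[] /eqP->; apply/andP.
have : t \in [set t in T | te t u v] by rewrite inE tT.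
by rewrite E !inE => /orP[] /eqP; [left|right].
Qed.

(** A cycle of edges of [S] bounds some [X] in [T]. The boundary of the part of [X] outside [S] can
    only use edges common to [S] and its complement; these lie in a simple path, so that boundary is
    zero and [X] lies in [S]. *)
Lemma sub_disk S c1 a s : S \subset T -> uniq c1 -> 2 < size c1 ->
  (forall u v, bdT S u v = ce c1 u v) -> uniq (a :: s) ->
  (forall u v, edge S u v -> edge (T :\: S) u v -> pe a s u v) -> disk S c1.
Proof.
move=> sS u1 s1 b1 us co; split=> //.
- by move=> t /(subsetP sS); apply: (d_card D).
- move=> u v; apply: leq_trans (d_two D u v); apply: subset_leq_card.
  by apply/subsetP=> t; rewrite !inE => /andP[/(subsetP sS)-> ->].
- move=> z zs zS ze.
  have [|X sX zX] := d_bd_onto D zs _ ze; first by move=> u v /zS; apply: edge_sub.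
  have card3 : forall t, t \in X -> #|t| = 3.
    by move=> t /(subsetP sX); apply: (d_card D).
  have X0 : X :\: S = set0.
    apply: (d_bd_inj D); first exact: subset_trans (subsetDl _ _) sX.
    apply: (pe_even_false us); first exact: bdT_sym.
      by apply: bdT_even => t; rewrite inE => /andP[_ /card3].
    move=> u v h; apply: co.
      move: (zX u v); rewrite (bdT_ID X S) h addbT => zuv.
      have [|h2] := boolP (bdT (X :&: S) u v).
        by case/bdT_te=> t /setIP[_ tS] tt; apply/edgeP; exists t.
      by apply: zS; rewrite zuv h2.
    case/bdT_te: h => t /setDP[/(subsetP sX) tT tS] tt; apply/edgeP; exists t => //.
    by rewrite inE tS.
  by exists X => //; rewrite -setD_eq0 X0.
- by move=> X /subset_trans/(_ sS); apply: (d_bd_inj D).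
Qed.

End Disk.

(** * Cutting a disk along a path *)

Lemma pe_ends a (A : seq V) b : uniq (a :: rcons A b) -> pe a (rcons A b) a b -> A = [::].
Proof.
case: A => // x A; rewrite [rcons _ _]/= => /= /and3P[].
rewrite inE negb_or mem_rcons => /andP[ax aA]; rewrite mem_rcons inE negb_or => /andP[xb _] _.
case h: (pe x (rcons A b) a b).
  by case: (pe_in h); rewrite inE mem_rcons (negbTE ax) (negbTE aA).
rewrite /ed eqxx (negbTE ax) /= !addbF => /eqP e.
by rewrite e eqxx in xb.
Qed.

(** The two arcs of a cycle meet only in [a] and [b], so a common edge would be [ab]; each arc would
    be that single edge, and the cycle too short. *)
Lemma arcs_disjoint a b (A1 A2 : seq V) u v :
  uniq (a :: A1 ++ b :: A2) -> 2 < size (a :: A1 ++ b :: A2) ->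
  pe a (rcons A1 b) u v -> pe b (rcons A2 a) u v -> False.
Proof.
move=> U sz h1 h2.
have U1 : uniq (a :: rcons A1 b).
  by move: U; rewrite -cat_rcons -cat_cons cat_uniq => /andP[].
have U2 : uniq (b :: rcons A2 a).
  by move: U; rewrite -[a :: _]/([:: a] ++ _) uniq_catC -catA /= cats1 cat_uniq => /and3P[].
have ab : a != b by move: U1; rewrite /= mem_rcons inE negb_or => /andP[/andP[]].
have K w : w \in a :: rcons A1 b -> w \in b :: rcons A2 a -> w = a \/ w = b.
  rewrite !inE !mem_rcons !inE.
  case: (eqVneq w a) => [->|wa]; first by left.
  case: (eqVneq w b) => [->|wb] /=; first by right.
  move=> w1 w2; move: U; rewrite /= cat_uniq => /and4P[_ _ /hasPn/(_ w)].
  by rewrite inE w2 orbT w1 => /(_ isT).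
have uv : u != v.
  by apply: contraTneq h1 => ->; rewrite pe_irr.
have [[p1 p2] [q1 q2]] := (pe_in h1, pe_in h2).
have ab1 : pe a (rcons A1 b) a b /\ pe b (rcons A2 a) b a.
  case: (K u p1 q1) (K v p2 q2) => eu [] ev; move: uv h1 h2; rewrite eu ev ?eqxx // => _ h1 h2.
    by split; last rewrite pe_sym.
  by split; first rewrite pe_sym.
case: ab1 => /(pe_ends U1) e1 /(pe_ends U2) e2.
by move: sz; rewrite e1 e2.
Qed.

(** By [ce_theta] the complement of [S] is bounded by the other inner cycle of the theta graph. An
    edge common to both sides is in the boundary of [S] and not in that of [T], hence on the path,
    and [sub_disk] applies to both sides. *)
Lemma theta_disk T a b (P A1 A2 : seq V) S :
  disk T (a :: A1 ++ b :: A2) ->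
  uniq (a :: A1 ++ b :: rev P) -> uniq (a :: P ++ b :: A2) ->
  2 < size (a :: A1 ++ b :: rev P) -> 2 < size (a :: P ++ b :: A2) ->
  S \subset T -> (forall u v, bdT S u v = ce (a :: A1 ++ b :: rev P) u v) ->
  [/\ disk S (a :: A1 ++ b :: rev P), disk (T :\: S) (a :: P ++ b :: A2),
      (forall u v, edge S u v -> edge (T :\: S) u v -> pe a (rcons P b) u v) &
      (forall x t t', t \in S -> t' \in T :\: S -> x \in t -> x \in t' ->
         x \in a :: rcons P b)].
Proof.
move=> D U1 U2 z1 z2 sS bS.
have bS' u v : bdT (T :\: S) u v = ce (a :: P ++ b :: A2) u v.
  have := bdT_ID T S u v; rewrite (d_bd D) (setIidPr sS) bS (ce_theta _ _ P).
  by case: (ce _ _ _) (ce _ _ _) (bdT _ _ _) => -[] [].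
have UP : uniq (a :: rcons P b).
  by move: U2; rewrite -cat_rcons -cat_cons cat_uniq => /andP[].
have co u v : edge S u v -> edge (T :\: S) u v -> pe a (rcons P b) u v.
  move=> h1 h2; have [] := common_edge D sS h1 h2.
  rewrite bS (d_bd D) !ce_split pe_rev.
  case h: (pe a (rcons P b) u v) => //; rewrite addbF => h3; rewrite h3 /= negbK => h4.
  by case: (arcs_disjoint (d_uniq D) (d_size D) h3 h4).
have ss : T :\: (T :\: S) = S by rewrite setDDr setDv set0U (setIidPr sS).
split=> //.
- exact: (sub_disk D sS U1 z1 bS UP co).
- apply: (sub_disk D (subsetDl _ _) U2 z2 bS' UP) => u v h1; rewrite ss => h2; exact: co.
move=> x t t' tS t'S xt xt'; apply/negPn/negP=> xP.
have t'T : t' \in T by move: t'S; rewrite inE => /andP[].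
(* If [x] is off the path, no edge at [x] leads from [S] to its complement, so the whole star of [x]
   lies in [S]. *)
suff : t' \in [set t in S | x \in t].
  by move: t'S; rewrite !inE => /andP[/negbTE->].
apply: (star_connected D (v := x)) => //.
- by apply/subsetP=> w; rewrite inE => /andP[/(subsetP sS)].
- by apply/set0Pn; exists t; rewrite inE tS.
- by move=> w; rewrite inE => /andP[].
move=> u w w'; rewrite inE => /andP[wS xw] w'T tw tw'.
have xw' : x \in w' by case/and3P: tw'.
rewrite inE xw' andbT; apply/negPn/negP=> w'S.
have : pe a (rcons P b) x u.
  by apply: co; apply/edgeP; [exists w|exists w' => //; rewrite inE w'S].
by case/pe_in => h; rewrite h in xP.
Qed.

(** * Fans at a boundary vertex *)

Lemma te3 x y w u v : x != y -> y != w -> x != w ->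
  te [set x; y; w] u v = ed x y u v (+) ed y w u v (+) ed x w u v.
Proof.
move=> xy yw xw; rewrite /te /ed !inE.
have [yx wy wx] : [/\ y != x, w != y & w != x] by split; rewrite eq_sym.
have N := (negbTE xy, negbTE yw, negbTE xw, negbTE yx, negbTE wy, negbTE wx, eqxx).
have xorE p q : p != q -> (v == p) || (v == q) = (v == p) (+) (v == q).
  by move=> pq; have [->|] := eqVneq v p; rewrite ?(negbTE pq).
have [->|ux] := eqVneq u x.
  rewrite !N /= !addbF [x == v]eq_sym -xorE //.
  by have [->|] := eqVneq v x; rewrite ?N.
have [->|uy] := eqVneq u y.
  rewrite !N /= !addbF [y == v]eq_sym -xorE //.
  by have [->|] := eqVneq v y; rewrite ?N ?orbF ?orbT //= orbC.
have [->|uw] := eqVneq u w; last by rewrite /= andbF.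
rewrite /= [w == v]eq_sym addbC -xorE //.
by have [->|] := eqVneq v w; rewrite ?N //= orbF.
Qed.

Lemma card3 x y w : x != y -> y != w -> x != w -> #|[set x; y; w]| = 3.
Proof.
by move=> xy yw xw; rewrite setUC cardsU1 cards2 xy !inE negb_or ![w == _]eq_sym xw yw.
Qed.

Lemma card3_eq t x y w : #|t| = 3 -> x != y -> y != w -> x != w ->
  x \in t -> y \in t -> w \in t -> t = [set x; y; w].
Proof.
move=> t3 xy yw xw xt yt wt; apply/esym/eqP; rewrite eqEcard t3 card3 // andbT.
by apply/subsetP=> u; rewrite !inE => /orP[/orP[]|] /eqP->.
Qed.

Fixpoint fan v x s : seq {set V} :=
  if s is y :: s' then [set v; x; y] :: fan v y s' else [::].

Lemma fan_in v x s t u : t \in fan v x s -> u \in t -> u \in v :: x :: s.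
Proof.
elim: s x => //= y s IH x; rewrite inE => /orP[/eqP->|/IH{}IH /IH].
  by rewrite !inE => /orP[/orP[]|] ->; rewrite ?orbT.
by rewrite !inE => /orP[|] ->; rewrite ?orbT.
Qed.

Lemma fan_split v x s t : t \in fan v x s ->
  exists s1 y s2, s = s1 ++ y :: s2 /\ t = [set v; last x s1; y].
Proof.
elim: s x => //= y s IH x; rewrite inE => /orP[/eqP->|/IH[s1 [w [s2 [-> ->]]]]].
  by exists [::], y, s.
by exists (y :: s1), w, s2.
Qed.

Lemma mem_fan v x s1 y s2 : [set v; last x s1; y] \in fan v x (s1 ++ y :: s2).
Proof. by elim: s1 x => [|w s1 IH] x /=; rewrite inE ?eqxx // IH orbT. Qed.

Lemma fan_uniq v x s : uniq (x :: s) -> v \notin x :: s -> uniq (fan v x s).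
Proof.
elim: s x => // y s IH x /andP[xs us]; rewrite inE negb_or => /andP[vx vs].
rewrite /= IH // andbT; apply/negP=> h; have := fan_in (u := x) h.
rewrite !inE eqxx orbT => /(_ isT) /orP[/eqP e|h']; first by rewrite e eqxx in vx.
by move: xs; rewrite inE h'.
Qed.

(** The inner spokes belong to two consecutive triangles and cancel; the path and the two extreme
    spokes remain. *)
Lemma bdT_fan v x s u w : uniq (x :: s) -> v \notin x :: s ->
  bdT [set t in fan v x s] u w =
  pe x s u w (+) (ed v x u w (+) ed v (last x s) u w).
Proof.
move=> us vs; rewrite /bdT.
rewrite (eq_bigl (fun t => t \in fan v x s)); last by move=> t; rewrite inE.
rewrite -big_uniq ?fan_uniq //=.
elim: s x us vs => [|y s IH] x us vs /=; first by rewrite big_nil addbb.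
move: us vs => /andP[xs us]; rewrite inE negb_or => /andP[vx vs].
rewrite big_cons te3 //; last by move: vs; rewrite inE negb_or => /andP[].
  rewrite (IH y us vs).
  by case: (ed x y u w) (ed v x u w) (ed v y u w) (pe y s u w) => -[] [] [] /=; case: (ed _ _ _ _).
by move: xs; rewrite inE negb_or => /andP[].
Qed.

Lemma ce_head x y s w : uniq (x :: y :: s) ->
  ce (x :: y :: s) x w = (w == y) (+) (w == last y s).
Proof.
move=> /andP[xs _] /=; rewrite pe_rcons /ed eqxx.
have xy : x != y by move: xs; rewrite inE negb_or => /andP[].
have xl : x != last y s by apply: contraNneq xs => ->; apply: mem_last.
rewrite (negbTE xy) (negbTE xl) /= addbF.
case h: (pe y s x w); first by case: (pe_in h) => h1; rewrite h1 in xs.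
by rewrite addFb.
Qed.

(** The link of [v] joins [a] to [b] because the star of [v] is connected. A simple path in the link
    gives a fan, and the fan exhausts the star, again by connectedness. *)
Lemma corner_fan T a v b rest : disk T (a :: v :: b :: rest) ->
  exists P, [/\ uniq (a :: rcons P b), v \notin a :: rcons P b,
    (forall t, t \in fan v a (rcons P b) -> t \in T) &
    (forall t, t \in T -> v \in t -> t \in fan v a (rcons P b))].
Proof.
move=> D; have U := d_uniq D.
have [av vb ab] : [/\ a != v, v != b & a != b].
  by move: U; rewrite /= !inE !negb_or => /and3P[/and3P[-> -> _] /andP[-> _] _].
have U' : uniq (v :: b :: rcons rest a).
  by move: U; rewrite -[a :: _]/([:: a] ++ _) uniq_catC /= cats1.
have bva w : bdT T v w = (w == b) (+) (w == a).
  have E : ce (a :: v :: b :: rest) v w = ce (v :: b :: rcons rest a) v w.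
    by rewrite -[a :: _]/([:: a] ++ _) ce_rot cats1.
  by rewrite (d_bd D) E ce_head // last_rcons.
have [ba bb] : bdT T v a /\ bdT T v b.
  by rewrite !bva !eqxx (negbTE ab) eq_sym (negbTE ab).
have [t0 t0T tt0] := bdT_te ba; have [t1 t1T tt1] := bdT_te bb.
(* The link of [v] as a graph. *)
pose G := [rel x y | [&& [set v; x; y] \in T, x != y, x != v & y != v]].
have co : connect G a b.
  pose A := [set t in T | (v \in t) && [exists x in t, (x != v) && connect G a x]].
  have : t1 \in A.
    apply: (star_connected D (v := v)) => //; last by case/and3P: tt1.
    - by apply/subsetP=> t; rewrite inE => /andP[].
    - apply/set0Pn; exists t0; rewrite inE t0T; case/and3P: tt0 => _ -> a0 /=.
      by apply/existsP; exists a; rewrite a0 av connect0.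
    - by move=> t; rewrite inE => /and3P[].
    move=> u t t'; rewrite !inE => /and3P[tT vt /existsP[x /and3P[xt xv ax]]] t'T.
    move=> /and3P[vu _ ut] /and3P[_ vt' ut']; rewrite t'T vt' /=.
    apply/existsP; exists u; rewrite ut' eq_sym vu /=.
    have [<-//|xu] := eqVneq x u; apply: connect_trans ax (connect1 _).
    have [vx uv] : v != x /\ u != v by split; rewrite eq_sym.
    by rewrite /= xu xv uv !andbT -(card3_eq (d_card D tT) vx xu vu).
  rewrite inE => /and3P[_ vt /existsP[x /and3P[xt xv ax]]].
  have [<-//|xb] := eqVneq x b; apply: connect_trans ax (connect1 _).
  have [_ _ bt] := and3P tt1.
  have [vx bv] : v != x /\ b != v by split; rewrite eq_sym.
  by rewrite /= xb xv bv !andbT -(card3_eq (d_card D t1T) vx xb vb).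
case/connectP: co => s' ps' es'; case: (shortenP ps') es' => s ps us _ es {s' ps'}.
have [P sE] : exists P, s = rcons P b.
  case/lastP: s es {ps us} => [e|P y]; first by rewrite e eqxx in ab.
  by rewrite last_rcons => ->; exists P.
exists P; rewrite -sE.
have vs : v \notin a :: s.
  rewrite inE negb_or eq_sym av /=; elim: s (a) ps {us es sE} => //= y s IH x.
  by move=> /andP[/and4P[_ _ _ yv] ps]; rewrite inE negb_or eq_sym yv (IH y).
have fT t : t \in fan v a s -> t \in T.
  move=> /fan_split[s1 [y [s2 [e ->]]]]; move: ps; rewrite e cat_path /=.
  by case/and3P=> _ /and4P[].
have fT' := fT; split=> // t tT vt.
suff : t \in [set t in fan v a s] by rewrite inE.
(* The fan cannot be left across a spoke: the extreme spokes [va] and [vb] are boundary edges with a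
   single triangle, and an inner spoke already has its two triangles in the fan. *)
apply: (star_connected D (v := v)) => //.
- by apply/subsetP=> w; rewrite inE; apply: fT.
- apply/set0Pn; move: es; case: (s) ab => [|y s2 _ _]; first by move=> /eqP ab /esym.
  by exists [set v; a; y]; rewrite inE /= inE eqxx.
- by move=> w; rewrite inE => /fan_split[s1 [y [s2 [_ ->]]]]; rewrite !inE eqxx.
move=> u w w'; rewrite !inE => wf w'T tw tw'.
have : u \in a :: s.
  have [vu _ uw] := and3P tw; move: (fan_in wf uw).
  by rewrite inE eq_sym (negbTE vu).
have mid s1 y s2 : s = s1 ++ y :: s2 ->
    let t := [set v; last a s1; y] in [/\ t \in fan v a s, te t v (last a s1) & te t v y].
  move=> e /=; rewrite e mem_fan; split=> //; rewrite /te !inE !eqxx ?orbT andbT.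
    have : last a s1 \in a :: s by rewrite e -cat_cons mem_cat mem_last.
    by apply: contraTneq => <-.
  by rewrite andbT; apply: contraNneq vs => ->; rewrite e -cat_cons mem_cat mem_head orbT.
rewrite inE => /orP[/eqP ua|us1].
  subst u; case: (s) mid es fT' => [|y s2] mid es fT'; first by rewrite es eqxx in ab.
  have [h1 h2 _] := mid [::] y s2 erefl.
  by rewrite (bd_one D (fT' _ h1) h2 ba w'T tw').
case/splitPr: us1 mid vs us es {ps sE fT wf tw} fT' => s1 s2 mid vs us es fT'.
have [h1 _ h2] := mid s1 u s2 erefl.
case: s2 => [|y s3] in mid vs us es fT' h1 h2 *.
  rewrite last_cat /= in es; subst u.
  by rewrite (bd_one D (fT' _ h1) h2 bb w'T tw').
have := mid (rcons s1 u) y s3; rewrite cat_rcons last_rcons => /(_ erefl)[h3 h4 _].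
have n12 : [set v; last a s1; u] != [set v; u; y].
  apply/eqP=> /setP/(_ y); rewrite !inE eqxx orbT.
  have yv : y != v.
    by apply: contraNneq vs => <-; rewrite inE mem_cat !inE eqxx !orbT.
  move: us; rewrite -cat_cons cat_uniq => /and3P[_ /hasPn/(_ y)].
  rewrite !inE eqxx orbT => /(_ isT) ny /= /andP[]; rewrite inE negb_or => /andP[uy _] _.
  have yl : y != last a s1.
    by apply: contraNneq ny => ->; rewrite -in_cons mem_last.
  by rewrite (negbTE yv) (negbTE yl) eq_sym (negbTE uy).
by case: (two_only D (fT' _ h1) (fT' _ h3) n12 w'T h2 h4 tw') => ->.
Qed.

End Parity.

Local Open Scope ring_scope.

(** * Signed areas *)

Section SubseqTriples.
Variable T : eqType.
Implicit Types (x y z : T) (s : seq T).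

Lemma sub2_cat x y s1 s2 : subseq [:: x; y] (s1 ++ s2) ->
  [\/ subseq [:: x; y] s1, x \in s1 /\ y \in s2 | subseq [:: x; y] s2].
Proof.
elim: s1 => [|h s1 IH] /=; first by constructor 3.
case: eqP => [->|_].
  rewrite sub1seq mem_cat => /orP[ys|ys]; first by constructor 1; rewrite sub1seq.
  by constructor 2; rewrite mem_head.
case/IH => [h1|[xs ys]|h1]; [by constructor 1|constructor 2|by constructor 3].
by rewrite inE xs orbT.
Qed.

Lemma sub3_cat x y z s1 s2 : subseq [:: x; y; z] (s1 ++ s2) ->
  subseq [:: x; y; z] s1 \/ subseq [:: x; y] s1 /\ z \in s2 \/
  x \in s1 /\ subseq [:: y; z] s2 \/ subseq [:: x; y; z] s2.
Proof.
elim: s1 => [|h s1 IH] /=; first by right; right; right.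
case: eqP => [->|_].
  case/sub2_cat => [h1|[xs ys]|h1]; [by left| |].
    by right; left; rewrite sub1seq.
  by right; right; left; rewrite mem_head.
case/IH => [h1|[[h1 h2]|[[h1 h2]|h1]]]; [by left|by right; left| |by right; right; right].
by right; right; left; rewrite inE h1 orbT.
Qed.

Lemma sub2_total x y s : x \in s -> y \in s -> x != y ->
  subseq [:: x; y] s || subseq [:: y; x] s.
Proof.
move=> + + xy; elim: s => //= h s IH; rewrite !inE.
case: (eqVneq x h) => [ex|xh]; case: (eqVneq y h) => [ey|yh] //=.
- by rewrite ex ey eqxx in xy.
- by move=> _ ys; rewrite sub1seq ys.
- by move=> xs _; rewrite (sub1seq x) xs orbT.
Qed.

Lemma sub2_index x y s : uniq s -> subseq [:: x; y] s -> (index x s < index y s)%N.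
Proof.
elim: s => //= h s IH /andP[hs us].
case: (eqVneq x h) => [_|xh].
  by rewrite sub1seq => ys; case: (eqVneq h y) => // e; rewrite e ys in hs.
move=> h1; case: (eqVneq h y) => [e|_]; last by rewrite ltnS; apply: IH.
by move: hs; rewrite e (mem_subseq h1) // !inE eqxx orbT.
Qed.

End SubseqTriples.

Section Area.
Variable R : realFieldType.
Local Notation pt := 'rV[R]_2.
Implicit Types (p q r x y z u v w l m : pt).

Lemma ptP p q : p 0 0 = q 0 0 -> p 0 1 = q 0 1 -> p = q.
Proof.
move=> h0 h1; apply/rowP=> i; case: (unliftP 0 i) => [j ->|-> //].
by rewrite (ord1 j); have -> : lift 0 0 = 1 :> 'I_2 by apply/val_inj.
Qed.

(** Twice the signed area of the triangle, positive if it is counterclockwise; as a function of [x],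
    an affine form vanishing on the line [pq]. *)
Definition area p q x : R :=
  (q 0 0 - p 0 0) * (x 0 1 - p 0 1) - (q 0 1 - p 0 1) * (x 0 0 - p 0 0).

Lemma area_cyc p q x : area p q x = area q x p.
Proof. rewrite /area; ring. Qed.

Lemma areaC p q x : area q p x = - area p q x.
Proof. rewrite /area; ring. Qed.

Lemma areaC23 p q x : area p x q = - area p q x.
Proof. rewrite /area; ring. Qed.

Lemma areaC13 p q x : area x q p = - area p q x.
Proof. rewrite /area; ring. Qed.

Lemma area_pp p x : area p p x = 0.
Proof. rewrite /area; ring. Qed.

Lemma area_pqp p q : area p q p = 0.
Proof. rewrite /area; ring. Qed.

Lemma area_pqq p q : area p q q = 0.
Proof. rewrite /area; ring. Qed.

Lemma area_sum p q r x : area q r x + area r p x + area p q x = area p q r.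
Proof. rewrite /area; ring. Qed.

(** The affine form [area u v] evaluated in barycentric coordinates of [x] with respect to [pqr],
    denominators cleared so that degenerate triangles need no separate case. *)
Lemma area_bary p q r u v x :
  area p q r * area u v x
  = area q r x * area u v p + area r p x * area u v q + area p q x * area u v r.
Proof. rewrite /area; ring. Qed.

Lemma area_line p q x y (k : R) :
  area p q (x + k *: (y - x)) = (1 - k) * area p q x + k * area p q y.
Proof. rewrite /area !mxE; ring. Qed.

Lemma area_conv3 p q x y z (a b c : R) : a + b + c = 1 ->
  area p q (a *: x + b *: y + c *: z) = a * area p q x + b * area p q y + c * area p q z.
Proof. move=> h; have -> : a = 1 - b - c by lra. rewrite /area !mxE; ring. Qed.

Lemma collinear_param p q x : p != q -> area p q x = 0 -> exists k, x = p + k *: (q - p).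
Proof.
rewrite /area => pq h.
have [h0|h0] := eqVneq (q 0 0) (p 0 0).
  have h1 : q 0 1 - p 0 1 != 0.
    by apply: contra_neq pq => h1; apply: ptP => //; lra.
  exists ((x 0 1 - p 0 1) / (q 0 1 - p 0 1)); apply: ptP; rewrite !mxE.
    rewrite h0 subrr mulr0 addr0; apply/eqP; rewrite -subr_eq0; apply/eqP.
    by apply: (mulfI h1); rewrite mulr0 -[RHS]oppr0 -h h0; ring.
  by rewrite divfK // addrC subrK.
have h1 : q 0 0 - p 0 0 != 0 by rewrite subr_eq0.
exists ((x 0 0 - p 0 0) / (q 0 0 - p 0 0)); apply: ptP; rewrite !mxE.
  by rewrite divfK // addrC subrK.
by apply: (mulfI h1); rewrite mulrDr mulrCA mulrA divfK //; lra.
Qed.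

(** An affine form that vanishes at three noncollinear points is zero; testing it at [u] shifted by
    the unit vectors gives [u = v]. *)
Lemma area_all0 p q r u v : area p q r != 0 ->
  area u v p = 0 -> area u v q = 0 -> area u v r = 0 -> u = v.
Proof.
move=> n0 hp hq hr; have K x : area u v x = 0.
  by apply: (mulfI n0); rewrite (area_bary p q r) hp hq hr !mulr0 !addr0.
have := K (u + delta_mx 0 0); have := K (u + delta_mx 0 1).
rewrite /area !mxE /= => h1 h2; apply: ptP; lra.
Qed.

Lemma col_trans p q u v : p != q -> area p q u = 0 -> area p q v = 0 -> area u v p = 0.
Proof.
move=> pq /(collinear_param pq)[k ->] /(collinear_param pq)[l ->].
rewrite /area !mxE; ring.
Qed.

(** Convex position without an order on the points: a supporting line of [A] passes through each of
    them. *)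
Definition supported (A : pt -> Prop) :=
  forall m, A m -> exists m', m' != m /\ forall x, A x -> 0 <= area m m' x.

(** A supporting line at a point strictly between [l] and [r] must contain both, so it is the line
    [lr]; but [z] and [z'] lie strictly on its two sides. *)
Lemma middle_contra A l r m z z' (k : R) : supported A ->
  A l -> A r -> A m -> A z -> A z' -> 0 < k < 1 -> m = l + k *: (r - l) ->
  0 < area l r z -> area l r z' < 0 -> False.
Proof.
move=> sA Al Ar Am Az Az' /andP[k0 k1] em zp zn.
have [m' [mm' sm]] := sA _ Am.
have := area_pqp m m'; rewrite {2}em area_line => h0.
have [hl hr] := (sm _ Al, sm _ Ar).
have l0 : area m m' l = 0 by nra.
have r0 : area m m' r = 0 by nra.
have := area_bary l r z m m' z'; rewrite l0 r0 !mulr0 !add0r => E.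
have [hz hz'] := (sm _ Az, sm _ Az').
have z0 : area m m' z = 0 by nra.
have n0 : area l r z != 0 by rewrite gt_eqF.
by move/eqP: mm'; apply; rewrite (area_all0 n0 l0 r0 z0).
Qed.

(** One of three distinct collinear points lies strictly between the others, where [middle_contra]
    applies; the sign and size of [k] tell which one. *)
Lemma three_collinear A x y w z z' : supported A ->
  A x -> A y -> A w -> A z -> A z' -> x != y -> x != w -> y != w ->
  area x y w = 0 -> 0 < area x y z -> area x y z' < 0 -> False.
Proof.
move=> sA Ax Ay Aw Az Az' xy xw yw /(collinear_param xy)[k ew] zp zn.
have k0 : k != 0 by apply: contra_neq xw => k0; rewrite ew k0 scale0r addr0.
have k1 : k != 1 by apply: contra_neq yw => k1; rewrite ew k1 scale1r addrC subrK.
have [kn|kp|/eqP] := ltrgtP k 0; last by rewrite (negbTE k0).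
  have h1 : 1 - k != 0 by rewrite subr_eq0 eq_sym.
  have E z1 : area w y z1 = (1 - k) * area x y z1 by rewrite ew /area !mxE; ring.
  (* For negative [k] the middle point is [x], at this fraction of the way from [w] to [y]. *)
  apply: (@middle_contra A w y x z z' (- k / (1 - k))) => //.
  - by rewrite divr_gt0 ?ltr_pdivrMr /=; lra.
  - by rewrite ew; apply: ptP; rewrite !mxE; field.
  - by rewrite E mulr_gt0 //; lra.
  - by rewrite E; nra.
have [kl|kg|/eqP] := ltrgtP k 1; last by rewrite (negbTE k1).
  by apply: (@middle_contra A x y w z z' k) => //; rewrite kp kl.
have E z1 : area x w z1 = k * area x y z1 by rewrite ew /area !mxE; ring.
apply: (@middle_contra A x w y z z' k^-1) => //.
- by rewrite invr_gt0 kp invf_lt1.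
- by rewrite ew; apply: ptP; rewrite !mxE; field.
- by rewrite E mulr_gt0.
- by rewrite E; nra.
Qed.

(* The parabolic arc (quadratic Bezier curve) tangent to pq at p and to qr at r. *)
Definition bez p q r (t : R) : pt :=
  (1 - t) ^+ 2 *: p + (2 * t * (1 - t)) *: q + t ^+ 2 *: r.

Lemma bez0 p q r : bez p q r 0 = p.
Proof. by rewrite /bez subr0 expr1n scale1r mulr0 mul0r scale0r expr0n scale0r !addr0. Qed.

Lemma bez1 p q r : bez p q r 1 = r.
Proof. by rewrite /bez subrr expr0n /= mulr0 !scale0r !add0r expr1n scale1r. Qed.

Lemma area_to_bez u v p q r t : area u v (bez p q r t)
  = (1 - t) ^+ 2 * area u v p + 2 * t * (1 - t) * area u v q + t ^+ 2 * area u v r.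
Proof. by rewrite area_conv3 //; ring. Qed.

(** A Vandermonde determinant: points with increasing parameters are in strictly convex position. *)
Lemma area_bez3 p q r (a b c : R) :
  area (bez p q r a) (bez p q r b) (bez p q r c)
  = 2 * (b - a) * (c - a) * (c - b) * area p q r.
Proof. rewrite /area !mxE; ring. Qed.

(** For [a < b] in the unit interval the sign is opposite to that of [area p q r]: the corner [q]
    lies beyond every chord. *)
Lemma area_bez2 p q r (a b : R) :
  area (bez p q r a) (bez p q r b) q
  = - ((b - a) * (a * (1 - b) + b * (1 - a)) * area p q r).
Proof. rewrite /area !mxE; ring. Qed.

(** Written in the barycentric coordinates of [x], whose signs are known for points of the polygon
    beyond the side [pr]; every term is then of one sign. *)
Lemma area_bez2_out p q r x (s t : R) : area p q r != 0 ->
  area (bez p q r s) (bez p q r t) x =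
  (t - s) * (2 * s * t * area q r x - (s * (1 - t) + t * (1 - s)) * area r p x
             + 2 * (1 - s) * (1 - t) * area p q x).
Proof.
move=> n0; apply: (mulfI n0); rewrite (area_bary p q r).
rewrite area_bez2.
have -> : area (bez p q r s) (bez p q r t) p = 2 * s * t * (t - s) * area p q r.
  by rewrite /area !mxE; ring.
have -> : area (bez p q r s) (bez p q r t) r = 2 * (1 - s) * (1 - t) * (t - s) * area p q r.
  by rewrite /area !mxE; ring.
ring.
Qed.

End Area.

(** * Straight-line drawings with prescribed convex boundary *)

Section Embedding.
Variables (R : realFieldType) (V : finType).
Local Notation pt := 'rV[R]_2.
Implicit Types (p f g : V -> pt) (c : seq V) (T S : {set {set V}}).

(* Counterclockwise; consecutive points may be collinear. *)
Definition weakly_convex p c := forall x y z, subseq [:: x; y; z] c -> 0 <= area (p x) (p y) (p z).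

Definition not_all_collinear p c := exists x y z,
  [/\ x \in c, y \in c, z \in c & area (p x) (p y) (p z) != 0].

(* No edge of T off the cycle c has all of c weakly on one side of it. *)
Definition unobstructed T p c := forall x y, x \in c -> y \in c -> edge T x y -> ~~ ce c x y ->
  exists z z', [/\ z \in c, z' \in c, 0 < area (p x) (p y) (p z) & area (p x) (p y) (p z') < 0].

Record good T c p : Prop := Good {
  g_disk : disk T c;
  g_WC : weakly_convex p c;
  g_NC : not_all_collinear p c;
  g_inj : {in c &, injective p};
  g_NObs : unobstructed T p c }.

(* The line PQ weakly separates f s from f t; both have on it at most the
   two labelled points pa and pb, so that f s and f t meet in a common face. *)
Definition separated f (s t : {set V}) := exists (P Q : pt) (a b : V) (pa pb : pt),
  [/\ pa != pb,
      forall x, x \in s -> 0 <= area P Q (f x) /\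
        (area P Q (f x) = 0 -> (x = a /\ f x = pa) \/ (x = b /\ f x = pb)) &
      forall x, x \in t -> area P Q (f x) <= 0 /\
        (area P Q (f x) = 0 -> (x = a /\ f x = pa) \/ (x = b /\ f x = pb))].

Lemma separated_sym f (s t : {set V}) : separated f s t -> separated f t s.
Proof.
case=> P [Q [a [b [pa [pb [n hs ht]]]]]]; exists Q, P, a, b, pa, pb.
split=> // x xs; rewrite areaC.
  by case: (ht x xs) => h1 h2; split; [lra|move=> h; apply: h2; lra].
by case: (hs x xs) => h1 h2; split; [lra|move=> h; apply: h2; lra].
Qed.

Lemma separated_ext f g (s t : {set V}) : (forall x, x \in s -> f x = g x) ->
  (forall x, x \in t -> f x = g x) -> separated f s t -> separated g s t.
Proof.
move=> es et [P [Q [a [b [pa [pb [n hs ht]]]]]]]; exists P, Q, a, b, pa, pb.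
split=> // x xs; first by rewrite -es //; apply: hs.
by rewrite -et //; apply: ht.
Qed.

(* The last field puts the interior vertices inside the polygon, strictly; it is what
   makes the solutions for two pieces fit together. *)
Record solves T c p f : Prop := Solves {
  s_bd : forall x, x \in c -> f x = p x;
  s_sep : forall s t, s \in T -> t \in T -> s != t -> separated f s t;
  s_tri : forall t, t \in T -> exists x y z, t = [set x; y; z] /\ area (f x) (f y) (f z) != 0;
  s_int : forall u t, t \in T -> u \in t -> u \notin c -> forall P Q : pt,
    (forall x, x \in c -> 0 <= area P Q (p x)) ->
    (exists2 x, x \in c & area P Q (p x) != 0) -> 0 < area P Q (f u) }.

(** A rotation permutes each triple cyclically, which leaves [area] unchanged. *)
Lemma weakly_convex_rot p s1 s2 : weakly_convex p (s1 ++ s2) -> weakly_convex p (s2 ++ s1).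
Proof.
move=> h x y z /sub3_cat [h1|[[h1 h2]|[[h1 h2]|h1]]].
- by apply: h; apply: subseq_trans h1 (suffix_subseq _ _).
- rewrite area_cyc area_cyc; apply: h; rewrite -[[:: z; x; y]]/([:: z] ++ [:: x; y]).
  by apply: cat_subseq; rewrite // sub1seq.
- rewrite area_cyc; apply: h; rewrite -[[:: y; z; x]]/([:: y; z] ++ [:: x]).
  by apply: cat_subseq; rewrite // sub1seq.
- by apply: h; apply: subseq_trans h1 (prefix_subseq _ _).
Qed.

Lemma good_rot T p s1 s2 : good T (s1 ++ s2) p -> good T (s2 ++ s1) p.
Proof.
have E : s1 ++ s2 =i s2 ++ s1 by move=> x; rewrite !mem_cat orbC.
case=> h1 h2 [x [y [z [xc yc zc n]]]] h4 h5; split.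
- exact: disk_rot.
- exact: weakly_convex_rot.
- by exists x, y, z; rewrite -!E.
- by move=> u v; rewrite -!E; apply: h4.
move=> u v uc vc uv; rewrite ce_rot => nuv.
case: (h5 u v _ _ uv nuv); rewrite ?E // => w [w' [wc wc' ? ?]].
by exists w, w'; rewrite -!E.
Qed.

Lemma solves_mem T p f c c' : c =i c' -> solves T c p f -> solves T c' p f.
Proof.
move=> E [h1 h2 h3 h4]; split=> //; first by move=> x; rewrite -E; apply: h1.
move=> u t tT ut uc P Q hP [x xc nx]; apply: (h4 u t) => //.
- by rewrite E.
- by move=> y; rewrite E; apply: hP.
- by exists x; rewrite ?E.
Qed.

(** After rotating [x] to the front, the line from [x] to the next boundary vertex supports all the
    others. *)
Lemma disk_supported T c p : disk T c -> weakly_convex p c -> {in c &, injective p} ->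
  supported (fun q => exists2 x, x \in c & q = p x).
Proof.
move=> D W I m [x xc ->]; case/splitPr: xc (d_size D) (d_uniq D) W I => s1 s2.
rewrite size_cat /= => sz U W I.
have W' := weakly_convex_rot W.
have U' : uniq ((x :: s2) ++ s1) by rewrite uniq_catC.
have E : s1 ++ x :: s2 =i (x :: s2) ++ s1 by move=> y; rewrite !mem_cat orbC.
have : (1 < size (s2 ++ s1))%N by rewrite size_cat; move: sz; rewrite addnS addnC.
case e: (s2 ++ s1) => [//|y s] _.
rewrite cat_cons e in W' U' E.
exists (p y); split.
  have yc : y \in s1 ++ x :: s2 by rewrite E !inE eqxx orbT.
  have xc : x \in s1 ++ x :: s2 by rewrite E mem_head.
  apply/eqP=> /(I _ _ yc xc) exy; move: U'; rewrite exy /= inE eqxx //.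
move=> q [z]; rewrite E !inE => /or3P[/eqP->|/eqP->|zs] ->.
- by rewrite area_pqp.
- by rewrite area_pqq.
by apply: W'; rewrite /= !eqxx sub1seq.
Qed.

Lemma disk_cover T c x : disk T c -> x \in c -> exists2 t, t \in T & x \in t.
Proof.
move=> D /splitPr h; case: h D => s1 s2 /disk_rot /= D.
case: (s2 ++ s1) D => [|y s] D; first by have := d_size D.
have : bdT T x y.
  rewrite (d_bd D) (ce_head _ (d_uniq D)) eqxx.
  have := d_uniq D; have := d_size D; case/lastP: s {D} => // s z _.
  rewrite last_rcons /= => /and3P[_ + _]; rewrite mem_rcons inE negb_or => /andP[yz _].
  by rewrite (negbTE yz).
by case/bdT_te=> t tT /and3P[_ xt _]; exists t.
Qed.


Lemma chord_not_bd T u w (A1 A2 : seq V) : disk T (u :: A1 ++ w :: A2) ->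
  A1 != [::] -> A2 != [::] -> ~~ ce (u :: A1 ++ w :: A2) u w.
Proof.
move=> D n1 n2; have U := d_uniq D.
have U1 : uniq (u :: rcons A1 w).
  by move: U; rewrite -cat_rcons -cat_cons cat_uniq => /andP[].
have U2 : uniq (w :: rcons A2 u).
  by move: U; rewrite -[u :: _]/([:: u] ++ _) uniq_catC -catA /= cats1 cat_uniq => /and3P[].
rewrite ce_split; case h1: (pe u _ _ _); first by rewrite (pe_ends U1 h1) in n1.
rewrite addFb; apply/negP; rewrite pe_sym => h2.
by rewrite (pe_ends U2 h2) in n2.
Qed.

(** The weak signs come from the cyclic order. Equality would put a third vertex on the line [uw],
    which has boundary vertices strictly on both sides, against [three_collinear]. *)
Lemma chord_strict T u w (A1 A2 : seq V) p : good T (u :: A1 ++ w :: A2) p ->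
  A1 != [::] -> A2 != [::] -> edge T u w ->
  (forall x, x \in A1 -> area (p u) (p w) (p x) < 0) /\
  (forall x, x \in A2 -> 0 < area (p u) (p w) (p x)).
Proof.
move=> [D W _ I O] n1 n2 e; have U := d_uniq D.
set c := u :: A1 ++ w :: A2 in D W I O U *.
have [uc wc] : u \in c /\ w \in c.
  by split; rewrite /c !inE ?mem_cat ?inE ?eqxx ?orbT.
have [z [z' [zc z'c hz hz']]] := O u w uc wc e (chord_not_bd D n1 n2).
have uw : u != w by case/andP: e.
have key x : x \in c -> x != u -> x != w -> area (p u) (p w) (p x) != 0.
  move=> xc xu xw; apply/eqP=> h0.
  have inj a b : a \in c -> b \in c -> b != a -> p a != p b.
    by move=> ac bc; apply: contra_neq => /(I _ _ ac bc).
  apply: (three_collinear (disk_supported D W I) _ _ _ _ _ _ _ _ h0 hz hz').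
  - by exists u. - by exists w. - by exists x. - by exists z. - by exists z'.
  - by apply: inj; rewrite // eq_sym.
  - exact: inj.
  - exact: inj.
move: U; rewrite /c /= mem_cat inE !negb_or cat_uniq => /andP[/and3P[u1 _ u2] /and3P[_ /hasPn d /andP[w2 _]]].
split=> x xA.
  rewrite lt_neqAle key /c ?inE ?mem_cat ?xA ?orbT //.
  - rewrite -oppr_ge0 -areaC area_cyc; apply: W; rewrite /c /= eqxx.
    by rewrite -[[:: x; w]]/([:: x] ++ [:: w]); apply: cat_subseq; rewrite sub1seq // mem_head.
  - by apply: contraNneq u1 => <-.
  by have := d w (mem_head _ _); apply: contraNneq => <-.
rewrite lt_def key /c ?inE ?mem_cat ?inE ?xA ?orbT //.
- apply: W; rewrite /c /= eqxx -[[:: w; x]]/([::] ++ [:: w; x]).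
  by apply: cat_subseq; rewrite ?sub0seq //= eqxx sub1seq.
- by apply: contraNneq u2 => <-.
by apply: contraNneq w2 => <-.
Qed.

(** Only the witnesses for an inner edge [xy] of the piece need care. A vertex cut off may no longer
    serve; on the side of the cut it is replaced by [u] or [w], unless both are on the line [xy].
    Then [xy] lies on the line [uw], which contains no vertex of [A1], so [xy] is the cut itself,
    now a boundary edge. *)
Lemma chord_part T S u w (A1 A2 : seq V) p : good T (u :: A1 ++ w :: A2) p ->
  A1 != [::] -> (forall x, x \in A1 -> area (p u) (p w) (p x) < 0) ->
  disk S (u :: A1 ++ [:: w]) -> S \subset T -> good S (u :: A1 ++ [:: w]) p.
Proof.
set c1 := u :: A1 ++ [:: w]; set c := u :: A1 ++ w :: A2.
move=> [D W _ I O] n1 neg D1 sS.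
have cE : c = c1 ++ A2 by rewrite /c /c1 -cat_cons -[w :: A2]/([:: w] ++ A2) catA.
have sub x : x \in c1 -> x \in c by rewrite cE mem_cat => ->.
have W1 : weakly_convex p c1.
  by move=> x y z h; apply: W; rewrite cE; apply: subseq_trans h (prefix_subseq _ _).
have I1 : {in c1 &, injective p} by move=> x y /sub h1 /sub h2; apply: I.
split=> //.
  case: A1 @c1 @c n1 neg D D1 W O I cE sub W1 I1 => [|x A1] c1 c //= _ neg *.
  exists u, w, x; split; rewrite /c1 /= ?inE ?mem_cat ?inE ?eqxx ?orbT //.
  by have := neg x; rewrite mem_head => /(_ isT); rewrite lt_neqAle => /andP[].
have key x y : subseq [:: x; y] c1 -> edge S x y -> ~~ ce c1 x y ->
  exists z z', [/\ z \in c1, z' \in c1, 0 < area (p x) (p y) (p z) & area (p x) (p y) (p z') < 0].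
  move=> sxy e nce.
  have xy : x != y by case/andP: e.
  have [xc1 yc1] : x \in c1 /\ y \in c1 by split; rewrite (mem_subseq sxy) // !inE eqxx ?orbT.
  have nce' : ~~ ce c x y.
    apply: contra nce; rewrite -(d_bd D) -(d_bd D1) => b.
    suff -> : bdT S x y = bdT T x y by [].
    case/edgeP: e => t tS tt; apply: eq_bdT => t' tt'.
    apply/idP/idP => [/(subsetP sS)//|t'T].
    by rewrite (bd_one D (subsetP sS _ tS) tt b t'T tt').
  have [z [z' [zc z'c hz hz']]] := O x y (sub _ xc1) (sub _ yc1) (edge_sub sS e) nce'.
  (* The vertices cut off come after [x] and [y], so the negative witness survives. *)
  have out v : v \in A2 -> 0 <= area (p x) (p y) (p v).
    move=> vA; apply: W; rewrite cE -[[:: x; y; v]]/([:: x; y] ++ [:: v]).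
    by apply: cat_subseq; rewrite // sub1seq.
  have z'1 : z' \in c1.
    by move: z'c; rewrite cE mem_cat => /orP[//|/out]; rewrite leNgt hz'.
  have [uc1 wc1] : u \in c1 /\ w \in c1 by split; rewrite /c1 !inE ?mem_cat ?inE ?eqxx ?orbT.
  suff [z1 z1c hz1] : exists2 z1, z1 \in c1 & 0 < area (p x) (p y) (p z1) by exists z1, z'.
  have hu : 0 <= area (p x) (p y) (p u).
    have [->|xu] := eqVneq x u; first by rewrite area_pqp.
    rewrite area_cyc area_cyc; apply: W1; rewrite /c1 /= eqxx.
    by move: sxy; rewrite /c1 /= (negbTE xu).
  have hw : 0 <= area (p x) (p y) (p w).
    move: (sxy); rewrite /c1 -cat_cons => /sub2_cat[h|[xA]|].
    - apply: W1; rewrite /c1 -cat_cons -[[:: x; y; w]]/([:: x; y] ++ [:: w]).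
      exact: cat_subseq.
    - by rewrite inE => /eqP->; rewrite area_pqq.
    - by rewrite /=; case: ifP.
  have [u0|u0] := eqVneq (area (p x) (p y) (p u)) 0; last first.
    by exists u => //; rewrite lt_def u0 hu.
  have [w0|w0] := eqVneq (area (p x) (p y) (p w)) 0; last first.
    by exists w => //; rewrite lt_def w0 hw.
  have pxy : p x != p y by apply: contra_neq xy => /(I1 _ _ xc1 yc1).
  have pyx : p y != p x by rewrite eq_sym.
  have ax : area (p u) (p w) (p x) = 0 by apply: col_trans pxy u0 w0.
  have ay : area (p u) (p w) (p y) = 0.
    by apply: (col_trans pyx); rewrite areaC ?u0 ?w0 oppr0.
  have nx : x \notin A1 by apply/negP=> /neg; rewrite ax ltxx.
  have ny : y \notin A1 by apply/negP=> /neg; rewrite ay ltxx.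
  have U1 := d_uniq D1.
  have [xu yw] : x = u /\ y = w.
    move: sxy xc1 yc1 xy; rewrite /c1 !inE !mem_cat !inE (negbTE nx) (negbTE ny) /=.
    move=> h /orP[/eqP ex|/eqP ex] /orP[/eqP ey|/eqP ey] nxy //; try by rewrite ex ey eqxx in nxy.
    have wu : w == u = false by rewrite -ex -ey (negbTE nxy).
    move: h; rewrite /= ex ey wu => h.
    have h1 : u \in A1 ++ [:: w] by apply: (mem_subseq h); rewrite !inE eqxx orbT.
    by move: U1; rewrite /c1 /= h1.
  case/negP: nce; rewrite xu yw /c1 ce_split /=.
  case h: (pe u _ _ _).
    have U2 : uniq (u :: rcons A1 w) by rewrite -cats1.
    by rewrite (pe_ends U2 h) in n1.
  by rewrite addbF addFb edC ed_id //; rewrite -xu -yw.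
move=> x y xc yc e nce; have xy : x != y by case/andP: e.
case/orP: (sub2_total xc yc xy) => h; first exact: key.
have [||z [z' [zc z'c hz hz']]] := key y x h; rewrite ?[edge _ y x]edge_sym ?[ce _ y x]ce_sym //.
by exists z', z; split=> //; rewrite areaC; lra.
Qed.

End Embedding.

(** * Gluing two solutions along a chord *)

Section Induction.
Variables (R : realFieldType) (V : finType).
Local Notation pt := 'rV[R]_2.
Implicit Types (p f g : V -> pt) (c : seq V) (T S : {set {set V}}).

Lemma gt0_side (a : R) (Q : Prop) : 0 < a -> 0 <= a /\ (a = 0 -> Q).
Proof. by move=> h; split; [exact: ltW|move=> a0; rewrite a0 ltxx in h]. Qed.

Lemma lt0_side (a : R) (Q : Prop) : a < 0 -> a <= 0 /\ (a = 0 -> Q).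
Proof. by move=> h; split; [exact: ltW|move=> a0; rewrite a0 ltxx in h]. Qed.

Lemma not_all_collinear_area p c (P Q : pt) : not_all_collinear p c -> P != Q ->
  exists2 x, x \in c & area P Q (p x) != 0.
Proof.
case=> x [y [z [xc yc zc n]]] PQ.
have [hx|] := eqVneq (area P Q (p x)) 0; last by exists x.
have [hy|] := eqVneq (area P Q (p y)) 0; last by exists y.
have [hz|] := eqVneq (area P Q (p z)) 0; last by exists z.
by move: PQ; rewrite (area_all0 n hx hy hz) eqxx.
Qed.

Definition solvable_below T := forall S c p, (#|S| < #|T|)%N -> good S c p ->
  exists f, solves S c p f.

(** The line of the chord separates the triangles of one piece from those of the other: boundary
    vertices by [chord_strict], interior ones by the strictness in [s_int], so that only [u] and [w]
    are on it. *)
Lemma chord_solve T u w (A1 A2 : seq V) p : good T (u :: A1 ++ w :: A2) p ->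
  A1 != [::] -> A2 != [::] -> edge T u w -> solvable_below T ->
  exists f, solves T (u :: A1 ++ w :: A2) p f.
Proof.
move=> G n1 n2 e IH; have [D W N I O] := G.
set c := u :: A1 ++ w :: A2 in G D W N I O *.
have [neg pos] := chord_strict G n1 n2 e.
have nce := chord_not_bd D n1 n2.
have U := d_uniq D.
set c1 := u :: A1 ++ [:: w].
have uw : u != w by case/andP: e.
have cE : c = c1 ++ A2 by rewrite /c /c1 -cat_cons -[w :: A2]/([:: w] ++ A2) catA.
have U1 : uniq c1 by move: U; rewrite cE cat_uniq => /andP[].
have U2 : uniq (u :: [::] ++ w :: A2).
  move: U; apply: subseq_uniq; rewrite /c /= eqxx; exact: suffix_subseq.
have b1 : ce c1 u w.
  rewrite /c1 ce_split /= addbF; case h: (pe u _ _ _).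
    have U3 : uniq (u :: rcons A1 w) by rewrite -cats1.
    by rewrite (pe_ends U3 h) in n1.
  by rewrite addFb edC ed_id.
(* The piece on the side of [A1] is obtained as the set of triangles bounded by the cycle [c1]. *)
have [x y|S sS bS] := d_bd_onto D (@ce_sym _ c1) _ (@ce_even _ c1).
   rewrite /c1 ce_split /= addbF.
  case h: (ed w u x y).
    by case/edP: h => -[-> ->] //; rewrite edge_sym.
  rewrite addbF => h1.
  have : ce c x y.
    rewrite /c ce_split h1; case h2: (pe w _ _ _) => //.
    by case: (arcs_disjoint U (d_size D) h1 h2).
  rewrite -(d_bd D) => /bdT_te[t tT tt]; apply/edgeP; by exists t.
have sz1 : (2 < size c1)%N.
  by rewrite /c1 /= size_cat /= addn1 !ltnS lt0n size_eq0.
have sz2 : (2 < size (u :: [::] ++ w :: A2))%N.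
  by rewrite /= !ltnS lt0n size_eq0.
have [D1 D2 co sh] := theta_disk (P := [::]) D U1 U2 sz1 sz2 sS (fun x y => esym (bS x y)).
have {sh}sh x t t' : t \in S -> t' \in T :\: S -> x \in t -> x \in t' -> x = u \/ x = w.
  move=> tS t'S xt xt'; have := sh x t t' tS t'S xt xt'; rewrite !inE.
  by case/orP=> /eqP; [left|right].
have G1 : good S c1 p by exact: chord_part G n1 neg D1 sS.
have G2 : good (T :\: S) (w :: A2 ++ [:: u]) p.
  apply: (@chord_part _ _ T (T :\: S) w u A2 A1) => //.
  - by have := @good_rot _ _ T p (u :: A1) (w :: A2) G.
  - by move=> x /pos; rewrite areaC; lra.
  - by have := @disk_rot _ _ [:: u] (w :: A2) D2.
  - exact: subsetDl.
have S0 : S != set0.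
  apply: contraTneq b1 => S0; rewrite bS S0.
  by apply/negP=> /bdT_te[t]; rewrite inE.
have S'0 : T :\: S != set0.
  apply: contraNneq nce => /eqP; rewrite setD_eq0 => TS.
  have E : T = S by apply/eqP; rewrite eqEsubset TS.
  by rewrite -/c -(d_bd D) E -bS.
have cT : (#|T| = #|S| + #|T :\: S|)%N by rewrite -(cardsID S T) (setIidPr sS).
have [f1 s1] : exists f, solves S c1 p f.
  by apply: IH G1; rewrite cT -[X in (X < _)%N]addn0 ltn_add2l card_gt0.
have [f2 s2] : exists f, solves (T :\: S) (w :: A2 ++ [:: u]) p f.
  by apply: IH G2; rewrite cT -[X in (X < _)%N]add0n ltn_add2r card_gt0.
have {}s2 : solves (T :\: S) (u :: w :: A2) p f2.
  apply: solves_mem s2 => x.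
  by rewrite !inE mem_cat inE; case: (x == u); rewrite ?orbT ?orbF.
(* The pieces share only [u] and [w], where both solutions equal [p], so the choice between them
   does not matter. *)
pose f x := if [exists t in S, x \in t] then f1 x else f2 x.
have fS x t : t \in S -> x \in t -> f x = f1 x.
  by move=> tS xt; rewrite /f; case: existsP => // -[]; exists t; rewrite tS.
have uc1 : u \in c1 by rewrite mem_head.
have wc1 : w \in c1 by rewrite /c1 !inE mem_cat mem_head !orbT.
have fS' x t : t \in T :\: S -> x \in t -> f x = f2 x.
  move=> tS xt; rewrite /f; case: existsP => // -[t' /andP[t'S xt']].
  have [->|->] := sh _ _ _ t'S tS xt' xt; rewrite (s_bd s1) // (s_bd s2) // !inE ?eqxx ?orbT //.
have TP t : t \in T -> t \in S \/ t \in T :\: S.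
  by move=> tT; rewrite inE tT andbT; case: (t \in S); [left|right].
have cross (s t : {set V}) : s \in S -> t \in T :\: S -> separated f s t.
  (* The line is directed from [w] to [u], because [A1] lies on the right of [uw]. *)
  move=> sS' tS'; exists (p w), (p u), u, w, (p u), (p w).
  have puw : p u != p w.
    by apply: contra_neq uw; apply: I; rewrite cE mem_cat ?uc1 ?wc1.
  split=> // x xs.
    rewrite (fS x s) //; have [xc|xc] := boolP (x \in c1); last first.
      apply: gt0_side.
      apply: (s_int s1 sS' xs xc); last by apply: not_all_collinear_area (g_NC G1) _; rewrite eq_sym.
      move=> y; rewrite /c1 !inE mem_cat inE => /or3P[/eqP->|/neg h|/eqP->].
      - by rewrite area_pqq.
      - by rewrite areaC; lra.
      - by rewrite area_pqp.
    rewrite (s_bd s1 xc); move: xc; rewrite /c1 !inE mem_cat inE => /or3P[/eqP->|/neg h|/eqP->].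
    - by rewrite area_pqq; split=> // _; left.
    - by rewrite areaC; apply: gt0_side; rewrite oppr_gt0.
    - by rewrite area_pqp; split=> // _; right.
  rewrite (fS' x t) //; have [xc|xc] := boolP (x \in u :: w :: A2); last first.
    rewrite areaC; apply: lt0_side; rewrite oppr_lt0.
    apply: (s_int s2 tS' xs xc); last first.
      case: (not_all_collinear_area (g_NC G2) puw) => y yc ny; exists y => //.
      by move: yc; rewrite !inE mem_cat inE; case: (y == u); rewrite ?orbT ?orbF.
    move=> y; rewrite !inE => /or3P[/eqP->|/eqP->|/pos h].
    - by rewrite area_pqp.
    - by rewrite area_pqq.
    - by lra.
  rewrite (s_bd s2 xc); move: xc; rewrite !inE => /or3P[/eqP->|/eqP->|/pos h].
  - by rewrite area_pqq; split=> // _; left.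
  - by rewrite area_pqp; split=> // _; right.
  - by rewrite areaC; apply: lt0_side; rewrite oppr_lt0.
exists f; split.
- move=> x xc; rewrite /f; case: existsP => [[t /andP[tS xt]]|nS].
    have [xc1|xc1] := boolP (x \in c1); first exact: (s_bd s1).
    have xA : x \in A2 by move: xc; rewrite cE mem_cat (negbTE xc1).
    have [|t' t'S xt'] := @disk_cover _ _ (u :: w :: A2) x D2; first by rewrite !inE xA !orbT.
    by move: xc1; have [->|->] := sh _ _ _ tS t'S xt xt'; rewrite ?uc1 ?wc1.
  apply: (s_bd s2); move: xc; rewrite cE mem_cat => /orP[xc1|xA]; last by rewrite !inE xA !orbT.
  by have [t tS xt] := disk_cover D1 xc1; case: nS; exists t; rewrite tS.
- move=> s t /TP[sS'|sS'] /TP[tS'|tS'] st.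
  + apply: separated_ext (s_sep s1 sS' tS' st) => x xs; by rewrite (fS x _ _ xs).
  + exact: cross.
  + by apply: separated_sym; apply: cross.
  + apply: separated_ext (s_sep s2 sS' tS' st) => x xs; by rewrite (fS' x _ _ xs).
- move=> t /TP[tS|tS].
    have [x [y [z [et h]]]] := s_tri s1 tS; exists x, y, z; split=> //.
    by rewrite !(fS _ t) // et !inE eqxx ?orbT.
  have [x [y [z [et h]]]] := s_tri s2 tS; exists x, y, z; split=> //.
  by rewrite !(fS' _ t) // et !inE eqxx ?orbT.
(* A half plane containing [c] contains the boundary of each piece, which is not contained in a
   line. *)
move=> x t /TP[tS|tS] xt xc P Q hP [y yc ny].
  have PQ : P != Q by apply: contraNneq ny => ->; rewrite area_pp.
  rewrite (fS x t) //; apply: (s_int s1 tS xt).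
  - by apply: contra xc; rewrite cE mem_cat => ->.
  - by move=> v vc; apply: hP; rewrite cE mem_cat vc.
  - exact: not_all_collinear_area (g_NC G1) PQ.
have PQ : P != Q by apply: contraNneq ny => ->; rewrite area_pp.
have sub v : v \in u :: w :: A2 -> v \in c.
  by move=> h; apply: (mem_subseq _ h); rewrite /c /= eqxx; apply: suffix_subseq.
rewrite (fS' x t) //; apply: (s_int s2 tS xt).
- by apply: contra xc; apply: sub.
- by move=> v /sub; apply: hP.
case: (not_all_collinear_area (g_NC G2) PQ) => v vc nv; exists v => //.
by move: vc; rewrite !inE mem_cat inE; case: (v == u); rewrite ?orbT ?orbF.
Qed.

End Induction.

(** * Chords of the parabolic arc and points beyond its base *)

Section BezierPosition.
Variable R : realFieldType.
Local Notation pt := 'rV[R]_2.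
Implicit Types (p q r x : pt) (s t : R).

Lemma bez_out_ge p q r x s t : 0 < area p q r -> 0 <= area q r x ->
  area r p x <= 0 -> 0 <= area p q x -> 0 <= s -> s < t -> t <= 1 ->
  0 <= area (bez p q r s) (bez p q r t) x.
Proof.
move=> h0 h1 h2 h3 s0 st t1; rewrite area_bez2_out ?gt_eqF //.
have e1 : 0 <= s * t * area q r x by rewrite !mulr_ge0 //; lra.
have e2 : 0 <= (1 - s) * (1 - t) * area p q x by rewrite !mulr_ge0 //; lra.
have e3 : 0 <= s * (1 - t) + t * (1 - s) by rewrite addr_ge0 // mulr_ge0 //; lra.
have e4 : 0 <= (s * (1 - t) + t * (1 - s)) * - area r p x by rewrite mulr_ge0 //; lra.
rewrite mulr_ge0 //; lra.
Qed.

(** Off the line [pr] the middle term of [area_bez2_out] is positive. On it the outer terms decide,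
    and one of them survives as soon as the chord is not the whole base [pr]. *)
Lemma bez_out_gt p q r x s t : 0 < area p q r -> 0 <= area q r x ->
  area r p x <= 0 -> 0 <= area p q x -> 0 <= s -> s < t -> t <= 1 ->
  0 < s \/ t < 1 -> x != p -> x != r ->
  0 < area (bez p q r s) (bez p q r t) x.
Proof.
move=> h0 h1 h2 h3 s0 st t1 hst xp xr; rewrite area_bez2_out ?gt_eqF //.
have n0 : area p q r != 0 by rewrite gt_eqF.
have e1 : 0 <= s * t * area q r x by rewrite !mulr_ge0 //; lra.
have e2 : 0 <= (1 - s) * (1 - t) * area p q x by rewrite !mulr_ge0 //; lra.
have e3 : 0 < s * (1 - t) + t * (1 - s).
  have e5 : 0 <= s * (1 - t) by rewrite mulr_ge0 //; lra.
  have e6 : 0 <= t * (1 - s) by rewrite mulr_ge0 //; lra.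
  have : 0 < t * (1 - s) by rewrite mulr_gt0 //; lra.
  lra.
have e4 : 0 <= (s * (1 - t) + t * (1 - s)) * - area r p x.
  by rewrite mulr_ge0 ?(ltW e3) //; lra.
rewrite mulr_gt0 //; first by rewrite subr_gt0.
have [b0|b0] := eqVneq (area r p x) 0; last first.
  have : 0 < (s * (1 - t) + t * (1 - s)) * - area r p x.
    by rewrite mulr_gt0 // oppr_gt0 lt_neqAle b0.
  lra.
(* [x] is on the line [pr] and differs from [p] and [r], so it is off the other two sides. *)
have a1 : 0 < area q r x.
  rewrite lt_def h1 andbT; apply: contra_neq xr => a0; apply/esym.
  by apply: (area_all0 n0); rewrite ?area_pqp //; rewrite /area in a0 b0 *; lra.
have a2 : 0 < area p q x.
  rewrite lt_def h3 andbT; apply: contra_neq xp => a0; apply/esym.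
  by apply: (area_all0 n0); rewrite ?area_pqp //; rewrite /area in a0 b0 *; lra.
case: hst => [hs|ht].
  have : 0 < s * t * area q r x by rewrite !mulr_gt0 //; lra.
  lra.
have : 0 < (1 - s) * (1 - t) * area p q x by rewrite !mulr_gt0 //; lra.
lra.
Qed.

End BezierPosition.

(** * Removing the star of a corner *)

Section StarRemoval.
Variables (R : realFieldType) (V : finType).
Local Notation pt := 'rV[R]_2.
Variables (p : V -> pt) (T : {set {set V}}) (a v b : V) (rest P : seq V).
Let c := a :: v :: b :: rest.
Let L := a :: rcons P b.
Hypothesis G : good T c p.
Hypothesis D0 : 0 < area (p a) (p v) (p b).
Hypothesis UL : uniq L.
Hypothesis vL : v \notin L.
Hypothesis fanT : forall t, t \in fan v a (rcons P b) -> t \in T.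
Hypothesis starT : forall t, t \in T -> v \in t -> t \in fan v a (rcons P b).
Hypothesis P0 : P != [::].
Hypothesis Pc : forall x, x \in P -> x \notin c.

Let c' := a :: P ++ b :: rest.
Let S := [set t in fan v a (rcons P b)].
(** Evenly spaced parameters; [a] gets 0 and [b] gets 1, so both keep their positions. *)
Let tau x : R := (index x L)%:R / (size P).+1%:R.
Let bz := bez (p a) (p v) (p b).
Let p' x := if x \in P then bz (tau x) else p x.

Let Dk := g_disk G.
Let Uc := d_uniq Dk.

Let c'E : c' = L ++ rest.
Proof. by rewrite /c' /L -cat_rcons. Qed.

Let index_b : index b L = (size P).+1.
Proof.
have : a != b by move: UL; rewrite /= mem_rcons inE negb_or => /andP[/andP[]].
rewrite /L /= => /negbTE ->; rewrite -cats1 index_cat /= eqxx addn0.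
by move: UL; rewrite /= rcons_uniq => /and3P[_ /negbTE-> _].
Qed.

Let n_gt0 : 0 < (size P).+1%:R :> R.
Proof. by rewrite ltr0n. Qed.

Let tau_ge0 x : 0 <= tau x.
Proof. by rewrite divr_ge0 // ler0n. Qed.

Let tau_le1 x : x \in L -> tau x <= 1.
Proof.
rewrite -index_mem /= size_rcons => h.
by rewrite ler_pdivrMr // mul1r ler_nat -ltnS.
Qed.

Let tau_lt x y : (index x L < index y L)%N -> tau x < tau y.
Proof. by move=> h; rewrite ltr_pM2r ?invr_gt0 // ltr_nat. Qed.

Let tau_a : tau a = 0.
Proof. by rewrite /tau /= eqxx mul0r. Qed.

Let tau_b : tau b = 1.
Proof. by rewrite /tau index_b divff // gt_eqF. Qed.

Let aP : a \notin P.
Proof. by move: UL; rewrite /= mem_rcons inE negb_or => /andP[/andP[]]. Qed.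

Let bP : b \notin P.
Proof. by move: UL; rewrite /= rcons_uniq => /and3P[]. Qed.

Let p'L x : x \in L -> p' x = bz (tau x).
Proof.
rewrite inE mem_rcons inE /p' /bz => /or3P[/eqP->|/eqP->|->//].
  by rewrite (negbTE aP) tau_a bez0.
by rewrite (negbTE bP) tau_b bez1.
Qed.

Let p'c x : x \in c -> p' x = p x.
Proof. by move=> xc; rewrite /p'; case: ifP => // /Pc; rewrite xc. Qed.

Let mem_rest x : x \in rest -> x \in c.
Proof. by move=> h; rewrite !inE h !orbT. Qed.

Let rest_side z : z \in rest ->
  [/\ 0 <= area (p v) (p b) (p z), area (p b) (p a) (p z) <= 0,
      0 <= area (p a) (p v) (p z), p z != p a & p z != p b].
Proof.
move=> zr; have W := g_WC G; have I := g_inj G.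
have sub x y : subseq [:: x; y] [:: a; v; b] -> 0 <= area (p x) (p y) (p z).
  move=> h; apply: W; rewrite -[[:: x; y; z]]/([:: x; y] ++ [:: z]).
  by rewrite -[c]/([:: a; v; b] ++ rest); apply: cat_subseq => //; rewrite sub1seq.
have h1 : subseq [:: v; b] [:: a; v; b] by apply: (suffix_subseq [:: a]).
have h2 : subseq [:: a; v] [:: a; v; b] by apply: (prefix_subseq [:: a; v] [:: b]).
have h3 : subseq [:: a; b] [:: a; v; b].
  by rewrite /= eqxx; case: ifP => _; rewrite ?eqxx.
have nz x : x \in [:: a; b] -> p z != p x.
  move=> xab; apply/eqP=> /(I _ _ (mem_rest zr)) e.
  have xc : x \in c by move: xab; rewrite !inE => /orP[] ->; rewrite ?orbT.
  move: Uc; rewrite /c -[_ :: _]/([:: a; v; b] ++ rest) cat_uniq => /and3P[_ /hasPn/(_ z zr) + _].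
  by move: xab; rewrite (e xc) !inE => /orP[] ->; rewrite ?orbT.
split; rewrite ?sub //; last 2 first.
- by apply: nz; rewrite inE eqxx.
- by apply: nz; rewrite !inE eqxx orbT.
by rewrite areaC oppr_le0 sub.
Qed.

Let bz_rest_ge x y z : x \in L -> y \in L -> (index x L < index y L)%N -> z \in rest ->
  0 <= area (p' x) (p' y) (p' z).
Proof.
move=> xL yL xy zr; have [h1 h2 h3 _ _] := rest_side zr.
rewrite (p'L xL) (p'L yL) (p'c (mem_rest zr)).
by apply: bez_out_ge; rewrite // ?tau_lt ?tau_le1.
Qed.

(** By the number of points on the arc: three give a Vandermonde sign, two are covered by
    [bez_rest_ge], one is a convex combination of [a], [v] and [b], and none is the old
    statement. *)
Let weakly_convex' : weakly_convex p' c'.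
Proof.
have W := g_WC G; move=> x y z; rewrite c'E => /sub3_cat[h|[[h zr]|[[xL h]|h]]].
- have xy : (index x L < index y L)%N.
    by apply: (sub2_index UL); apply: subseq_trans h; apply: (prefix_subseq [:: x; y] [:: z]).
  have yz : (index y L < index z L)%N.
    by apply: (sub2_index UL); apply: subseq_trans h; apply: (suffix_subseq [:: x]).
  have m := mem_subseq h; rewrite !p'L ?m ?inE ?eqxx ?orbT // area_bez3.
  have h1 := tau_lt xy; have h2 := tau_lt yz.
  by rewrite !mulr_ge0 // ?(ltW D0) //; lra.
- have m := mem_subseq h; apply: bz_rest_ge; rewrite ?m ?inE ?eqxx ?orbT //.
  exact: sub2_index.
- have m := mem_subseq h; rewrite (p'L xL) !p'c; try by apply: mem_rest; rewrite m ?inE ?eqxx ?orbT.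
  have A u : u \in [:: a; v; b] -> 0 <= area (p y) (p z) (p u).
    move=> ub; rewrite area_cyc area_cyc; apply: W.
    rewrite -[[:: u; y; z]]/([:: u] ++ [:: y; z]) -[c]/([:: a; v; b] ++ rest).
    by apply: cat_subseq; rewrite ?sub1seq.
  rewrite area_cyc area_to_bez; have t0 := tau_ge0 x; have t1 := tau_le1 xL.
  have [A1 A2 A3] : [/\ 0 <= area (p y) (p z) (p a), 0 <= area (p y) (p z) (p v)
    & 0 <= area (p y) (p z) (p b)] by rewrite !A ?inE ?eqxx ?orbT.
  move: (tau x) t0 t1 => t t0 t1.
  rewrite !addr_ge0 // mulr_ge0 ?sqr_ge0 //.
  by rewrite !mulr_ge0 //; lra.
have m := mem_subseq h; rewrite !p'c; try by apply: mem_rest; rewrite m ?inE ?eqxx ?orbT.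
apply: W; apply: subseq_trans h _; exact: (suffix_subseq [:: a; v; b]).
Qed.

Let split_index s1 y s2 : rcons P b = s1 ++ y :: s2 ->
  [/\ last a s1 \in L, y \in L, index (last a s1) L = size s1 & index y L = (size s1).+1].
Proof.
move=> e; have LE : L = (a :: s1) ++ y :: s2 by rewrite /L e.
split.
- by rewrite LE mem_cat mem_last.
- by rewrite LE mem_cat mem_head orbT.
- have -> : last a s1 = nth a L (size s1).
    by rewrite LE nth_cat /= ltnSn (last_nth a).
  by rewrite index_uniq // LE size_cat /= addSn ltnS leq_addr.
have -> : y = nth a L (size s1).+1 by rewrite LE nth_cat /= ltnn subnn.
by rewrite index_uniq // LE size_cat /= addnS !addSn !ltnS leq_addr.
Qed.

(** The edges of the new polygon along the arc are strict: their lines contain no other boundary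
    vertex. All later strict inequalities at new vertices rest on this. *)
Let SC s1 y s2 w : rcons P b = s1 ++ y :: s2 -> w \in c' -> w != last a s1 -> w != y ->
  0 < area (p' (last a s1)) (p' y) (p' w).
Proof.
move=> e wc' wx wy; have [xL yL ix iy] := split_index e.
have xy : tau (last a s1) < tau y by apply: tau_lt; rewrite ix iy.
move: wc'; rewrite c'E mem_cat => /orP[wL|wr].
  rewrite (p'L xL) (p'L yL) (p'L wL) area_bez3.
  have ne z : z \in L -> w != z -> index w L != index z L.
    move=> zL; apply: contra_neq => h.
    by rewrite -(nth_index a wL) h nth_index.
  have := ne _ xL wx; have := ne _ yL wy; rewrite ix iy => n2 n1.
  have [h|h] : (index w L < index (last a s1) L)%N \/ (index y L < index w L)%N.
    rewrite ix iy; case: (ltngtP (index w L) (size s1)) n1 => // h1 _; first by left.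
    by right; rewrite ltn_neqAle eq_sym n2.
  - have h1 := tau_lt h.
    have h2 : 0 < (tau w - tau (last a s1)) * (tau w - tau y) by rewrite nmulr_rgt0; lra.
    rewrite -[_ * _ * (tau w - tau y)]mulrA.
    by apply: mulr_gt0 => //; apply: mulr_gt0 => //; lra.
  have h1 := tau_lt h; rewrite !mulr_gt0 //; lra.
have [h1 h2 h3 h4 h5] := rest_side wr.
rewrite (p'L xL) (p'L yL) (p'c (mem_rest wr)); apply: bez_out_gt; rewrite ?tau_le1 //.
(* The first chord starts at parameter 0 but does not reach 1, since [P] is not empty. *)
case e1 : (size s1) => [|k]; last by left; rewrite /tau ix e1 divr_gt0 // ltr0n.
right; rewrite /tau iy e1 ltr_pdivrMr // mul1r ltr_nat ltnS lt0n size_eq0 //.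
Qed.

Let Uc' : uniq c'.
Proof.
rewrite c'E cat_uniq UL /=; apply/andP; split; last first.
  by move: Uc; rewrite /c /= => /and4P[].
apply/hasPn=> x xr; rewrite inE mem_rcons inE !negb_or.
move: Uc; rewrite /c -[_ :: _]/([:: a; v; b] ++ rest) cat_uniq => /and3P[_ /hasPn/(_ x xr) + _].
rewrite !inE !negb_or => /and3P[-> _ ->] /=; apply/negP=> /Pc; by rewrite mem_rest.
Qed.

Let star_split :
  [/\ disk S (a :: [:: v] ++ b :: rev P), disk (T :\: S) c',
      (forall u w, edge S u w -> edge (T :\: S) u w -> pe a (rcons P b) u w) &
      (forall x t t', t \in S -> t' \in T :\: S -> x \in t -> x \in t' -> x \in L)].
Proof.
have vE : [/\ v != a, v \notin P & v != b].
  by move: vL; rewrite inE mem_rcons inE !negb_or => /and3P[-> -> ->].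
case: vE => va vP vb.
apply: theta_disk => //.
- rewrite /= rev_uniq; have := UL; rewrite /= rcons_uniq mem_rcons.
  rewrite !inE !negb_or !mem_rev => /and3P[/andP[ab aP1] bP1 uP].
  by rewrite aP1 ab vb vP bP1 uP [a == v]eq_sym va.
- rewrite /= size_cat /= addnS !ltnS; case: (P) P0 => //.
- by apply/subsetP=> t; rewrite inE; apply: fanT.
move=> x y; rewrite bdT_fan // last_rcons ce_split pe_rev /= addbF.
by rewrite edC addbC -addbA.
Qed.

Let Q0 : exists2 q, q \in P & true.
Proof. by case: (P) P0 => // q s _; exists q; rewrite ?mem_head. Qed.

Let tau_P x : x \in P -> 0 < tau x < 1.
Proof.
move=> xP; have xL : x \in L by rewrite inE mem_rcons inE xP !orbT.
have n_a : x != a by apply: contraTneq xP => ->.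
have n_b : x != b by apply: contraTneq xP => ->.
have i0 : (0 < index x L)%N by rewrite /L /= eq_sym (negbTE n_a).
have i1 : (index x L < index b L)%N.
  rewrite ltn_neqAle; apply/andP; split.
    apply: contra_neq n_b => h.
    by rewrite -(nth_index a xL) h nth_index // inE mem_rcons mem_head orbT.
  by rewrite index_b -ltnS; move: xL; rewrite -index_mem /= size_rcons.
by rewrite -tau_b tau_lt // divr_gt0 // ltr0n.
Qed.

(** [SC] applied to the two chords that meet at [x]. *)
Let neighbors x : x \in P -> exists y z,
  [/\ [/\ y \in c', z \in c', y != x, z != x & y != z],
      (forall w, w \in c' -> w != y -> w != x -> 0 < area (p' y) (p' x) (p' w)),
      (forall w, w \in c' -> w != x -> w != z -> 0 < area (p' x) (p' z) (p' w)) &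
      (forall w, ce c' x w = (w == z) (+) (w == y))].
Proof.
move=> /splitPr h; move eP : P h => P1 h; case: h eP => s1 s2 eP.
have [z [s3 e3]] : exists z s3, rcons s2 b = z :: s3.
  by case: s2 {eP} => [|z s2]; [exists b, [::]|exists z, (rcons s2 b)].
have e1 : rcons P b = s1 ++ x :: z :: s3 by rewrite eP rcons_cat /= e3.
have e2 : rcons P b = rcons s1 x ++ z :: s3 by rewrite e1 cat_rcons.
have c'1 : c' = (a :: s1) ++ x :: z :: (s3 ++ rest).
  by rewrite c'E /L e1 /= -catA.
have U1 : uniq ((x :: z :: (s3 ++ rest)) ++ (a :: s1)).
  by rewrite uniq_catC -c'1.
set y := last a s1.
have yl : y = last z ((s3 ++ rest) ++ a :: s1) by rewrite last_cat.
have yx : y != x.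
  have := U1; rewrite /= => /andP[+ _]; apply: contraNneq => <-.
  by rewrite yl mem_last.
have yz : y != z.
  have := U1; rewrite /= => /and3P[_ + _]; apply: contraNneq => <-.
  by rewrite mem_cat mem_last orbT.
exists y, z; split.
- split=> //; first by rewrite c'1 mem_cat mem_last.
    by rewrite c'1 mem_cat !inE eqxx !orbT.
  by have := U1; rewrite /= inE negb_or eq_sym => /andP[/andP[]].
- by move=> w wc wy wx; apply: (SC e1).
- move=> w wc wx wz; have := SC e2 wc; rewrite last_rcons; exact.
move=> w; rewrite c'1 ce_rot; have := @ce_head _ x z ((s3 ++ rest) ++ a :: s1) w U1.
by rewrite -yl.
Qed.

Let pred_area x y : x \in P -> y \in c' -> x != y -> p' x != p' y.
Proof.
move=> xP yc xy; have [u [w [[uc wc ux wx uw] h1 h2 _]]] := neighbors xP.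
have [yu|yu] := eqVneq y u.
  have := h2 y yc; rewrite eq_sym xy yu => /(_ isT uw).
  by apply: contraTneq => ->; rewrite area_pqp ltxx.
have := h1 y yc yu; rewrite eq_sym => /(_ xy).
by apply: contraTneq => ->; rewrite area_pqq ltxx.
Qed.

Let c'c x : x \in c' -> x \notin P -> x \in c /\ x != v.
Proof.
move=> xc' xP; have xx : x \in a :: b :: rest.
  by move: xc'; rewrite /c' !inE mem_cat (negbTE xP) inE.
split; first by move: xx; rewrite /c !inE => /or3P[] ->; rewrite ?orbT.
apply: contraTneq xx => ->.
by move: Uc; rewrite /c /= !inE !negb_or [a == v]eq_sym => /and4P[/and3P[-> _ _] /andP[-> ->]].
Qed.

Let inj' : {in c' &, injective p'}.
Proof.
move=> x y xc yc e; apply/eqP/negPn/negP=> xy.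
have [xP|xP] := boolP (x \in P); first by case/eqP: (pred_area xP yc xy).
have [yP|yP] := boolP (y \in P).
  by move: xy; rewrite eq_sym => /(pred_area yP xc)/eqP[].
have [xc1 _] := c'c xc xP; have [yc1 _] := c'c yc yP.
by move: xy; rewrite (g_inj G xc1 yc1) ?eqxx // -!p'c.
Qed.

Let ac' : a \in c'. Proof. by rewrite /c' mem_head. Qed.
Let bc' : b \in c'. Proof. by rewrite /c' !inE mem_cat mem_head !orbT. Qed.
Let ac : a \in c. Proof. by rewrite mem_head. Qed.
Let bc : b \in c. Proof. by rewrite !inE eqxx !orbT. Qed.
Let vc : v \in c. Proof. by rewrite !inE eqxx !orbT. Qed.

Let Pc' x : x \in P -> x \in c'.
Proof. by move=> h; rewrite /c' !inE mem_cat h !orbT. Qed.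

Let not_all_collinear' : not_all_collinear p' c'.
Proof.
have [q qP _] := Q0; exists a, q, b; split; rewrite // ?Pc' //.
have /andP[t0 t1] := tau_P qP.
rewrite !p'L ?inE ?mem_rcons ?inE ?qP ?eqxx ?orbT // tau_a tau_b area_bez3.
move: (tau q) t0 t1 => t t0 t1.
rewrite gt_eqF // !mulr_gt0 //; lra.
Qed.

(** A replacement for the removed vertex [v] as a witness. If [xy] is [ba], the arc bulges to the
    side of [v]. Otherwise [a] and [b] are weakly left of [xy]; one of them is neither [x] nor [y],
    and on the line it would be a third collinear vertex. *)
Let toward_v x y z' : x \in a :: b :: rest -> y \in a :: b :: rest -> x != y ->
  z' \in c -> area (p x) (p y) (p z') < 0 -> 0 < area (p x) (p y) (p v) ->
  exists2 z, z \in c' & 0 < area (p x) (p y) (p' z).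
Proof.
move=> xm ym xy z'c hz' hv; have W := g_WC G.
have sub : subseq (a :: b :: rest) c.
  have h : subseq [:: a] [:: a; v] by rewrite sub1seq mem_head.
  exact: (cat_subseq h (subseq_refl (b :: rest))).
have [xc yc] := (mem_subseq sub xm, mem_subseq sub ym).
have [[ya xb]|nab] : (y = a /\ x = b) \/ ~~ ((y == a) && (x == b)).
  by case: eqP => [->|]; case: eqP => [->|]; [left|right|right|right].
  have [q qP _] := Q0; exists q; first exact: Pc'.
  have /andP[t0 t1] := tau_P qP.
  rewrite /p' qP area_to_bez ya xb area_pqq area_pqp !mulr0 addr0 add0r.
  move: (tau q) t0 t1 => t t0 t1; rewrite !mulr_gt0 //; first by lra.
  by rewrite area_cyc.
have nab' : ~~ ((x == a) && (y == b)).
  apply/negP=> /andP[/eqP xa /eqP yb]; move: hv; rewrite xa yb.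
  by rewrite areaC23 oppr_gt0 ltNge (ltW D0).
have weak : 0 <= area (p x) (p y) (p a) /\ 0 <= area (p x) (p y) (p b).
  case/orP: (sub2_total xm ym xy) => h.
    have [xa|xa] := eqVneq x a.
      have yr : y \in rest.
        have ya : (y == a) = false by rewrite -xa eq_sym (negbTE xy).
        by move: ym nab'; rewrite !inE ya xa eqxx /=; case: (y == b).
      have [_ _ h3 _ _] := rest_side yr; move: hv; rewrite xa.
      by rewrite areaC23 oppr_gt0 ltNge h3.
    have h1 : subseq [:: x; y] (b :: rest) by move: h; rewrite /= (negbTE xa).
    split.
      rewrite area_cyc area_cyc; apply: W; rewrite /c /= eqxx.
      by apply: subseq_trans h1 (suffix_subseq [:: v] _).
    have [->|xb] := eqVneq x b; first by rewrite area_pqp.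
    have h2 : subseq [:: x; y] rest by move: h1; rewrite /= (negbTE xb).
    rewrite area_cyc area_cyc; apply: W.
    by apply: (cat_subseq (s1 := [:: b]) (s3 := [:: a; v; b])) h2; apply: (suffix_subseq [:: a; v]).
  have [ya|ya] := eqVneq y a.
    have xr : x \in rest.
      have xa : (x == a) = false by rewrite -ya (negbTE xy).
      by move: xm nab; rewrite !inE xa ya eqxx /=; case: (x == b).
    rewrite ya area_pqq; split=> //; rewrite area_cyc; apply: W.
    apply: (cat_subseq (s1 := [:: a; b]) (s3 := [:: a; v; b]) (s2 := [:: x])); last by rewrite sub1seq.
    by rewrite /= eqxx; case: ifP; rewrite ?eqxx.
  have h1 : subseq [:: y; x] (b :: rest) by move: h; rewrite /= (negbTE ya).
  have h2 : 0 <= area (p v) (p y) (p x).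
    apply: W; apply: subseq_trans (suffix_subseq [:: a] _).
    by rewrite /= eqxx.
  by move: hv; rewrite areaC13 oppr_gt0 ltNge h2.
have [w [wab wc' wx wy]] : exists w, [/\ w \in [:: a; b], w \in c', x != w & y != w].
  have [xa|xa] := eqVneq x a.
    exists b; split=> //; first by rewrite !inE eqxx orbT.
      by rewrite xa; move: UL; rewrite /= mem_rcons inE negb_or => /andP[/andP[]].
    by move: nab'; rewrite xa eqxx.
  have [ya|ya] := eqVneq y a.
    exists b; split=> //; first by rewrite !inE eqxx orbT.
      by move: nab; rewrite ya eqxx.
    by rewrite ya; move: UL; rewrite /= mem_rcons inE negb_or => /andP[/andP[]].
  by exists a; split; rewrite // inE eqxx.
have wc : w \in c by move: wab; rewrite !inE => /orP[] ->; rewrite ?orbT.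
exists w => //; rewrite p'c // lt_def; apply/andP; split; last first.
  by move: wab weak; rewrite !inE => /orP[] /eqP-> [].
apply/eqP=> h0; have inj x1 y1 : x1 \in c -> y1 \in c -> x1 != y1 -> p x1 != p y1.
  by move=> h1 h2; apply: contra_neq; apply: (g_inj G).
apply: (three_collinear (disk_supported Dk W (g_inj G)) _ _ _ _ _ _ _ _ h0 hv hz'); try exact: inj.
- by exists x. - by exists y. - by exists w. - by exists v. - by exists z'.
Qed.

(** For an end [x] on the arc, its two boundary neighbours lie strictly on the two sides of [xy], as
    both edges at [x] are strict. If both ends are old, the old witnesses serve, with [toward_v] in
    place of [v]. *)
Let unobstructed' : unobstructed (T :\: S) p' c'.
Proof.
have [_ D' co sh] := star_split.
have inner x y : x \in P -> y \in c' -> edge (T :\: S) x y -> ~~ ce c' x y ->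
    exists z z', [/\ z \in c', z' \in c', 0 < area (p' x) (p' y) (p' z)
      & area (p' x) (p' y) (p' z') < 0].
  move=> xP yc e nce; have xy : x != y by case/andP: e.
  have [u [w [[uc wc ux wx uw] h1 h2 h3]]] := neighbors xP.
  move: nce; rewrite h3 => nce.
  have [yu yw] : y != u /\ y != w.
    move: nce; case: (eqVneq y w) => [->|yw]; case: (eqVneq _ u) => [e1|yu] //=.
    by rewrite e1 eqxx in uw.
  have yx : y != x by rewrite eq_sym.
  exists u, w; split=> //; first by rewrite area_cyc area_cyc; apply: h1.
  by have := h2 y yc yx yw; rewrite areaC23; lra.
have outer x y : x \in c' -> y \in c' -> x \notin P -> y \notin P -> edge (T :\: S) x y ->
    ~~ ce c' x y -> exists2 z, z \in c' & 0 < area (p' x) (p' y) (p' z).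
  move=> xc' yc' xP yP e nce; have xy : x != y by case/andP: e.
  have [xc xv] := c'c xc' xP; have [yc yv] := c'c yc' yP.
  (* An edge of [c] lies in one triangle only, which is here in the rest, so it is a boundary edge
     of the rest as well. *)
  have nce' : ~~ ce c x y.
    apply: contra nce; rewrite -(d_bd Dk) -(d_bd D') => h.
    suff -> : bdT (T :\: S) x y = bdT T x y by [].
    case/edgeP: e => t tS tt; apply: eq_bdT => t' tt'.
    apply/idP/idP => [|t'T]; first by rewrite inE => /andP[].
    have tT : t \in T by move: tS; rewrite inE => /andP[].
    by rewrite (bd_one Dk tT tt h t'T tt').
  have [z [z' [zc z'c hz hz']]] := g_NObs G xc yc (edge_sub (subsetDl _ _) e) nce'.
  rewrite !p'c //; have [zv|zv] := eqVneq z v.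
    have m u : u \in c -> u != v -> u \in a :: b :: rest.
      by rewrite /c !inE => /or4P[] -> //; rewrite ?orbT.
    by apply: (toward_v _ _ xy z'c hz'); rewrite ?m // -zv.
  exists z; last by rewrite p'c.
  move: zc; rewrite /c /c' !inE mem_cat !inE (negbTE zv) /=.
  by case/or3P=> ->; rewrite ?orbT.
move=> x y xc yc e nce; have xy : x != y by case/andP: e.
have [e' nce'] : edge (T :\: S) y x /\ ~~ ce c' y x by rewrite edge_sym ce_sym.
have [xP|xP] := boolP (x \in P); first exact: inner.
have [yP|yP] := boolP (y \in P).
  have [z [z' [zc z'c h h']]] := inner y x yP xc e' nce'.
  by exists z', z; split=> //; rewrite areaC; lra.
have [z zc h] := outer x y xc yc xP yP e nce.
have [z' z'c h'] := outer y x yc xc yP xP e' nce'.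
by exists z, z'; split=> //; rewrite areaC; lra.
Qed.

Let G' : good (T :\: S) c' p'.
Proof. by have [_ D' _ _] := star_split; split. Qed.

Let vc' : v \notin c'.
Proof.
rewrite c'E mem_cat negb_or vL /=.
by have := Uc; rewrite /c => /andP[_ /andP[+ _]]; rewrite inE negb_or => /andP[_ ->].
Qed.

(** Makes the fan triangles nondegenerate and puts them outside the new polygon. *)
Let neg x y : x \in L -> y \in L -> (index x L < index y L)%N ->
  area (p' x) (p' y) (p v) < 0.
Proof.
move=> xL yL /tau_lt xy; rewrite (p'L xL) (p'L yL) area_bez2 oppr_lt0.
have := tau_ge0 x; have := tau_le1 yL; move: (tau x) (tau y) xy => s t st t1 s0.
have h : 0 < t * (1 - s) by rewrite mulr_gt0 //; lra.
have h2 : 0 <= s * (1 - t) by rewrite mulr_ge0 //; lra.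
by apply: mulr_gt0 => //; apply: mulr_gt0; lra.
Qed.

Let L_c' x : x \in L -> x \in c'.
Proof. by rewrite c'E mem_cat => ->. Qed.

Let index_eq x y : x \in L -> y \in L -> index x L = index y L -> x = y.
Proof. by move=> xL yL h; rewrite -(nth_index a xL) h nth_index. Qed.

(** [v] is put back at [p v]. A fan triangle and a triangle of the rest are separated by the chord
    that is the base of the former, two fan triangles by a line through [p v]. *)
Lemma star_solve : solvable_below R T -> exists f, solves T c p f.
Proof.
move=> IH; have [_ D' co sh] := star_split.
have sS : S \subset T by apply/subsetP=> t; rewrite inE; apply: fanT.
have SP t : t \in S -> exists s1 y s2, rcons P b = s1 ++ y :: s2 /\ t = [set v; last a s1; y].
  by rewrite inE => /fan_split.
have cT : (#|T :\: S| < #|T|)%N.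
  rewrite -(cardsID S T) (setIidPr sS) -[X in (X < _)%N]add0n ltn_add2r card_gt0.
  have [q qP _] := Q0; apply/set0Pn.
  by exists [set v; last a [::]; head b P]; rewrite inE; case: (P) P0 => // x s _; apply: (mem_fan v a [::]).
have [f' F] := IH _ _ _ cT G'.
pose f x := if x == v then p v else f' x.
have fT t x : t \in T :\: S -> x \in t -> f x = f' x.
  rewrite inE => /andP[tS tT] xt; rewrite /f; case: eqP => // e.
  by move: tS; rewrite inE starT // -e.
have fv : f v = p v by rewrite /f eqxx.
have fc' x : x \in c' -> f x = p' x.
  move=> xc; rewrite /f; case: eqP => [e|_]; first by move: vc'; rewrite -e xc.
  exact: (s_bd F).
have fL x : x \in L -> f x = p' x by move=> /L_c'; apply: fc'.
have TP t : t \in T -> t \in S \/ t \in T :\: S.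
  by move=> tT; rewrite in_setD tT andbT; case: (t \in S); [left|right].
have cross s t : s \in T :\: S -> t \in S -> separated f s t.
  move=> sS' /SP[s1 [y [s2 [e ->]]]]; have [xL yL ix iy] := split_index e.
  set x := last a s1 in xL ix *.
  have xy : x != y by apply/eqP=> h; move: ix; rewrite h iy => /esym/eqP; rewrite ltn_eqF.
  have pxy : p' x != p' y by apply: contra_neq xy; apply: inj'; apply: L_c'.
  have K w : w \in c' -> 0 <= area (p' x) (p' y) (p' w) /\
    (area (p' x) (p' y) (p' w) = 0 -> (w = x /\ p' w = p' x) \/ (w = y /\ p' w = p' y)).
    move=> wc; have [->|wx] := eqVneq w x; first by rewrite area_pqp; split=> // _; left.
    have [->|wy] := eqVneq w y; first by rewrite area_pqq; split=> // _; right.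
    by apply: gt0_side; apply: (SC e).
  exists (p' x), (p' y), x, y, (p' x), (p' y); split=> // w ws; last first.
    move: ws; rewrite !inE => /orP[/orP[]|] /eqP->.
    - by rewrite fv; apply: lt0_side; apply: neg; rewrite // ix iy.
    - by rewrite fL // area_pqp; split=> // _; left.
    - by rewrite fL // area_pqq; split=> // _; right.
  have [wc|wc] := boolP (w \in c'); first by rewrite fc' //; apply: K.
  rewrite (fT s) //; apply: gt0_side; apply: (s_int F sS' ws wc).
    by move=> z /K[].
  exact: not_all_collinear_area not_all_collinear' pxy.
have fans s t : s \in S -> t \in S -> s != t -> separated f s t.
  move=> /SP[s1 [y [s2 [e ->]]]] /SP[s1' [y' [s2' [e' ->]]]] st.
  wlog lt : s1 y s2 s1' y' s2' e e' st / (size s1 < size s1')%N.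
    move=> W; case: (ltngtP (size s1) (size s1')) => h; first exact: W e e' st h.
      by apply: separated_sym; apply: W e' e _ h; rewrite eq_sym.
    have [xL yL ix iy] := split_index e; have [xL' yL' ix' iy'] := split_index e'.
    by move: st; rewrite (index_eq xL xL') ?ix ?ix' // (index_eq yL yL') ?iy ?iy' ?h // eqxx.
  have [xL yL ix iy] := split_index e; have [xL' yL' ix' iy'] := split_index e'.
  have n1 : area (p' (last a s1)) (p' y) (p v) < 0 by apply: neg; rewrite // ix iy.
  (* The spoke from [v] to the last vertex [y] of the earlier triangle. *)
  exists (p v), (p' y), v, y, (p v), (p' y); split.
  - by apply: contraTneq n1 => <-; rewrite area_pqq ltxx.
  - move=> w; rewrite !inE => /orP[/orP[]|] /eqP->.
    + by rewrite fv area_pqp; split=> // _; left.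
    + by rewrite fL //; apply: gt0_side; rewrite areaC13 oppr_gt0.
    + by rewrite fL // area_pqq; split=> // _; right.
  have late w : w \in L -> (index y L < index w L)%N -> area (p v) (p' y) (p' w) < 0.
    by move=> wL h; rewrite area_cyc; apply: neg.
  move=> w; rewrite !inE => /orP[/orP[]|] /eqP->.
  - by rewrite fv area_pqp; split=> // _; left.
  - rewrite fL //; have [->|h] := eqVneq (last a s1') y.
      by rewrite area_pqq; split=> // _; right.
    apply: lt0_side; apply: late => //; rewrite ix' iy ltn_neqAle lt andbT.
    by apply: contra_neq h => h; apply: index_eq; rewrite // ix' iy.
  - by rewrite fL //; apply: lt0_side; apply: late; rewrite // iy' iy.
exists f; split.
- move=> x xc; have [->|xv] := eqVneq x v; first exact: fv.
  rewrite fc' ?p'c //; move: xc; rewrite /c /c' !inE mem_cat inE (negbTE xv) /=.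
  by case/or3P=> ->; rewrite ?orbT.
- move=> s t /TP[sS'|sS'] /TP[tS'|tS'] st.
  + exact: fans.
  + by apply: separated_sym; apply: cross.
  + exact: cross.
  + by apply: separated_ext (s_sep F sS' tS' st) => x xs; rewrite (fT _ _ _ xs).
- move=> t /TP[/SP[s1 [y [s2 [e ->]]]]|tS].
    have [xL yL ix iy] := split_index e.
    exists v, (last a s1), y; split=> //; rewrite fv !fL // area_cyc.
    by rewrite lt_eqF //; apply: neg; rewrite // ix iy.
  have [x [y [z [et h]]]] := s_tri F tS; exists x, y, z; split=> //.
  by rewrite !(fT t) // et !inE eqxx ?orbT.
move=> u t tT ut uc A B hA [w wc nw].
have AB : A != B by apply: contraNneq nw => ->; rewrite area_pp.
(* A point strictly inside the arc has positive weights on [p a], [p v] and [p b], which are not all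
   on the line [AB]. *)
have posP q : q \in P -> 0 < area A B (p' q).
  move=> qP; rewrite /p' qP area_to_bez.
  have /andP[t0 t1] := tau_P qP; move: (tau q) t0 t1 => r t0 t1.
  have [h1 h2 h3] := And3 (hA _ ac) (hA _ vc) (hA _ bc).
  have k1 : 0 < (1 - r) ^+ 2 by rewrite exprn_gt0 //; lra.
  have k2 : 0 < 2 * r * (1 - r) by rewrite !mulr_gt0 //; lra.
  have k3 : 0 < r ^+ 2 by rewrite exprn_gt0.
  have g1 := mulr_ge0 (ltW k1) h1; have g2 := mulr_ge0 (ltW k2) h2.
  have g3 := mulr_ge0 (ltW k3) h3.
  have [e1|e1] := eqVneq (area A B (p a)) 0; last first.
    have : 0 < (1 - r) ^+ 2 * area A B (p a) by rewrite mulr_gt0 // lt_def e1.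
    by lra.
  have [e2|e2] := eqVneq (area A B (p v)) 0; last first.
    have : 0 < 2 * r * (1 - r) * area A B (p v) by rewrite mulr_gt0 // lt_def e2.
    by lra.
  have [e3|e3] := eqVneq (area A B (p b)) 0; last first.
    have : 0 < r ^+ 2 * area A B (p b) by rewrite mulr_gt0 // lt_def e3.
    by lra.
  by move: AB; rewrite (area_all0 _ e1 e2 e3) ?eqxx // gt_eqF.
have [uP|uP] := boolP (u \in P); first by rewrite fc' ?posP // Pc'.
case: (TP _ tT) => tS.
  move: ut tS; rewrite inE => ut /fan_in/(_ ut).
  rewrite !inE mem_rcons inE (negbTE uP) orbF => h; case/negP: uc.
  by case/or3P: h => /eqP->.
rewrite (fT t) //; apply: (s_int F tS ut).
- by apply/negP=> uc'; have [] := c'c uc' uP; rewrite (negbTE uc).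
- move=> x xc'; have [xP|xP] := boolP (x \in P); first by rewrite ltW // posP.
  by have [xc _] := c'c xc' xP; rewrite p'c //; apply: hA.
exact: not_all_collinear_area not_all_collinear' AB.
Qed.

End StarRemoval.

(** * The induction on the number of triangles *)

Section Main.
Variables (R : realFieldType) (V : finType).
Local Notation pt := 'rV[R]_2.
Implicit Types (p : V -> pt) (c s : seq V) (T : {set {set V}}).

Lemma consecutive_noncollinear p s x y : uniq (x :: y :: s) ->
  {in x :: y :: s &, injective p} ->
  (exists s1 a v b s2, x :: y :: s = s1 ++ [:: a, v, b & s2] /\ area (p a) (p v) (p b) != 0)
  \/ (forall z, z \in s -> area (p x) (p y) (p z) = 0).
Proof.
elim: s x y => [|z s IH] x y; first by right.
move=> U I; have [h|h] := eqVneq (area (p x) (p y) (p z)) 0; last first.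
  by left; exists [::], x, y, z, s.
have U' : uniq (y :: z :: s) by move: U => /andP[].
have I' : {in y :: z :: s &, injective p}.
  by move=> u w uc wc; apply: I; rewrite inE ?uc ?wc orbT.
case: (IH y z U' I') => [[s1 [a [v [b [s2 [e n]]]]]]|K].
  by left; exists (x :: s1), a, v, b, s2; rewrite e.
right=> w; rewrite inE => /orP[/eqP->//|/K h2].
have yz : p y != p z.
  move: U' => /andP[]; rewrite inE negb_or => /andP[yz _] _.
  by apply: contra_neq yz; apply: I'; rewrite !inE eqxx ?orbT.
rewrite area_cyc; have h3 : area (p y) (p z) (p x) = 0 by rewrite -area_cyc.
have : area (p x) (p w) (p y) = 0 by apply: col_trans yz h3 h2.
by rewrite -area_cyc areaC23 => /eqP; rewrite oppr_eq0 => /eqP.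
Qed.

Lemma corner p c : uniq c -> (2 < size c)%N -> {in c &, injective p} ->
  weakly_convex p c -> not_all_collinear p c ->
  exists s1 a v b s2, c = s1 ++ [:: a, v, b & s2] /\ 0 < area (p a) (p v) (p b).
Proof.
case: c => [|x [|y s]] //= U _ I W N.
case: (consecutive_noncollinear U I) => [[s1 [a [v [b [s2 [e n]]]]]]|K].
  exists s1, a, v, b, s2; split=> //; rewrite lt_def n W // e.
  exact: subseq_trans (prefix_subseq [:: a; v; b] s2) (suffix_subseq _ _).
have xy : p x != p y.
  move: U => /andP[]; rewrite inE negb_or => /andP[yz _] _.
  by apply: contra_neq yz; apply: I; rewrite !inE eqxx ?orbT.
have [z] := not_all_collinear_area N xy.
by rewrite !inE => /or3P[/eqP->|/eqP->|/K->]; rewrite ?area_pqp ?area_pqq eqxx.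
Qed.

Theorem disk_embedding T c p : good T c p -> exists f, solves T c p f.
Proof.
have [n] := ubnP #|T|; elim: n T c p => // n IHn T c p; rewrite ltnS => Tn G.
have IH : solvable_below R T.
  by move=> S c1 p1 ST; apply: IHn; apply: leq_trans ST Tn.
have D := g_disk G.
have [s1 [a [v [b [s2 [cE D0]]]]]] := corner (d_uniq D) (d_size D) (g_inj G) (g_WC G) (g_NC G).
have {}G : good T (a :: v :: b :: s2 ++ s1) p.
  by apply: (@good_rot _ _ T p s1 [:: a, v, b & s2]); rewrite -cE.
suff [f F] : exists f, solves T (a :: v :: b :: s2 ++ s1) p f.
  by exists f; apply: solves_mem F => x; rewrite cE mem_cat orbC -mem_cat.
move: (s2 ++ s1) G => rest G; have {}D := g_disk G.
have [P [UL vL fanT starT]] := corner_fan D.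
have Uc := d_uniq D.
have [av vb ab] : [/\ a != v, v != b & a != b].
  by move: Uc; rewrite /= !inE !negb_or => /and3P[/and3P[-> -> _] /andP[-> _] _].
(* The only chords that must be looked for are those that spoil the removal of the star: from [v] to
   a boundary vertex inside the link path or, if that path is the edge [ab], this edge. *)
have [/hasP[u uP uc]|/hasPn Pc] := boolP (has (mem (a :: v :: b :: rest)) P).
  have [va vu] : v != a /\ v != u.
    split; first by rewrite eq_sym.
    by apply: contraNneq vL => ->; rewrite inE mem_rcons inE uP !orbT.
  have [ua ub] : u != a /\ u != b.
    move: UL; rewrite /= rcons_uniq mem_rcons inE negb_or => /and3P[/andP[_ aP] bP _].
    by split; [apply: contraNneq aP|apply: contraNneq bP] => <-.
  have ur : u \in rest by move: uc; rewrite !inE (negbTE ua) eq_sym (negbTE vu) (negbTE ub).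
  have e : edge T v u.
    case/splitPr: uP fanT => P1 P2 fanT; apply/edgeP; exists [set v; last a P1; u].
      by apply: fanT; rewrite rcons_cat; apply: mem_fan.
    by rewrite /te vu !inE !eqxx !orbT.
  case/splitPr: ur G {Uc D fanT starT uc} => r1 r2 G.
  have G1 : good T (v :: (b :: r1) ++ u :: rcons r2 a) p.
    move: G; rewrite -[a :: _]/([:: a] ++ _) => /good_rot.
    by rewrite cats1 /= rcons_cat.
  have [|f F] := chord_solve G1 isT _ e IH; first by case: (r2).
  exists f; apply: solves_mem F => x.
  by rewrite !inE !mem_cat !inE !mem_rcons !inE; case: (x == a); rewrite ?orbT //= ?orbF -!orbA.
have [P0|P0] := eqVneq P [::].
  subst P; have tT : [set v; a; b] \in T by apply: fanT; rewrite inE.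
  have e : edge T a b.
    by apply/edgeP; exists [set v; a; b]; rewrite // /te ab !inE !eqxx !orbT.
  have [r0|r0] := eqVneq rest [::]; last exact: (@chord_solve _ _ T a b [:: v] rest).
  subst rest.
  have bd u w : bdT [set [set v; a; b]] u w = ce [:: a; v; b] u w.
    rewrite /bdT big_set1 te3 // 1?eq_sym // /= addbF.
    by rewrite [ed a v u w]edC [ed b a u w]edC -addbA; congr (_ (+) _); rewrite addbC.
  (* This triangle has the same boundary as [T], so the other triangles have boundary zero, and
     there are none. *)
  have TE : T = [set [set v; a; b]].
    have sT : [set [set v; a; b]] \subset T by rewrite sub1set.
    apply/eqP; rewrite eqEsubset sT andbT -setD_eq0; apply/eqP.
    apply: (d_bd_inj D); first exact: subsetDl.
    move=> u w; have := bdT_ID T [set [set v; a; b]] u w.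
    by rewrite (setIidPr sT) bd (d_bd D); case: (ce _ _ _) (bdT _ _ _) => -[].
  exists p; split=> //.
  - by move=> s t; rewrite TE !inE => /eqP-> /eqP->; rewrite eqxx.
  - move=> t; rewrite TE inE => /eqP->; exists v, a, b; split=> //.
    by rewrite areaC oppr_eq0 gt_eqF.
  move=> u t; rewrite TE inE => /eqP->; rewrite !inE => /orP[/orP[]|] -> //; rewrite ?orbT //.
by apply: (star_solve G D0 UL vL fanT starT P0 _ IH) => x /Pc.
Qed.

End Main.

(** * The cyclic order of a convex polygon *)

Section ConvexOrder.
Variables (R : realFieldType) (V : finType) (p : V -> 'rV[R]_2).
(** [nxt x] stands for the end of the boundary edge that leaves [x] counterclockwise. Only local
    facts are assumed; that its orbit is a single cycle, in convex order, is derived. *)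
Variables (B : {set V}) (nxt : V -> V).
Hypothesis nxtB : forall x, x \in B -> nxt x \in B.
Hypothesis nxt_inj : injective nxt.
Hypothesis p_inj : {in B &, injective p}.
Hypothesis nxt_neq : forall x, x \in B -> nxt x != x.
Hypothesis nxt_supp : forall x w, x \in B -> w \in B -> 0 <= area (p x) (p (nxt x)) (p w).
Hypothesis no_vertex_inside : forall x w k, x \in B -> w \in B -> 0 < k < 1 ->
  p w <> p x + k *: (p (nxt x) - p x).
Hypothesis B_noncollinear : forall x z, x \in B -> z \in B -> x != z ->
  exists2 w, w \in B & area (p x) (p z) (p w) != 0.

Let p_neq x y : x \in B -> y \in B -> x != y -> p x != p y.
Proof. by move=> xB yB; apply: contra_neq; apply: p_inj. Qed.

Let supp : supported (fun q => exists2 x, x \in B & q = p x).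
Proof.
move=> m [x xB ->]; exists (p (nxt x)); split.
  by apply: p_neq; rewrite ?nxtB ?nxt_neq.
by move=> q [w wB ->]; apply: nxt_supp.
Qed.

(** The edge leaving [y] stays on the supporting line [xz], goes forward because a vertex off the
    line lies on its left, and cannot jump over [z], as no vertex is inside an edge. *)
Let flat_step x z y k : x \in B -> z \in B -> x != z ->
  (forall w, w \in B -> 0 <= area (p x) (p z) (p w)) -> y \in B ->
  0 <= k -> k < 1 -> p y = p x + k *: (p z - p x) ->
  nxt y = z \/ exists2 l, k < l < 1 & p (nxt y) = p x + l *: (p z - p x).
Proof.
move=> xB zB xz pos yB k0 k1 ey.
have pxz := p_neq xB zB xz.
have nB := nxtB yB; have pyn : p (nxt y) != p y by rewrite p_neq ?nxt_neq.
have col : area (p x) (p z) (p (nxt y)) = 0.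
  have [k00|kn0] := eqVneq k 0.
    have yx : p y = p x by rewrite ey k00 scale0r addr0.
    have := nxt_supp yB zB; rewrite yx areaC23 => h1.
    by have := pos _ nB; lra.
  have kp : 0 < k by rewrite lt_def kn0.
  have h1 := nxt_supp yB xB; have h2 := nxt_supp yB zB.
  have := area_pqp (p y) (p (nxt y)); rewrite {2}ey area_line => h3.
  have e1 : area (p y) (p (nxt y)) (p x) = 0 by nra.
  have e2 : area (p y) (p (nxt y)) (p z) = 0 by nra.
  have pny : p y != p (nxt y) by rewrite eq_sym.
  rewrite -area_cyc -area_cyc.
  have a1 := col_trans pny e1 e2.
  have a2 : area (p x) (p z) (p (nxt y)) = 0.
    have E1 : area (p (nxt y)) (p y) (p x) = 0 by rewrite areaC e1 oppr0.
    have E2 : area (p (nxt y)) (p y) (p z) = 0 by rewrite areaC e2 oppr0.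
    exact: col_trans pyn E1 E2.
  by rewrite area_cyc area_cyc.
have [l el] := collinear_param pxz col.
have [w wB nw] := B_noncollinear xB zB xz.
have wp : 0 < area (p x) (p z) (p w) by rewrite lt_def nw pos.
have E : area (p y) (p (nxt y)) (p w) = (l - k) * area (p x) (p z) (p w).
  by rewrite ey el /area !mxE; ring.
have kl : k < l.
  rewrite lt_def; apply/andP; split.
    by apply: contraNneq pyn => lk; rewrite el lk ey.
  have := nxt_supp yB wB; rewrite E => h.
  by rewrite -subr_ge0 -(pmulr_lge0 _ wp).
have [l1|l1|l1] := ltrgtP l 1.
- by right; exists l; rewrite ?kl.
- have n0 : l - k != 0 by rewrite gt_eqF // subr_gt0.
  case: (@no_vertex_inside y z ((1 - k) / (l - k))) => //.
    by rewrite divr_gt0 ?ltr_pdivrMr; lra.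
  by rewrite ey el; apply: ptP; rewrite !mxE; field.
left; apply: p_inj => //; rewrite el l1 scale1r addrC subrK //.
Qed.

(** With vertices strictly on both sides of [xz], no third vertex is on that line, so only an edge
    crossing it from right to left has to be excluded. *)
Let mixed_step x z y z1 z2 : x \in B -> z \in B -> x != z -> z1 \in B -> z2 \in B ->
  0 < area (p x) (p z) (p z1) -> area (p x) (p z) (p z2) < 0 -> y \in B ->
  y = x \/ area (p x) (p z) (p y) < 0 ->
  nxt y = z \/ nxt y != x /\ area (p x) (p z) (p (nxt y)) < 0.
Proof.
move=> xB zB xz z1B z2B pz1 nz2 yB inv.
have pxz := p_neq xB zB xz; have nB := nxtB yB.
have on_line w : w \in B -> w != x -> w != z -> area (p x) (p z) (p w) != 0.
  move=> wB wx wz; apply/eqP=> h0.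
  apply: (three_collinear supp _ _ _ _ _ _ _ _ h0 pz1 nz2).
  - by exists x. - by exists z. - by exists w. - by exists z1. - by exists z2.
  - exact: p_neq.
  - by apply: p_neq; rewrite // eq_sym.
  - by apply: p_neq; rewrite // eq_sym.
have [nz|nz] := eqVneq (nxt y) z; first by left.
right; have nx : nxt y != x.
  case: inv => [->|yn]; first exact: nxt_neq.
  apply/eqP=> e; have := nxt_supp yB zB; rewrite e -area_cyc -area_cyc area_cyc area_cyc.
  by rewrite area_cyc => h; move: yn; lra.
split=> //; rewrite lt_def eq_sym on_line //= leNgt; apply/negP=> np.
case: inv => [yx|yn].
  by have := nxt_supp yB zB; rewrite yx areaC23; move: np; rewrite yx; lra.
set r := - area (p x) (p z) (p y); set l := area (p x) (p z) (p (nxt y)).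
have [rp lp] : 0 < r /\ 0 < l by rewrite /r oppr_gt0.
have s0 : l + r != 0 by rewrite gt_eqF // addr_gt0.
pose s := p y + (r / (l + r)) *: (p (nxt y) - p y).
have sline : area (p x) (p z) s = 0.
  rewrite /s area_line -/l; have -> : area (p x) (p z) (p y) = - r by rewrite opprK.
  by field.
have [k ek] := collinear_param pxz sline.
have hx := nxt_supp yB xB; have hz := nxt_supp yB zB.
have h1 : (1 - k) * area (p y) (p (nxt y)) (p x) + k * area (p y) (p (nxt y)) (p z) = 0.
  by rewrite -area_line -ek /s area_line area_pqp area_pqq !mulr0 addr0.
have h2 : area (p y) (p (nxt y)) (p z) = area (p y) (p (nxt y)) (p x) - (l + r).
  by rewrite /l /r /area; ring.
(* [z] is weakly left of the edge from [y], so this edge does not meet the line [xz] before [z]. *)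
have k1 : 1 <= k.
  rewrite leNgt; apply/negP=> k1.
  have lr : 0 < l + r by lra.
  have ax : 0 < area (p y) (p (nxt y)) (p x) by lra.
  have : area (p y) (p (nxt y)) (p x) = k * (l + r) by move: h1; rewrite h2; lra.
  move=> h3; have kp : 0 < k by rewrite h3 pmulr_lgt0 in ax.
  have : 0 < (1 - k) * area (p y) (p (nxt y)) (p x) by rewrite mulr_gt0 //; lra.
  have : 0 <= k * area (p y) (p (nxt y)) (p z) by rewrite mulr_ge0 // ltW.
  by lra.
have t01 : 0 < r / (l + r) < 1.
  have lr : 0 < l + r by lra.
  by rewrite divr_gt0 // ltr_pdivrMr //; lra.
have [ke|kn] := eqVneq k 1.
  apply: (@no_vertex_inside y z (r / (l + r))) => //.
  by rewrite -/s ek ke scale1r addrC subrK.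
have kg : 1 < k by rewrite lt_def kn.
(* Now [z] is strictly between [x] and the crossing point [s]. The supporting edge at [z] therefore
   runs along both, and along [y] and [nxt y]; but these two are not collinear with [x]. *)
pose G q := area (p z) (p (nxt z)) q.
have [Gx [Gy Gn]] := (nxt_supp zB xB, (nxt_supp zB yB, nxt_supp zB nB)).
have /andP[t0 t1] := t01.
have Gs : 0 <= G s by rewrite /G /s area_line addr_ge0 // mulr_ge0 //; lra.
have Gz : (1 - k^-1) * G (p x) + k^-1 * G s = 0.
  rewrite /G -area_line ek (_ : _ + _ = p z) ?area_pqp //.
  have k0 : k != 0 by rewrite gt_eqF //; lra.
  by apply: ptP; rewrite !mxE; field.
have i0 : 0 < k^-1 by rewrite invr_gt0; lra.
have i1 : k^-1 < 1 by rewrite invf_lt1 //; lra.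
have Gx0 : G (p x) = 0 by rewrite /G in Gs Gz *; nra.
have Gs0 : G s = 0 by rewrite /G in Gs Gz *; nra.
have Gs1 : (1 - r / (l + r)) * G (p y) + r / (l + r) * G (p (nxt y)) = 0.
  by rewrite /G -area_line -/s.
move: (r / (l + r)) t0 t1 Gs1 => t t0 t1 Gs1.
have Gy0 : G (p y) = 0 by rewrite /G in Gs1 *; nra.
have Gn0 : G (p (nxt y)) = 0 by rewrite /G in Gs1 *; nra.
have pzz : p (nxt z) != p z by rewrite p_neq ?nxtB ?nxt_neq.
have n0 : area (p x) (p y) (p (nxt y)) != 0.
  rewrite area_cyc gt_eqF //.
  have lr : 0 < l + r by lra.
  by lra.
by move/eqP: pzz; apply; apply/esym; apply: (area_all0 n0).
Qed.

(* Walking along nxt from x stays weakly right of the line xz until z. *)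
Let walk x z : x \in B -> z \in B -> x != z ->
  (exists Inv : V -> Prop, Inv x /\ forall y, y \in B -> Inv y ->
     nxt y = z \/ [/\ nxt y != x, Inv (nxt y) & area (p x) (p z) (p (nxt y)) <= 0])
  \/ forall w, w \in B -> area (p x) (p z) (p w) <= 0.
Proof.
move=> xB zB xz.
have [/existsP[z1 /andP[z1B p1]]|/existsPn n1] :=
  boolP [exists z1, (z1 \in B) && (0 < area (p x) (p z) (p z1))]; last first.
  by right=> w wB; move: (n1 w); rewrite wB /= leNgt.
left; have [/existsP[z2 /andP[z2B n2]]|/existsPn p2] :=
  boolP [exists z1, (z1 \in B) && (area (p x) (p z) (p z1) < 0)].
  exists (fun y => y = x \/ area (p x) (p z) (p y) < 0); split; first by left.
  move=> y yB inv; case: (mixed_step xB zB xz z1B z2B p1 n2 yB inv) => [|[h1 h2]]; first by left.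
  by right; split=> //; [right|rewrite ltW].
have pos w : w \in B -> 0 <= area (p x) (p z) (p w).
  by move=> wB; move: (p2 w); rewrite wB /= leNgt.
exists (fun y => exists2 k, 0 <= k < 1 & p y = p x + k *: (p z - p x)); split.
  by exists 0; rewrite ?lexx ?ltr01 // scale0r addr0.
move=> y yB [k /andP[k0 k1] ey].
case: (flat_step xB zB xz pos yB k0 k1 ey) => [|[l /andP[kl l1] el]]; first by left.
right; split.
- apply/eqP=> e; have pzx : p z - p x != 0 by rewrite subr_eq0 eq_sym p_neq.
  have : l *: (p z - p x) = 0 by apply: (addrI (p x)); rewrite -el e addr0.
  by move/eqP; rewrite scaler_eq0 (negbTE pzx) orbF => /eqP l0; lra.
- by exists l; rewrite // l1 andbT; lra.
by rewrite el area_line area_pqp area_pqq; lra.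
Qed.

Let walk_path x z s : x \in B -> z \in B -> x != z -> fpath nxt x s -> z \notin s ->
  (forall w, w \in B -> area (p x) (p z) (p w) <= 0) \/
  (forall y, y \in s -> area (p x) (p z) (p y) <= 0) /\
  (nxt (last x s) = z \/ nxt (last x s) != x).
Proof.
move=> xB zB xz ps zs; case: (walk xB zB xz) => [[Inv [ix st]]|]; last by left.
right; suff [h1 h2 h3] : [/\ forall y, y \in s -> area (p x) (p z) (p y) <= 0,
    Inv (last x s) & last x s \in B].
  by split=> //; case: (st _ h3 h2) => [|[]]; [left|right].
have gen y : y \in B -> Inv y -> fpath nxt y s ->
    [/\ forall y, y \in s -> area (p x) (p z) (p y) <= 0, Inv (last y s) & last y s \in B].
  elim: s zs {ps} y => [|w s IH] zs y yB iy //=.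
  move=> /andP[/eqP e ps]; move: zs; rewrite inE negb_or => /andP[zw zs].
  case: (st y yB iy) => [ez|[_ iw aw]]; first by rewrite -e ez eqxx in zw.
  rewrite e in iw aw; have wB : w \in B by rewrite -e nxtB.
  have [h1 h2 h3] := IH zs w wB iw ps; split=> // u; rewrite inE => /orP[/eqP->//|].
  exact: h1.
exact: gen.
Qed.

Variable a0 : V.
Hypothesis a0B : a0 \in B.
Let c := orbit nxt a0.

Let fc : fcycle nxt c.
Proof. exact: cycle_orbit. Qed.

Let Uc : uniq c.
Proof. exact: orbit_uniq. Qed.

Let orbit_B x z : x \in B -> z \in orbit nxt x -> z \in B.
Proof.
rewrite -fconnect_orbit => xB /iter_findex <-.
by elim: (findex _ _ _) => //= n IH; apply: nxtB.
Qed.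

(** The orbit of [x] returns to [x] without meeting [z], which the invariant of [walk] forbids; what
    remains is that no vertex is strictly left of [xz]. *)
Let orbit_all_aux x z : x \in B -> z \in B -> z \notin orbit nxt x ->
  forall w, w \in B -> area (p x) (p z) (p w) <= 0.
Proof.
move=> xB zB; have cy := cycle_orbit nxt_inj x.
have xo := in_orbit nxt x; move: cy xo; rewrite /orbit -orderSpred /= => cy _ zn.
move: zn; rewrite inE negb_or eq_sym => /andP[xz zs].
move: cy; rewrite rcons_path => /andP[ps /eqP el].
case: (walk_path xB zB xz ps zs) => // -[_ [e|]].
  by move: xz; rewrite -e el eqxx.
by rewrite el eqxx.
Qed.

(** Otherwise [orbit_all_aux] applies in both directions and puts all vertices on the line through
    [a0] and [z]. *)
Lemma orbit_all z : (z \in c) = (z \in B).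
Proof.
apply/idP/idP => [|zB]; first exact: orbit_B.
apply/negPn/negP=> zn; have xz : a0 != z by apply: contraNneq zn => <-; apply: in_orbit.
have h1 := orbit_all_aux a0B zB zn.
have zn' : a0 \notin orbit nxt z.
  by rewrite -fconnect_orbit fconnect_sym // fconnect_orbit.
have h2 := orbit_all_aux zB a0B zn'.
have [w wB] := B_noncollinear a0B zB xz.
by rewrite eq_le h1 //= -oppr_le0 -areaC h2.
Qed.

(** After rotation, [y] is met on the walk from [x] before [z], hence is weakly right of [xz]. *)
Lemma orbit_WC : weakly_convex p c.
Proof.
move=> x y z sxyz.
have m := mem_subseq sxyz.
have [xc yc zc] : [/\ x \in c, y \in c & z \in c] by rewrite !m ?inE ?eqxx ?orbT.
have [xB yB zB] : [/\ x \in B, y \in B & z \in B] by rewrite -!orbit_all.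
have := subseq_uniq sxyz Uc; rewrite /= !inE negb_or => /and3P[/andP[xy xz] yz _].
move: xc fc Uc sxyz => /splitPr h; case: h => s1 s2 cy U sxyz.
have syz : subseq [:: y; z] s2.
  move: U; rewrite cat_uniq /= => /and3P[_ /norP[x1 _] /andP[x2 _]].
  case: (sub3_cat sxyz) => [h|[[h _]|[[h _]|h]]].
  - by move: x1; rewrite (mem_subseq h) // mem_head.
  - by move: x1; rewrite (mem_subseq h) // mem_head.
  - by move: x1; rewrite h.
  by move: h; rewrite /= eqxx.
have {}cy : fcycle nxt (x :: s2 ++ s1) by rewrite -cat_cons -rot_size_cat rot_cycle.
have U2 : uniq (x :: s2 ++ s1) by rewrite -cat_cons uniq_catC.
have : subseq [:: y; z] (s2 ++ s1) by apply: subseq_trans syz (prefix_subseq _ _).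
move: cy U2; rewrite /= rcons_path; move: (s2 ++ s1) => s /andP[ps _] /andP[_ us] s2'.
have zs : z \in s by rewrite (mem_subseq s2') // !inE eqxx orbT.
move: ps us s2'; case/splitPr: zs => A D; rewrite cat_path => /andP[pA _] uAD s2'.
have zA : z \notin A by move: uAD; rewrite cat_uniq /= => /and3P[_ /norP[]].
have yA : y \in A.
  move: uAD; rewrite cat_uniq /= => /and3P[_ _ /andP[zD _]].
  case: (sub2_cat s2') => [h|[]//|].
    by rewrite (mem_subseq h) // mem_head.
  rewrite /= (negbTE yz) => h; move: zD; rewrite (mem_subseq h) // !inE eqxx orbT //.
rewrite -oppr_le0 -areaC23.
case: (walk_path xB zB xz pA zA) => [h|[h _]]; exact: h.
Qed.

Lemma orbit_size : (2 < size c)%N.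
Proof.
have n0 := nxt_neq a0B; have nB := nxtB a0B.
have [w wB nw] := B_noncollinear nB a0B n0.
have : uniq [:: a0; nxt a0; w].
  rewrite /= !inE negb_or eq_sym n0 /= andbT; apply/andP; split; apply: contraNneq nw => <-.
    by rewrite area_pqq.
  by rewrite area_pqp.
move/uniq_leq_size; apply=> x; rewrite orbit_all !inE => /or3P[] /eqP-> //.
Qed.

Lemma orbit_ce u w : ce c u w = [&& u \in B, w \in B & (w == nxt u) || (u == nxt w)].
Proof.
have [uB|uB] /= := boolP (u \in B); last first.
  by apply/negP=> /ce_in[]; rewrite orbit_all (negbTE uB).
have uc : u \in c by rewrite orbit_all.
have sz := orbit_size; have al := orbit_all.
move: uc fc Uc sz al; rewrite /= => /splitPr h; case: h => s1 s2 cy U sz al.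
rewrite ce_rot.
have {}cy : fcycle nxt (u :: s2 ++ s1) by rewrite -cat_cons -rot_size_cat rot_cycle.
have U2 : uniq (u :: s2 ++ s1) by rewrite -cat_cons uniq_catC.
have al2 x : (x \in u :: s2 ++ s1) = (x \in B) by rewrite -al -cat_cons !mem_cat orbC.
have {}sz : (2 < size (u :: s2 ++ s1))%N by move: sz; rewrite /= !size_cat /= addnS addnC.
rewrite cat_cons; move: (s2 ++ s1) cy U2 al2 sz => [|x s] // cy U2 al2 sz.
rewrite ce_head //; move: cy; rewrite /= rcons_path => /and3P[/eqP eu _ /eqP el].
have xl : x != last x s.
  case: s U2 sz {al2 el} => // y s; rewrite [last _ _]/= => /and3P[_ xs _] _.
  by apply: contraNneq xs => ->; rewrite mem_last.
have lB : last x s \in B by rewrite -al2 inE mem_last orbT.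
rewrite eu; have -> : (u == nxt w) = (w == last x s).
  by rewrite -{1}el (inj_eq nxt_inj) eq_sym.
have [->|wx] := eqVneq w x.
  by rewrite (negbTE xl) -al2 !inE eqxx orbT.
by have [->|wl] := eqVneq w (last x s); rewrite ?lB ?andbF.
Qed.

End ConvexOrder.

(** * Crossing parity *)

Section Crossing.
Variable R : realFieldType.
Local Notation pt := 'rV[R]_2.
Implicit Types (u v w q : pt).

(* Whether the vertical ray going up from q crosses the segment uv. The half-open
   convention at the end points makes the count right without general position. *)
Definition cross q u v : bool :=
  ((u 0 0 <= q 0 0) (+) (v 0 0 <= q 0 0)) &&
  (if u 0 0 <= q 0 0 then area u v q < 0 else area v u q < 0).

Lemma crossC q u v : cross q u v = cross q v u.
Proof. by rewrite /cross addbC; case: (u 0 0 <= q 0 0) (v 0 0 <= q 0 0) => -[]. Qed.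

(** [u] is alone on its side of the vertical line through [q], which thus meets the edges [uv] and
    [uw]. Exactly one crossing is above [q] when [q] is between the two edges; above or below both,
    the counts agree. *)
Lemma cross_tri_aux u v w q : 0 < area u v w ->
  (u 0 0 <= q 0 0) != (v 0 0 <= q 0 0) -> (u 0 0 <= q 0 0) != (w 0 0 <= q 0 0) ->
  (0 < area v w q -> 0 < area w u q -> 0 < area u v q -> cross q u v (+) cross q u w) /\
  (~~ [&& 0 <= area v w q, 0 <= area w u q & 0 <= area u v q] ->
    cross q u v = cross q u w).
Proof.
move=> D0; rewrite /cross.
(* The first coordinate of [q] is the mean of those of the vertices with barycentric weights. *)
have E : area v w q * (u 0 0 - q 0 0) + area w u q * (v 0 0 - q 0 0)
    + area u v q * (w 0 0 - q 0 0) = 0 by rewrite /area; ring.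
have S := area_sum u v w q.
rewrite (areaC u v) [area u w q]areaC.
move: (area v w q) (area w u q) (area u v q) D0 E S => a b c D0 E S.
case: (lerP (u 0 0) (q 0 0)) => hu; case: (lerP (v 0 0) (q 0 0)) => // hv _;
  case: (lerP (w 0 0) (q 0 0)) => // hw _ /=; rewrite ?oppr_lt0; split.
- by move=> a0 b0 c0; rewrite b0 ltNge (ltW c0).
- case: (ltrP c 0) => hc; case: (ltrP 0 b) => hb //.
    have : 0 < - c * (w 0 0 - q 0 0) by rewrite mulr_gt0; lra.
    have : 0 <= - b * (v 0 0 - q 0 0) by rewrite mulr_ge0; lra.
    move=> h1 h2; have ha : 0 < a by lra.
    have : 0 <= a * (q 0 0 - u 0 0) by rewrite mulr_ge0; lra.
    lra.
  have h1 : 0 <= c * (w 0 0 - q 0 0) by rewrite mulr_ge0; lra.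
  have h2 : 0 < b * (v 0 0 - q 0 0) by rewrite mulr_gt0; lra.
  rewrite (ltW hb) /= andbT -ltNge => ha.
  have : 0 <= - a * (q 0 0 - u 0 0) by rewrite mulr_ge0; lra.
  lra.
- by move=> a0 b0 c0; rewrite c0 ltNge (ltW b0).
case: (ltrP 0 c) => hc; case: (ltrP b 0) => hb //.
  rewrite (ltW hc) /= andbT -ltNge => ha.
  have h1 : 0 <= c * (q 0 0 - w 0 0) by rewrite mulr_ge0; lra.
  have h2 : 0 <= b * (q 0 0 - v 0 0) by rewrite mulr_ge0; lra.
  have : 0 < - a * (u 0 0 - q 0 0) by rewrite mulr_gt0; lra.
  lra.
move=> _.
have h1 : 0 <= - c * (q 0 0 - w 0 0) by rewrite mulr_ge0; lra.
have h2 : 0 <= - b * (q 0 0 - v 0 0) by rewrite mulr_ge0; lra.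
have ha : 0 < a by lra.
have : 0 < a * (u 0 0 - q 0 0) by rewrite mulr_gt0; lra.
lra.
Qed.

(** If a vertex is alone on its side of the vertical line through [q], it takes the role of [u] in
    [cross_tri_aux]. If none is, no edge is crossed, and [q] cannot be strictly inside. *)
Lemma cross_tri u v w q : 0 < area u v w ->
  (0 < area v w q -> 0 < area w u q -> 0 < area u v q ->
    cross q u v (+) cross q v w (+) cross q u w) /\
  (~~ [&& 0 <= area v w q, 0 <= area w u q & 0 <= area u v q] ->
    cross q u v (+) cross q v w (+) cross q u w = false).
Proof.
move=> D0.
have same (x y : pt) : (x 0 0 <= q 0 0) = (y 0 0 <= q 0 0) -> cross q x y = false.
  by move=> e; rewrite /cross e addbb.
have [e1|n1] := eqVneq (u 0 0 <= q 0 0) (v 0 0 <= q 0 0);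
 have [e2|n2] := eqVneq (u 0 0 <= q 0 0) (w 0 0 <= q 0 0).
- rewrite !same -?e1 //; split=> // h1 h2 h3.
  have E : area v w q * (u 0 0 - q 0 0) + area w u q * (v 0 0 - q 0 0)
    + area u v q * (w 0 0 - q 0 0) = 0 by rewrite /area; ring.
  case: (lerP (u 0 0) (q 0 0)) e1 e2 => hu /esym hv /esym hw.
    have k1 : 0 <= area v w q * (q 0 0 - u 0 0) by rewrite mulr_ge0; lra.
    have k2 : 0 <= area w u q * (q 0 0 - v 0 0) by rewrite mulr_ge0; lra.
    have k3 : 0 <= area u v q * (q 0 0 - w 0 0) by rewrite mulr_ge0; lra.
    have [z1 z2] : area v w q * (q 0 0 - u 0 0) = 0 /\ area w u q * (q 0 0 - v 0 0) = 0 by lra.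
    have z3 : area u v q * (q 0 0 - w 0 0) = 0 by lra.
    have [f1 f2 f3] : [/\ q 0 0 = u 0 0, q 0 0 = v 0 0 & q 0 0 = w 0 0].
      by split; nra.
    by move: D0; rewrite /area -f1 -f2 -f3; lra.
  move: hv hw => /negbT; rewrite -ltNge => hv /negbT; rewrite -ltNge => hw.
  have k1 : 0 < area v w q * (u 0 0 - q 0 0) by rewrite mulr_gt0; lra.
  have k2 : 0 < area w u q * (v 0 0 - q 0 0) by rewrite mulr_gt0; lra.
  have k3 : 0 < area u v q * (w 0 0 - q 0 0) by rewrite mulr_gt0; lra.
  lra.
- have D1 : 0 < area w u v by rewrite area_cyc.
  have [||h1 h2] := cross_tri_aux (q := q) D1; first by rewrite eq_sym.
    by rewrite -e1 eq_sym.
  rewrite (same u v) // addFb crossC [cross q u w]crossC; split=> [a b c|h].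
    by rewrite addbC h1.
  by rewrite h2 ?addbb //; apply: contra h => /and3P[-> -> ->].
- have D1 : 0 < area v w u by rewrite -area_cyc.
  have [||h1 h2] := cross_tri_aux (q := q) D1; rewrite -?e2 1?eq_sym //.
  rewrite (same u w) // addbF crossC; split=> [a b c|h].
    by rewrite addbC h1.
  by rewrite h2 ?addbb //; apply: contra h => /and3P[-> -> ->].
have [h1 h2] := cross_tri_aux D0 n1 n2.
rewrite (same v w) ?addbF //; last by case: (u 0 0 <= q 0 0) (v 0 0 <= q 0 0) (w 0 0 <= q 0 0) n1 n2 => -[] [].
by split=> [|h]; [exact: h1|rewrite h2 ?addbb].
Qed.

Lemma area_bary_coord u v w (a b c : R) : a + b + c = 1 ->
  let q := a *: u + b *: v + c *: w in
  [/\ area v w q = a * area u v w, area w u q = b * area u v w & area u v q = c * area u v w].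
Proof.
move=> h /=; have -> : a = 1 - b - c by lra.
by rewrite /area !mxE; split; ring.
Qed.

Lemma cross_bary u v w (a b c : R) : area u v w != 0 -> a + b + c = 1 ->
  let q := a *: u + b *: v + c *: w in
  (0 < a -> 0 < b -> 0 < c -> cross q u v (+) cross q v w (+) cross q u w) /\
  (~~ [&& 0 <= a, 0 <= b & 0 <= c] -> cross q u v (+) cross q v w (+) cross q u w = false).
Proof.
move=> n0 h q; have [ea eb ec] := area_bary_coord u v w h; rewrite -/q in ea eb ec.
have [Dn|Dp|/eqP] := ltrgtP (area u v w) 0; last by rewrite (negbTE n0).
  have D' : 0 < area u w v by rewrite areaC23; lra.
  have [h1 h2] := cross_tri q D'.
  have E : cross q u v (+) cross q v w (+) cross q u w =
      cross q u w (+) cross q w v (+) cross q u v.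
    by rewrite (crossC q w v); case: (cross q u v) (cross q v w) (cross q u w) => -[] [].
  rewrite E; have [e1 e2 e3] : [/\ area w v q = a * - area u v w,
      area v u q = c * - area u v w & area u w q = b * - area u v w].
    by rewrite areaC ea [area v u q]areaC ec [area u w q]areaC eb !mulrN.
  split=> [a0 b0 c0|n]; first by apply: h1; rewrite ?e1 ?e2 ?e3 mulr_gt0 //; lra.
  have Dm : 0 < - area u v w by lra.
  by apply: h2; rewrite e1 e2 e3 !pmulr_lge0 //; apply: contra n => /and3P[-> -> ->].
have [h1 h2] := cross_tri q Dp.
split=> [a0 b0 c0|n]; first by apply: h1; rewrite ?ea ?eb ?ec mulr_gt0.
by apply: h2; rewrite ea eb ec !pmulr_lge0.
Qed.

Definition disjoint_segments q q' u v :=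
  forall k l : R, 0 <= k <= 1 -> 0 <= l <= 1 -> u + k *: (v - u) <> q + l *: (q' - q).

(** The vertex [w] is passed by the upward ray as its foot moves from [q] to [q']; half-open in the
    same way as [cross]. *)
Definition above q q' w : bool :=
  [&& q 0 0 < w 0 0, w 0 0 <= q' 0 0 & 0 < area q q' w].

Lemma sign_const (f : R -> R) (a b k0 k1 : R) :
  (forall k, f k = a + k * b) -> k0 <= k1 ->
  (forall k, k0 <= k <= k1 -> f k != 0) -> (0 < f k0) = (0 < f k1).
Proof.
move=> fE k01 nz; apply/idP/idP => h; rewrite ltNge; apply/negP=> h'.
  have d : 0 < f k0 - f k1.
    have := nz k1; rewrite lexx k01 => /(_ isT) n1.
    have : f k1 < 0 by rewrite lt_neqAle n1.
    by lra.
  have d0 : f k0 - f k1 != 0 by rewrite gt_eqF.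
  (* The zero of the affine function [f] between [k0] and [k1]. *)
  have := nz (k0 + f k0 / (f k0 - f k1) * (k1 - k0)).
  have t0 : 0 <= f k0 / (f k0 - f k1) by rewrite divr_ge0 // ltW.
  have t1 : f k0 / (f k0 - f k1) <= 1 by rewrite ler_pdivrMr // mul1r; lra.
  rewrite lerDl mulr_ge0 ?subr_ge0 //= => /(_ _)/eqP[].
    have : f k0 / (f k0 - f k1) * (k1 - k0) <= 1 * (k1 - k0).
      by rewrite ler_wpM2r // subr_ge0.
    by lra.
  by move: d0; rewrite !fE => d0; field.
have d : 0 < f k1 - f k0.
  have := nz k0; rewrite lexx k01 => /(_ isT) n1.
  have : f k0 < 0 by rewrite lt_neqAle n1.
  by lra.
have d0 : f k1 - f k0 != 0 by rewrite gt_eqF.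
have := nz (k0 + (- f k0) / (f k1 - f k0) * (k1 - k0)).
have t0 : 0 <= (- f k0) / (f k1 - f k0) by rewrite divr_ge0 ?oppr_ge0 // ltW.
have t1 : (- f k0) / (f k1 - f k0) <= 1 by rewrite ler_pdivrMr // mul1r; lra.
rewrite lerDl mulr_ge0 ?subr_ge0 //= => /(_ _)/eqP[].
  have : (- f k0) / (f k1 - f k0) * (k1 - k0) <= 1 * (k1 - k0).
    by rewrite ler_wpM2r // subr_ge0.
  by lra.
by move: d0; rewrite !fE => d0; field.
Qed.

(** As long as [uv] does not meet [qq'], a crossing appears or disappears only when the ray passes
    an end of [uv]. *)
Lemma cross_move_lr q q' u v : disjoint_segments q q' u v ->
  q 0 0 < q' 0 0 -> u 0 0 <= v 0 0 ->
  cross q u v (+) cross q' u v = above q q' u (+) above q q' v.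
Proof.
move=> dj qq uv; rewrite /cross /above.
have [vq|qv] := lerP (v 0 0) (q 0 0).
  have uq := le_trans uv vq.
  by rewrite uq (le_trans vq (ltW qq)) (le_trans uq (ltW qq)) /= !(ltNge (q 0 0)) uq.
have [uq'|q'u] := lerP (u 0 0) (q' 0 0); last first.
  have q'v : q' 0 0 < v 0 0 by apply: lt_le_trans uv.
  have qu : q 0 0 < u 0 0 by apply: lt_trans q'u.
  by rewrite (lt_geF qu) (lt_geF q'v) /= !andbF.
set d := q' 0 0 - q 0 0.
have d0 : 0 < d by rewrite subr_gt0.
(* The side of [qq'] on which a point of [uv] lies; over the strip between [q] and [q'] disjointness
   keeps [f] from vanishing, so its sign is constant there. *)
pose f k := area q q' (u + k *: (v - u)).
have fE k : f k = area q q' u + k * (area q q' v - area q q' u).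
  by rewrite /f area_line; ring.
have fne k : 0 <= k <= 1 -> q 0 0 <= u 0 0 + k * (v 0 0 - u 0 0) <= q' 0 0 -> f k != 0.
  move=> k01 /andP[x0 x1]; apply/eqP=> f0.
  have qq' : q != q' by apply: contraTneq qq => ->; rewrite ltxx.
  have [l el] := collinear_param qq' f0; apply: (dj k l k01 _ el).
  have : (u + k *: (v - u)) 0 0 = (q + l *: (q' - q)) 0 0 by rewrite el.
  rewrite !mxE -/d => E; rewrite E in x0 x1.
  have h1 : 0 <= l * d by lra.
  have dE : d = q' 0 0 - q 0 0 by [].
  have h2 : l * d <= 1 * d by lra.
  by rewrite -(pmulr_lge0 _ d0) h1 -(ler_pM2r d0) h2.
have at_x x : u 0 0 <= x -> x < v 0 0 ->
  let k := (x - u 0 0) / (v 0 0 - u 0 0) in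
  [/\ 0 <= k, k < 1 & u 0 0 + k * (v 0 0 - u 0 0) = x].
  move=> ux xv; have w0 : 0 < v 0 0 - u 0 0 by lra.
  split; first by rewrite divr_ge0 // ?subr_ge0 // ltW.
    by rewrite ltr_pdivrMr //; lra.
  by rewrite divfK ?gt_eqF //; lra.
have sgn x (r : pt) : r 0 0 = x -> area q q' r = 0 -> u 0 0 <= x -> x < v 0 0 ->
  (area u v r < 0) = (0 < f ((x - u 0 0) / (v 0 0 - u 0 0))).
  move=> rx r0 ux xv; have w0 : 0 < v 0 0 - u 0 0 by lra.
  have E : f ((x - u 0 0) / (v 0 0 - u 0 0)) * (v 0 0 - u 0 0) = - area u v r * d.
    have kw : (x - u 0 0) / (v 0 0 - u 0 0) * (v 0 0 - u 0 0) = x - u 0 0.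
      by rewrite divfK ?gt_eqF.
    rewrite fE mulrDl mulrAC kw; apply/eqP; rewrite -subr_eq0.
    rewrite (_ : _ - _ = (v 0 0 - u 0 0) * area q q' r); first by rewrite r0 mulr0.
    by rewrite -rx /d /area; ring.
  by rewrite -(pmulr_lgt0 _ w0) E pmulr_lgt0 // oppr_gt0.
have key k0 k1 : 0 <= k0 -> k0 <= k1 -> k1 <= 1 -> q 0 0 <= u 0 0 + k0 * (v 0 0 - u 0 0) ->
    u 0 0 + k1 * (v 0 0 - u 0 0) <= q' 0 0 -> (0 < f k0) = (0 < f k1).
  move=> h0 h01 h1 x0 x1; apply: (sign_const fE) => // k /andP[hk0 hk1].
  apply: fne; first by apply/andP; split; lra.
  have w0 : 0 <= v 0 0 - u 0 0 by rewrite subr_ge0.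
  have := ler_wpM2r w0 hk0; have := ler_wpM2r w0 hk1 => m1 m0.
  by apply/andP; split; lra.
have f0 : f 0 = area q q' u by rewrite fE mul0r addr0.
have f1 : f 1 = area q q' v by rewrite fE mul1r addrC subrK.
have aq : area q q' q = 0 by rewrite area_pqp.
have aq' : area q q' q' = 0 by rewrite area_pqq.
rewrite /=; case: (lerP (u 0 0) (q 0 0)) => hu; case: (lerP (v 0 0) (q' 0 0)) => hv /=.
- have [a1 a2 a3] := at_x _ hu qv.
  by rewrite (sgn _ _ erefl aq hu qv) addbF -f1; apply: key => //; lra.
- have [a1 a2 a3] := at_x _ hu qv; have [b1 b2 b3] := at_x _ uq' hv.
  rewrite (sgn _ _ erefl aq hu qv) (sgn _ _ erefl aq' uq' hv).
  have w0 : 0 < v 0 0 - u 0 0 by lra.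
  rewrite (key _ ((q' 0 0 - u 0 0) / (v 0 0 - u 0 0))) ?addbb //; try lra.
  by rewrite ler_pM2r ?invr_gt0 //; lra.
- by rewrite -f0 -f1 (key 0 1) ?addbb //; lra.
have [b1 b2 b3] := at_x _ uq' hv.
by rewrite (sgn _ _ erefl aq' uq' hv) addbF -f0; apply/esym; apply: key => //; lra.
Qed.

Lemma cross_move_vert q q' u v : disjoint_segments q q' u v ->
  q 0 0 = q' 0 0 -> u 0 0 <= v 0 0 -> cross q u v = cross q' u v.
Proof.
move=> dj qq uv; rewrite /cross -qq; case: (lerP (u 0 0) (q 0 0)) => hu; last first.
  by rewrite (lt_geF (lt_le_trans hu uv)).
case: (lerP (v 0 0) (q 0 0)) => // hv /=.
pose g l := area u v (q + l *: (q' - q)).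
have gE l : g l = area u v q + l * (area u v q' - area u v q) by rewrite /g area_line; ring.
have w0 : 0 < v 0 0 - u 0 0 by lra.
have gn l : 0 <= l <= 1 -> g l != 0.
  move=> l01; apply/eqP=> g0.
  have uv' : u != v by apply: contraTneq w0 => ->; rewrite subrr ltxx.
  have [k ek] := collinear_param uv' g0; apply: (dj k l _ l01); last by rewrite ek.
  have : (q + l *: (q' - q)) 0 0 = (u + k *: (v - u)) 0 0 by rewrite ek.
  rewrite !mxE -qq subrr mulr0 addr0 => E.
  have e1 : 0 <= k * (v 0 0 - u 0 0) by lra.
  have e2 : k * (v 0 0 - u 0 0) <= 1 * (v 0 0 - u 0 0) by lra.
  by rewrite -(pmulr_lge0 _ w0) e1 -(ler_pM2r w0) e2.
have h := sign_const gE ler01 gn.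
have g0 : g 0 = area u v q by rewrite gE mul0r addr0.
have g1 : g 1 = area u v q' by rewrite gE mul1r addrC subrK.
have n0 : area u v q != 0 by rewrite -g0 gn // lexx ler01.
have n1 : area u v q' != 0 by rewrite -g1 gn // lexx ler01.
rewrite g0 g1 in h.
by rewrite !ltNge !le_eqVlt ![0 == _]eq_sym (negbTE n0) (negbTE n1) h.
Qed.

Lemma disjoint_segmentsC q q' u v : disjoint_segments q q' u v -> disjoint_segments q q' v u.
Proof.
move=> dj k l /andP[k0 k1] l01 e; apply: (dj (1 - k) l _ l01); first by apply/andP; split; lra.
by rewrite -e; apply: ptP; rewrite !mxE; ring.
Qed.

Lemma cross_move q q' u v : disjoint_segments q q' u v -> q 0 0 <= q' 0 0 ->
  cross q u v (+) cross q' u v = above q q' u (+) above q q' v.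
Proof.
move=> dj; wlog uv : u v dj / u 0 0 <= v 0 0.
  move=> W; have [h|/ltW h] := lerP (u 0 0) (v 0 0); first exact: W.
  by rewrite !(crossC _ u) addbC [RHS]addbC addbC; apply: W => //; apply: disjoint_segmentsC.
rewrite le_eqVlt => /orP[/eqP qq|qq]; last exact: cross_move_lr.
rewrite (cross_move_vert dj qq uv) addbb /above -qq.
have no (w : pt) : (q 0 0 < w 0 0) && (w 0 0 <= q 0 0) = false.
  by rewrite ltNge andNb.
by rewrite !andbA !no.
Qed.

End Crossing.

(** * The crossing parity of a mod 2 cycle *)

Section ParityOfCrossings.
Variables (R : realFieldType) (V : finType) (pos : V -> 'rV[R]_2).
Implicit Types (z : V -> V -> bool) (q : 'rV[R]_2).

(** An arbitrary total order on the vertices, by which each undirected edge is counted once. *)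
Let ord (u v : V) := (enum_rank u < enum_rank v)%N.

Definition crossings z q : bool := \big[addb/false]_u \big[addb/false]_v
  [&& z u v, ord u v & cross q (pos u) (pos v)].

Let ordC u v : u != v -> ord u v (+) ord v u.
Proof.
rewrite /ord; case: ltngtP => // /val_inj /enum_rank_inj ->; by rewrite eqxx.
Qed.

Lemma eq_par z1 z2 q : (forall u v, z1 u v = z2 u v) -> crossings z1 q = crossings z2 q.
Proof. by move=> h; apply: eq_bigr => u _; apply: eq_bigr => v _; rewrite h. Qed.

Lemma par0 z q : (forall u v, z u v = false) -> crossings z q = false.
Proof. by move=> h; rewrite /crossings big1 // => u _; rewrite big1 // => v _; rewrite h. Qed.

Lemma parD z1 z2 q : crossings (fun u v => z1 u v (+) z2 u v) q = crossings z1 q (+) crossings z2 q.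
Proof.
rewrite /crossings -big_split; apply: eq_bigr => u _ /=; rewrite -big_split.
by apply: eq_bigr => v _ /=; rewrite -andb_addl.
Qed.

Lemma par_bdT (S : {set {set V}}) q : crossings (bdT S) q = \big[addb/false]_(t in S) crossings (te t) q.
Proof.
rewrite exchange_big /=; apply: eq_bigr => u _; rewrite exchange_big /=.
apply: eq_bigr => v _; case h: (ord u v && _); last first.
  by rewrite andbF big1 // => t _; rewrite andbF.
by rewrite andbT; apply: eq_bigr => t _; rewrite andbT.
Qed.

Lemma par_ed x y q : x != y -> crossings (ed x y) q = cross q (pos x) (pos y).
Proof.
move=> xy; rewrite /crossings (eq_bigr (fun u => ((u == x) && ord x y && cross q (pos x) (pos y))
   (+) ((u == y) && ord y x && cross q (pos y) (pos x)))).
  rewrite big_split /= (@big_addb1 _ x) => [|u /negbTE-> //].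
  rewrite (@big_addb1 _ y) => [|u /negbTE-> //]; rewrite !eqxx crossC -andb_addl.
  by rewrite ordC.
move=> u _; rewrite /ed.
under eq_bigr => v _ do rewrite andb_addl.
rewrite big_split /= (@big_addb1 _ y) => [|v /negbTE->]; last by rewrite andbF.
rewrite (@big_addb1 _ x) => [|v /negbTE->]; last by rewrite andbF.
rewrite !eqxx !andbT; congr (_ (+) _).
  by case: eqP => [->|].
by case: eqP => [->|].
Qed.

Lemma par_te x y w q : x != y -> y != w -> x != w ->
  crossings (te [set x; y; w]) q =
  cross q (pos x) (pos y) (+) cross q (pos y) (pos w) (+) cross q (pos x) (pos w).
Proof.
move=> xy yw xw; rewrite -!par_ed // -!parD; apply: eq_par => u v; exact: te3.
Qed.

(** By [cross_move] the total change is a sum over the vertices passed, each counted with its degree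
    in [z], which is even. *)
Lemma par_move z q q' : (forall u v, z u v = z v u) -> (forall u, z u u = false) ->
  evenrel z -> (forall u v, z u v -> disjoint_segments q q' (pos u) (pos v)) ->
  crossings z q = crossings z q'.
Proof.
move=> zs zi ze; wlog qq : q q' / q 0 0 <= q' 0 0.
  move=> W dj; have [h|/ltW h] := lerP (q 0 0) (q' 0 0); first exact: W.
  apply/esym; apply: W h _ => u v /dj d k l k01 /andP[l0 l1] e.
  apply: (d k (1 - l) k01); first by apply/andP; split; lra.
  by rewrite e; apply: ptP; rewrite !mxE; ring.
move=> dj; suff : crossings z q (+) crossings z q' = false by case: (crossings z q) (crossings z q') => -[].
rewrite /crossings -big_split.
pose W u := above q q' (pos u).
rewrite (eq_bigr (fun u => (\big[addb/false]_v ([&& z u v, ord u v & W u]))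
   (+) (\big[addb/false]_v ([&& z u v, ord u v & W v])))); last first.
  move=> u _ /=; rewrite -!big_split; apply: eq_bigr => v _ /=.
  rewrite -!andb_addr; case zuv: (z u v) => //=.
  by rewrite (cross_move (dj u v zuv) qq).
rewrite big_split /= [X in _ (+) X]exchange_big /= -big_split big1 // => u _ /=.
rewrite -big_split /=.
rewrite (eq_bigr (fun v => z u v && W u)) => [|v _].
  case: (W u); last by rewrite big1 // => v _; rewrite andbF.
  by rewrite -[RHS](ze u); apply: eq_bigr => v _; rewrite andbT.
rewrite (zs v u); case zuv: (z u v) => //=; rewrite -andb_addl ordC //.
by apply: contraTneq zuv => ->; rewrite zi.
Qed.

End ParityOfCrossings.

(** * Injectivity and surjectivity of the boundary operator *)

Section Homology.
Variables (R : realFieldType) (V : finType) (pos : V -> 'rV[R]_2).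
Variables (T : {set {set V}}) (cen : {set V} -> 'rV[R]_2).
Hypothesis T3 : forall t, t \in T -> #|t| = 3.
Hypothesis T2 : forall u v, (#|[set t in T | te t u v]| <= 2)%N.
Hypothesis par_cen : forall t t', t \in T -> t' \in T -> crossings pos (te t) (cen t') = (t == t').
(** The parity of crossings acts as a winding number mod 2: between adjacent triangles it can change
    only across an edge of [z]. *)
Hypothesis par_cross : forall t t' a b (z : V -> V -> bool), t \in T -> t' \in T -> t != t' ->
  te t a b -> te t' a b -> (forall u v, z u v = z v u) ->
  (forall u v, z u v -> edge T u v) -> evenrel z -> ~~ z a b ->
  crossings pos z (cen t) = crossings pos z (cen t').

(** At the centre of [t0] the boundary of [S] has odd crossing number exactly when [t0] is in
    [S]. *)
Lemma bdT_inj (S : {set {set V}}) : S \subset T -> (forall u v, bdT S u v = false) -> S = set0.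
Proof.
move=> sS h; apply/eqP/negPn/negP=> /set0Pn[t0 t0S].
have t0T := subsetP sS _ t0S.
have : crossings pos (bdT S) (cen t0) = false by apply: par0.
rewrite par_bdT (bigD1 t0) //= par_cen // eqxx big1 ?addbF // => t /andP[tS tt].
by rewrite par_cen ?(negbTE tt) // (subsetP sS).
Qed.

(** [S0] is the set of triangles enclosed by [z]. Across an edge of two triangles the parity changes
    exactly if the edge is in [z], so the boundary of [S0] differs from [z] only on [c], and there
    by nothing or by all of [c]. *)
Lemma bdT_onto (c : seq V) (z : V -> V -> bool) : uniq c -> (forall u v, bdT T u v = ce c u v) ->
  (forall u v, z u v = z v u) -> (forall u v, z u v -> edge T u v) -> evenrel z ->
  exists2 S : {set {set V}}, S \subset T & forall u v, z u v = bdT S u v.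
Proof.
move=> Uc Tc zs zT ze.
pose S0 := [set t in T | crossings pos z (cen t)].
have sS : S0 \subset T by apply/subsetP=> t; rewrite inE => /andP[].
have S3 t : t \in S0 -> #|t| = 3 by move=> /(subsetP sS); apply: T3.
pose y u v := bdT S0 u v (+) z u v.
have two t1 t2 u v : t1 \in T -> t2 \in T -> t1 != t2 -> te t1 u v -> te t2 u v ->
    bdT S0 u v = (t1 \in S0) (+) (t2 \in S0).
  move=> t1T t2T n12 e1 e2.
  have E : [set t in T | te t u v] = [set t1; t2].
    apply/esym/eqP; rewrite eqEcard cards2 n12 T2 andbT.
    by apply/subsetP=> t; rewrite !inE => /orP[] /eqP->; apply/andP.
  rewrite /bdT (bigID (fun t => t \in [set t1; t2])) /= addbC big1 => [|t /andP[tS]].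
    rewrite addFb.
    rewrite (eq_bigl (fun t => (t \in [set t1; t2]) && (t \in S0))) => [|t]; last by rewrite andbC.
    rewrite big_mkcondr /= big_setU1 ?in_set1 // big_set1 e1 e2.
    by case: (t1 \in S0) (t2 \in S0) => -[].
  by rewrite -E inE (subsetP sS _ tS) => /negbTE.
have yc u v : y u v -> ce c u v.
  rewrite -Tc; apply: contraLR => nT; rewrite /y.
  have [/edgeP[t tT tt]|ne] := boolP (edge T u v); last first.
    rewrite (_ : z u v = false); last by apply/negP=> /zT; rewrite (negbTE ne).
    rewrite addbF; apply: contra ne => /bdT_te[t tS tt]; apply/edgeP; exists t => //.
    exact: (subsetP sS).
  have [t' [t'T tt' n']] : exists t', [/\ t' \in T, te t' u v & t != t'].
    have : (1 < #|[set t in T | te t u v]|)%N.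
      have : (0 < #|[set t in T | te t u v]|)%N by apply/card_gt0P; exists t; rewrite inE tT.
      by move: nT; rewrite bdT_card; case: #|_| => [|[|]].
    case/card_gt1P=> t1 [t2]; rewrite !inE => -[/andP[h1 k1] /andP[h2 k2] n12].
    have [e|n] := eqVneq t t1; first by exists t2; rewrite e; split.
    by exists t1; split.
  rewrite (two t t' u v tT t'T n' tt tt') !inE tT t'T /=.
  case zuv: (z u v); last first.
    by rewrite (par_cross tT t'T n' tt tt' zs zT ze) ?zuv // addbb.
  (* Here [uv] is in [z]. Adding the boundary of [t] removes it and changes the parity at [cen t]
     but not at [cen t']. *)
  have H : crossings pos (fun a b => z a b (+) te t a b) (cen t)
      = crossings pos (fun a b => z a b (+) te t a b) (cen t').
    apply: (par_cross tT t'T n' tt tt') => [a b|a b||].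
    - by rewrite zs te_sym.
    - by case zab: (z a b) => /= tab; [exact: zT|apply/edgeP; exists t].
    - by apply: evenD ze _; apply: te_even; apply: T3.
    - by rewrite zuv tt.
  move: H; rewrite !parD !par_cen // eqxx (negbTE n').
  by case: (crossings _ _ _) (crossings _ _ _) => -[].
have ys u v : y u v = y v u by rewrite /y zs bdT_sym.
have ye : evenrel y by apply: evenD ze; apply: bdT_even.
case: (even_subcycle Uc ys ye yc) => h.
  by exists S0 => // u v; move: (h u v); rewrite /y; case: (bdT _ _ _) (z u v) => -[].
(* The difference is all of [c], the boundary of [T], so the complement of [S0] has boundary [z]. *)
exists (T :\: S0); first exact: subsetDl.
move=> u v; move: (h u v) (bdT_ID T S0 u v); rewrite /y Tc (setIidPr sS).
by case: (bdT S0 u v) (bdT (T :\: S0) u v) (z u v) (ce c u v) => -[] [] [].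
Qed.

End Homology.

(** * Barycentric coordinates and complexes in the plane *)

Section SmallSums.
Variables (V : finType) (M : nmodType) (F : V -> M).

Lemma sum1_supp x : (forall v, v != x -> F v = 0) -> \sum_v F v = F x.
Proof. by move=> h; rewrite (bigD1 x) //= big1 ?addr0. Qed.

Lemma sum2_supp x y : x != y -> (forall v, v != x -> v != y -> F v = 0) ->
  \sum_v F v = F x + F y.
Proof.
move=> xy h; rewrite (bigD1 x) //= (bigD1 y) /=; last by rewrite eq_sym.
by rewrite big1 ?addr0 // => v /andP[vx vy]; apply: h.
Qed.

Lemma sum3_supp x y z : x != y -> y != z -> x != z ->
  (forall v, v != x -> v != y -> v != z -> F v = 0) -> \sum_v F v = F x + F y + F z.
Proof.
move=> xy yz xz h; rewrite (bigD1 x) //= (bigD1 y) /=; last by rewrite eq_sym.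
rewrite (bigD1 z) /=; last by rewrite ![z == _]eq_sym xz yz.
by rewrite big1 ?addr0 ?addrA // => v /andP[/andP[vx vy] vz]; apply: h.
Qed.

Lemma sum4_supp x y z w : uniq [:: x; y; z; w] ->
  (forall v, v \notin [:: x; y; z; w] -> F v = 0) -> \sum_v F v = F x + F y + F z + F w.
Proof.
move=> U h; rewrite (bigID (mem [:: x; y; z; w])) /= [X in _ + X]big1 ?addr0 //.
by rewrite -big_uniq //= !big_cons big_nil addr0 !addrA.
Qed.

End SmallSums.

Section Weights.
Variables (R : realFieldType) (V : finType).
Local Notation pt := 'rV[R]_2.
Implicit Types (f : V -> pt) (w : V -> R) (s t : {set V}).

Definition wsum f w := \sum_v w v *: f v.

Definition bary s w := [/\ forall v, 0 <= w v, forall v, v \notin s -> w v = 0 & \sum_v w v = 1].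

Definition weight3 (x y z : V) (a b c : R) v :=
  if v == x then a else if v == y then b else if v == z then c else 0.

Lemma weight3E x y z a b c : x != y -> y != z -> x != z ->
  [/\ weight3 x y z a b c x = a, weight3 x y z a b c y = b & weight3 x y z a b c z = c].
Proof.
move=> xy yz xz; rewrite /weight3 !eqxx [y == x]eq_sym [z == x]eq_sym [z == y]eq_sym.
by rewrite (negbTE xy) (negbTE yz) (negbTE xz).
Qed.

Lemma weight3_out x y z a b c v : v \notin [set x; y; z] -> weight3 x y z a b c v = 0.
Proof. by rewrite !inE !negb_or /weight3 => /andP[/andP[/negbTE-> /negbTE->] /negbTE->]. Qed.

Lemma sum3_set (M : nmodType) (F : V -> M) x y z : x != y -> y != z -> x != z ->
  (forall v, v \notin [set x; y; z] -> F v = 0) -> \sum_v F v = F x + F y + F z.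
Proof.
move=> xy yz xz h; apply: sum3_supp => // v vx vy vz; apply: h.
by rewrite !inE !negb_or vx vy vz.
Qed.

Lemma wsum3 f x y z w : x != y -> y != z -> x != z ->
  (forall v, v \notin [set x; y; z] -> w v = 0) ->
  wsum f w = w x *: f x + w y *: f y + w z *: f z.
Proof.
by move=> xy yz xz h; rewrite /wsum (sum3_set xy yz xz) // => v /h->; rewrite scale0r.
Qed.

Lemma wsum_weight3 f x y z a b c : x != y -> y != z -> x != z ->
  wsum f (weight3 x y z a b c) = a *: f x + b *: f y + c *: f z.
Proof.
move=> xy yz xz; rewrite (wsum3 _ xy yz xz); last exact: weight3_out.
by have [-> -> ->] := weight3E a b c xy yz xz.
Qed.

Lemma bary_weight3 x y z a b c : x != y -> y != z -> x != z ->
  0 <= a -> 0 <= b -> 0 <= c -> a + b + c = 1 -> bary [set x; y; z] (weight3 x y z a b c).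
Proof.
move=> xy yz xz a0 b0 c0 h; split.
- by move=> v; rewrite /weight3; do 3!case: ifP => // _.
- exact: weight3_out.
rewrite (sum3_set xy yz xz); last exact: weight3_out.
by have [-> -> ->] := weight3E a b c xy yz xz.
Qed.

Lemma area_wsum f w (P Q : pt) : \sum_v w v = 1 ->
  area P Q (wsum f w) = \sum_v w v * area P Q (f v).
Proof.
move=> h; have E x : area P Q x = (Q 0 0 - P 0 0) * x 0 1 - (Q 0 1 - P 0 1) * x 0 0
    + (\sum_v w v) * (- (Q 0 0 - P 0 0) * P 0 1 + (Q 0 1 - P 0 1) * P 0 0).
  by rewrite h /area; ring.
rewrite E /wsum !summxE !mulr_sumr mulr_suml -sumrB -big_split /=.
by apply: eq_bigr => v _; rewrite !mxE /area; ring.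
Qed.

End Weights.

(** * Simplicial complexes in the plane *)

Section Complex.
Variables (R : realFieldType) (V : finType).
Local Notation pt := 'rV[R]_2.
Variables (pos : V -> pt) (simp : pred {set V}).
Hypothesis simp_sub : forall s t : {set V}, simp s -> t \subset s -> t != set0 -> simp t.
(** A single injectivity statement expresses both that simplices are affinely independent and that
    they meet in common faces. *)
Hypothesis bary_inj : forall s t w w', simp s -> simp t -> bary s w -> bary t w' ->
  wsum pos w = wsum pos w' -> forall v, w v = w' v.

(** The positive and negative parts of a dependency, divided by their common sum, are two systems of
    weights for the same point. *)
Lemma affine_indep s (c : V -> R) : simp s -> (forall v, v \notin s -> c v = 0) ->
  \sum_v c v = 0 -> \sum_v c v *: pos v = 0 -> forall v, c v = 0.
Proof.
move=> ss supp c0 cp.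
pose P v := Num.max (c v) 0; pose N v := Num.max (- c v) 0.
have PN v : c v = P v - N v.
  have [h|h] : c v <= 0 \/ 0 <= c v by case: (lerP (c v) 0) => [|/ltW]; [left|right].
    by rewrite /P /N max_r // max_l ?oppr_ge0 // sub0r opprK.
  by rewrite /P /N max_l // max_r ?oppr_le0 // subr0.
have P0 v : 0 <= P v by rewrite le_max lexx orbT.
have N0 v : 0 <= N v by rewrite le_max lexx orbT.
have SE : \sum_v P v = \sum_v N v.
  apply/eqP; rewrite -subr_eq0 -sumrB -[X in _ == X]c0; apply/eqP.
  by apply: eq_bigr => v _; rewrite PN.
have PE : \sum_v P v *: pos v = \sum_v N v *: pos v.
  apply/eqP; rewrite -subr_eq0 -sumrB -[X in _ == X]cp; apply/eqP.
  by apply: eq_bigr => v _; rewrite [in RHS]PN scalerBl.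
set S := \sum_v P v in SE.
have [S0|S0] := eqVneq S 0.
  have Pz v : P v = 0 by apply/eqP; move/eqP: S0; rewrite psumr_eq0 // => /allP/(_ v (mem_index_enum _)).
  have Nz v : N v = 0.
    by apply/eqP; move/eqP: S0; rewrite SE psumr_eq0 // => /allP/(_ v (mem_index_enum _)).
  by move=> v; rewrite PN Pz Nz subrr.
have Sp : 0 < S by rewrite lt_def S0 sumr_ge0.
have bar (Q : V -> R) : (forall v, 0 <= Q v) -> \sum_v Q v = S -> (forall v, v \notin s -> Q v = 0) ->
    bary s (fun v => Q v / S).
  move=> Q0 QS Qs; split.
  - by move=> v; rewrite divr_ge0 // ltW.
  - by move=> v /Qs->; rewrite mul0r.
  - by rewrite -mulr_suml QS divff.
have bP : bary s (fun v => P v / S).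
  by apply: bar => // v /supp h; rewrite /P h maxxx.
have bN : bary s (fun v => N v / S).
  by apply: bar => // v /supp h; rewrite /N h oppr0 maxxx.
have E : wsum pos (fun v => P v / S) = wsum pos (fun v => N v / S).
  rewrite /wsum; under eq_bigr do rewrite mulrC -scalerA.
  under [RHS]eq_bigr do rewrite mulrC -scalerA.
  by rewrite -!scaler_sumr PE.
move=> v; have := bary_inj ss ss bP bN E v => /(divIf S0) h.
by rewrite PN h subrr.
Qed.

(** If the area vanishes, the differences of the [i]-th coordinates are coefficients of an affine
    dependency, so [x] and [y] agree in every coordinate. *)
Lemma simp_area x y z : x != y -> y != z -> x != z -> simp [set x; y; z] ->
  area (pos x) (pos y) (pos z) != 0.
Proof.
move=> xy yz xz ss; apply/eqP=> h0.
have K (i : 'I_2) : pos x 0 i = pos y 0 i.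
  pose c := weight3 x y z (pos y 0 i - pos z 0 i) (pos z 0 i - pos x 0 i) (pos x 0 i - pos y 0 i).
  have [c1 c2 c3] := weight3E (pos y 0 i - pos z 0 i) (pos z 0 i - pos x 0 i) (pos x 0 i - pos y 0 i) xy yz xz.
  have : c z = 0.
    apply: (affine_indep ss).
    - by move=> v; apply: weight3_out.
    - by rewrite /c (sum3_set xy yz xz) ?c1 ?c2 ?c3; [ring|exact: weight3_out].
    rewrite -/(wsum pos c) /c wsum_weight3 //.
    have iE : i = 0 \/ i = 1.
      by case: (unliftP 0 i) => [j ->|->]; [right|left]; rewrite // (ord1 j); apply/val_inj.
    move: h0; rewrite /area => h0.
    by case: iE => ->; apply: ptP; rewrite !mxE; lra.
  by rewrite /c c3 => /eqP; rewrite subr_eq0 => /eqP.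
have pxy : pos x = pos y by apply: ptP.
have sx : simp [set x].
  by apply: simp_sub ss _ _; rewrite ?sub1set ?inE ?eqxx // -card_gt0 cards1.
have sy : simp [set y].
  by apply: simp_sub ss _ _; rewrite ?sub1set ?inE ?eqxx ?orbT // -card_gt0 cards1.
have b (u : V) : bary [set u] (fun v => (v == u)%:R : R).
  split; first by move=> v; rewrite ler0n.
    by move=> v; rewrite inE => /negbTE->.
  by rewrite (sum1_supp (x := u)) ?eqxx // => v /negbTE->.
have E u : wsum pos (fun v => (v == u)%:R) = pos u.
  by rewrite /wsum (sum1_supp (x := u)) ?eqxx ?scale1r // => v /negbTE->; rewrite scale0r.
have := bary_inj sx sy (b x) (b y); rewrite !E => /(_ pxy x).
by rewrite eqxx (negbTE xy) => /eqP; rewrite oner_eq0.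
Qed.

(** Four points of the plane are affinely dependent, by Cramer's rule with areas as coefficients;
    the one at [w] is a nonzero area. *)
Lemma simp_card s : simp s -> (#|s| <= 3)%N.
Proof.
move=> ss; rewrite leqNgt; apply/negP=> c4.
have [e [Ue se es]] : exists e : seq V, [/\ uniq e, size e = 4 & {subset e <= s}].
  exists (take 4 (enum s)); split.
  - by rewrite take_uniq // enum_uniq.
  - by rewrite size_takel // -cardE.
  - by move=> x /mem_take; rewrite mem_enum.
case: e Ue se es => [|x [|y [|z [|w [|]]]]] // U _ es.
have [xs ys zs ws] : [/\ x \in s, y \in s, z \in s & w \in s].
  by split; apply: es; rewrite !inE eqxx ?orbT.
have [xy xz xw] : [/\ x != y, x != z & x != w].
  by move: U; rewrite /= !inE !negb_or => /andP[/and3P[]].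
have [yz yw zw] : [/\ y != z, y != w & z != w].
  by move: U; rewrite /= !inE !negb_or => /and4P[_ /andP[-> ->] -> _].
have sx : simp [set x; y; z].
  apply: simp_sub ss _ _; first by apply/subsetP=> v; rewrite !inE => /orP[/orP[]|] /eqP->.
  by apply/set0Pn; exists x; rewrite !inE eqxx.
have n0 := simp_area xy yz xz sx.
pose D := area (pos x) (pos y) (pos z).
pose a := area (pos y) (pos z) (pos w); pose b := area (pos z) (pos x) (pos w).
pose c := area (pos x) (pos y) (pos w).
pose k v := if v == w then - D else weight3 x y z a b c v.
have [c1 c2 c3] := weight3E a b c xy yz xz.
have [kx ky kz kw] : [/\ k x = a, k y = b, k z = c & k w = - D].
  by rewrite /k eqxx (negbTE xw) (negbTE yw) (negbTE zw).
have out v : v \notin [:: x; y; z; w] -> k v = 0.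
  rewrite !inE !negb_or /k => /and4P[vx vy vz /negbTE->].
  by rewrite weight3_out // !inE !negb_or vx vy vz.
have : k w = 0.
  apply: (affine_indep ss).
  - move=> v vs; apply: out; apply: contra vs => /es //.
  - by rewrite (sum4_supp U) // kx ky kz kw /a /b /c /D /area; ring.
  rewrite (sum4_supp U) => [|v /out->]; last by rewrite scale0r.
  by rewrite kx ky kz kw /a /b /c /D /area; apply: ptP; rewrite !mxE; ring.
by rewrite kw => /eqP; rewrite oppr_eq0 /D (negbTE n0).
Qed.

Definition triangles : {set {set V}} := [set t | simp t & #|t| == 3].

Let T := triangles.

Lemma trianglesP t : t \in T -> exists x y z,
  [/\ t = [set x; y; z], x != y, y != z & x != z].
Proof.
rewrite inE => /andP[_ /eqP t3].
have : (0 < #|t|)%N by rewrite t3.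
case/card_gt0P=> x xt; have t2 : #|t :\ x| = 2.
  by move: t3; rewrite (cardsD1 x) xt add1n => -[].
move/eqP/cards2P: t2 => [y [z [yz e]]]; exists x, y, z.
have [yx zx] : y != x /\ z != x.
  have : y \in t :\ x by rewrite e !inE eqxx.
  have : z \in t :\ x by rewrite e !inE eqxx orbT.
  by rewrite !inE => /andP[-> _] /andP[-> _].
split=> //; try by rewrite eq_sym.
by rewrite -(setD1K xt) e setUA.
Qed.

Let T3 t : t \in T -> #|t| = 3.
Proof. by rewrite inE => /andP[_ /eqP]. Qed.

Let Ts t : t \in T -> simp t.
Proof. by rewrite inE => /andP[]. Qed.

Lemma triangle_third t u v : t \in T -> te t u v ->
  exists w, [/\ t = [set u; v; w], v != w & u != w].
Proof.
move=> tT /and3P[uv ut vt]; have t3 := T3 tT.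
have : (0 < #|t :\ u :\ v|)%N.
  move: t3; rewrite (cardsD1 u) ut (cardsD1 v) !inE eq_sym uv vt /= !add1n => -[->] //.
case/card_gt0P=> w; rewrite !inE => /and3P[wv wu wt].
have [vw uw] : v != w /\ u != w by split; rewrite eq_sym.
by exists w; split=> //; apply: card3_eq.
Qed.

Lemma bary_coord x y z (q : pt) : area (pos x) (pos y) (pos z) != 0 ->
  exists a b c, a + b + c = 1 /\ q = a *: pos x + b *: pos y + c *: pos z.
Proof.
move=> n0; set D := area (pos x) (pos y) (pos z) in n0.
exists (area (pos y) (pos z) q / D), (area (pos z) (pos x) q / D), (area (pos x) (pos y) q / D).
split; first by rewrite -!mulrDl area_sum divff.
have K (r k : R) : D * (r / D * k) = r * k by field.
by apply: ptP; rewrite !mxE; apply: (mulfI n0); rewrite !mulrDr !K /D /area; ring.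
Qed.

(** Two triangles on the same side of a common edge overlap: a point slightly off the middle of [uv]
    towards [w'] lies in both, but only one of its systems of weights charges [w']. *)
Let same_side u v w w' : [set u; v; w] \in T -> [set u; v; w'] \in T -> u != v ->
  v != w -> u != w -> v != w' -> u != w' -> w != w' ->
  0 < area (pos u) (pos v) (pos w) * area (pos u) (pos v) (pos w') -> False.
Proof.
move=> t1 t2 uv vw uw vw' uw' ww' sg.
have n1 := simp_area uv vw uw (Ts t1).
have [a [b [c [h e]]]] := bary_coord (pos w') n1.
have cp : 0 < c.
  move: sg; rewrite e area_conv3 // area_pqp area_pqq !mulr0 !add0r => sg.
  rewrite -(pmulr_lgt0 c (_ : 0 < area (pos u) (pos v) (pos w) ^+ 2)); first by rewrite expr2 mulrA [c * _]mulrC; rewrite mulrCA mulrA in sg *; lra.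
  by rewrite lt_def sqr_ge0 andbT expf_neq0.
pose M := `|a| + `|b|; have M0 : 0 <= M by rewrite addr_ge0.
(* Chosen so that [(1 - d) / 2 = d * M], which outweighs negative values of [d * a] and [d * b]. *)
pose d := (1 + 2 * M)^-1.
have d0 : 0 < d by rewrite invr_gt0; lra.
have dM : d * (1 + 2 * M) = 1 by rewrite mulVf //; apply: lt0r_neq0; lra.
have dE : (1 - d) / 2 = d * M by lra.
have nrm (r : R) : - `|r| <= r by rewrite lerNl -normrN ler_norm.
have [na nb] := (nrm a, nrm b).
have da : 0 <= (1 - d) / 2 + d * a.
  rewrite dE -mulrDr mulr_ge0 ?(ltW d0) // /M; have := normr_ge0 b; lra.
have db : 0 <= (1 - d) / 2 + d * b.
  rewrite dE -mulrDr mulr_ge0 ?(ltW d0) // /M; have := normr_ge0 a; lra.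
have d1 : 0 <= (1 - d) / 2 by rewrite dE mulr_ge0 // ltW.
have b1 : bary [set u; v; w] (weight3 u v w ((1 - d) / 2 + d * a) ((1 - d) / 2 + d * b) (d * c)).
  apply: bary_weight3 => //; first by rewrite mulr_ge0 // ltW.
  have -> : a = 1 - b - c by lra.
  by field.
have b2 : bary [set u; v; w'] (weight3 u v w' ((1 - d) / 2) ((1 - d) / 2) d).
  by apply: bary_weight3 => //; [exact: ltW|field].
have := bary_inj (Ts t1) (Ts t2) b1 b2; rewrite !wsum_weight3 // e => K.
have : weight3 u v w' ((1 - d) / 2) ((1 - d) / 2) d w' = 0.
  rewrite -K; first by rewrite weight3_out // !inE !negb_or ![w' == _]eq_sym uw' vw' ww'.
  by apply: ptP; rewrite !mxE; ring.
have [_ _ ->] := weight3E ((1 - d) / 2) ((1 - d) / 2) d uv vw' uw'.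
by move=> d00; rewrite d00 ltxx in d0.
Qed.

(** Of three triangles on an edge, two are on the same side. *)
Lemma edge_triangles_le2 u v : (#|[set t in T | te t u v]| <= 2)%N.
Proof.
rewrite leqNgt; apply/negP=> /card_gt2P[t1 [t2 [t3 [[]]]]].
move=> /setIdP[h1 e1] /setIdP[h2 e2] /setIdP[h3 e3] [n12 n23 n31].
have uv : u != v by case/and3P: e1.
have [w1 [E1 vw1 uw1]] := triangle_third h1 e1.
have [w2 [E2 vw2 uw2]] := triangle_third h2 e2.
have [w3 [E3 vw3 uw3]] := triangle_third h3 e3.
have w12 : w1 != w2 by apply: contra_neq n12 => e; rewrite E1 E2 e.
have w23 : w2 != w3 by apply: contra_neq n23 => e; rewrite E2 E3 e.
have w31 : w3 != w1 by apply: contra_neq n31 => e; rewrite E3 E1 e.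
subst t1 t2 t3.
have N x : [set u; v; x] \in T -> v != x -> u != x -> area (pos u) (pos v) (pos x) != 0.
  by move=> h vx ux; apply: simp_area => //; apply: Ts.
have S12 := same_side h1 h2 uv vw1 uw1 vw2 uw2 w12.
have S23 := same_side h2 h3 uv vw2 uw2 vw3 uw3 w23.
have S31 := same_side h3 h1 uv vw3 uw3 vw1 uw1 w31.
have := N _ h1 vw1 uw1; have := N _ h2 vw2 uw2; have := N _ h3 vw3 uw3.
rewrite !neq_lt => /orP[g3|g3] /orP[g2|g2] /orP[g1|g1]; first [
  by apply: S12; first [exact: mulr_gt0|rewrite nmulr_rgt0]|
  by apply: S23; first [exact: mulr_gt0|rewrite nmulr_rgt0]|
  by apply: S31; first [exact: mulr_gt0|rewrite nmulr_rgt0]].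
Qed.

Definition centroid (t : {set V}) : pt := wsum pos (fun v => (3%:R)^-1 * (v \in t)%:R).

Let third_gt0 : 0 < (3%:R)^-1 :> R.
Proof. by rewrite invr_gt0 ltr0n. Qed.

Let bary_cen t : t \in T -> bary t (fun v => (3%:R)^-1 * (v \in t)%:R : R).
Proof.
move=> tT; split.
- by move=> v; rewrite mulr_ge0 ?ler0n // ltW.
- by move=> v /negbTE->; rewrite mulr0.
rewrite -mulr_sumr -natr_sum -big_mkcond /= sum1_card T3 // mulVf //.
by rewrite pnatr_eq0.
Qed.

(** The centroid of [t'] has positive weight at each vertex of [t'], so it lies in no other
    triangle. *)
Let par_cen t t' : t \in T -> t' \in T -> crossings pos (te t) (centroid t') = (t == t').
Proof.
move=> tT t'T; have [x [y [z [et xy yz xz]]]] := trianglesP tT.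
have n0 := simp_area xy yz xz; rewrite -et in n0; have {}n0 := n0 (Ts tT).
rewrite et par_te //; have [<-|tt] := eqVneq.
  have -> : centroid [set x; y; z] = (3%:R)^-1 *: pos x + (3%:R)^-1 *: pos y + (3%:R)^-1 *: pos z.
    rewrite /centroid (wsum3 _ xy yz xz); last by move=> v /negbTE->; rewrite mulr0.
    by rewrite !inE !eqxx !orbT !mulr1.
  have h : (3%:R)^-1 + (3%:R)^-1 + (3%:R)^-1 = 1 :> R by field.
  by case: (cross_bary n0 h) => + _; apply.
have [a [b [c [h e]]]] := bary_coord (centroid t') n0; rewrite e.
case: (cross_bary n0 h) => _; apply; apply/negP=> /and3P[a0 b0 c0].
have bw := bary_weight3 xy yz xz a0 b0 c0 h.
rewrite -et in bw.
have K := bary_inj (Ts tT) (Ts t'T) bw (bary_cen t'T).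
rewrite wsum_weight3 // in K; have {}K := K (esym e).
have [v vt' vt] : exists2 v, v \in t' & v \notin t.
  apply/subsetPn; apply: contra tt => s; rewrite -et eq_sym eqEcard s !T3 //.
have := K v; rewrite weight3_out -?et // vt' mulr1 => h3.
by have := third_gt0; rewrite -h3 ltxx.
Qed.

(** Both centroids can be moved to the midpoint of the common edge [ab] without meeting [z]: every
    point on the way has positive weights at [a] and [b], so an edge through it must be [ab]. *)
Let par_cross t t' a b (z : V -> V -> bool) : t \in T -> t' \in T -> t != t' ->
  te t a b -> te t' a b -> (forall u v, z u v = z v u) ->
  (forall u v, z u v -> edge T u v) -> evenrel z -> ~~ z a b ->
  crossings pos z (centroid t) = crossings pos z (centroid t').
Proof.
move=> tT t'T tt' ab ab' zs zT ze nz.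
have zi u : z u u = false by apply/negP=> /zT/andP[/eqP].
pose m := 2^-1 *: pos a + 2^-1 *: pos b.
suff K s : s \in T -> te s a b -> crossings pos z (centroid s) = crossings pos z m by rewrite !K.
move=> sT sab; have [w [es bw aw]] := triangle_third sT sab.
have abn : a != b by case/andP: sab.
apply: par_move => // u v zuv k l /andP[k0 k1] /andP[l0 l1] E.
have [t1 t1T /and3P[uv ut1 vt1]] := edgeP _ _ _ (zT _ _ zuv).
have [w1 [et1 vw1 uw1]] : exists w, [/\ t1 = [set u; v; w], v != w & u != w].
  by apply: triangle_third => //; apply/and3P.
have b1 : bary t1 (weight3 u v w1 (1 - k) k 0).
  by rewrite et1; apply: bary_weight3 => //; lra.
pose r := (1 - l) * (3%:R)^-1 : R.
have r0 : 0 <= r by rewrite mulr_ge0 // ?(ltW third_gt0) //; lra.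
have rh : 0 < r + l / 2.
  have [l00|ln] := eqVneq l 0; first by rewrite /r l00; have := third_gt0; lra.
  have lp : 0 < l by rewrite lt_def ln.
  by lra.
have b2 : bary s (weight3 a b w (r + l / 2) (r + l / 2) r).
  rewrite es; apply: bary_weight3 => //; try exact: ltW.
  by rewrite /r; field.
have := bary_inj (Ts t1T) (Ts sT) b1 b2; rewrite !wsum_weight3 // => K.
have {}K : forall x, weight3 u v w1 (1 - k) k 0 x = weight3 a b w (r + l / 2) (r + l / 2) r x.
  apply: K.
  have -> : (1 - k) *: pos u + k *: pos v + 0 *: pos w1 = pos u + k *: (pos v - pos u).
    by apply: ptP; rewrite !mxE; ring.
  rewrite E /centroid (wsum3 _ abn bw aw); last by move=> x; rewrite -es => /negbTE->; rewrite mulr0.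
  rewrite es !inE !eqxx !orbT !mulr1 /m /r.
  by apply: ptP; rewrite !mxE; field.
have mem x : x \in [set a; b] -> x = u \/ x = v.
  move=> xab; have [xu|xu] := eqVneq x u; first by left.
  have [xv|xv] := eqVneq x v; first by right.
  have [ea eb _] := weight3E (r + l / 2) (r + l / 2) r abn bw aw.
  have : weight3 a b w (r + l / 2) (r + l / 2) r x = r + l / 2.
    by move: xab; rewrite !inE => /orP[] /eqP->.
  rewrite -K /weight3 (negbTE xu) (negbTE xv) if_same => h.
  by rewrite -h ltxx in rh.
case: (mem a); rewrite ?inE ?eqxx // => ea; case: (mem b); rewrite ?inE ?eqxx ?orbT // => eb.
- by move: abn; rewrite ea eb eqxx.
- by move: nz; rewrite ea eb zuv.
- by move: nz; rewrite ea eb zs zuv.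
by move: abn; rewrite ea eb eqxx.
Qed.

(** An inclusion of the boundary in [c] is enough: a nonempty [T] has nonzero boundary, and a
    nonzero cycle inside [c] is [c]. *)
Theorem disk_of_complex (c : seq V) : uniq c -> (2 < size c)%N -> T != set0 ->
  (forall u v, bdT T u v -> ce c u v) -> disk T c.
Proof.
move=> Uc sz T0 h.
have H2 := bdT_inj par_cen.
have E u v : bdT T u v = ce c u v.
  case: (even_subcycle Uc (@bdT_sym _ T) (bdT_even T3) h) => [h0|->//].
  by move: T0; rewrite (H2 T (subxx _) h0) eqxx.
split=> //; first exact: edge_triangles_le2.
move=> z zs zT ze; exact: (bdT_onto T3 edge_triangles_le2 par_cen par_cross Uc E zs zT ze).
Qed.

(** Within one triangle the weights are ratios of areas. For two triangles, the areas relative to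
    the separating line sum to zero on both sides and so vanish term by term: only vertices on the
    line carry weight, at the two distinct points [pa] and [pb], which determines the weights. *)
Theorem solves_injective c p f s t w w' : solves T c p f -> s \in T -> t \in T ->
  bary s w -> bary t w' -> wsum f w = wsum f w' -> wsum pos w = wsum pos w'.
Proof.
move=> F sT tT [w0 ws w1] [w0' wt w1'] E.
have [st|st] := eqVneq s t.
  subst t; have [x [y [z [es n0]]]] := s_tri F sT.
  suff K v : w v = w' v by rewrite /wsum; apply: eq_bigr => v _; rewrite K.
  have [xy yz xz] : [/\ x != y, y != z & x != z].
    split; apply: contraNneq n0 => ->; by rewrite ?area_pp ?area_pqq ?area_pqp.
  have [vs|vs] := boolP (v \in s); last by rewrite ws // wt.
  have L (u : V -> R) : (forall v, v \notin s -> u v = 0) -> \sum_v u v = 1 ->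
      [/\ area (f y) (f z) (wsum f u) = u x * area (f x) (f y) (f z),
          area (f z) (f x) (wsum f u) = u y * area (f x) (f y) (f z) &
          area (f x) (f y) (wsum f u) = u z * area (f x) (f y) (f z)].
    rewrite es => us u1; rewrite (wsum3 _ xy yz xz us); apply: area_bary_coord.
    by rewrite -(sum3_set xy yz xz us).
  have [a1 b1 c1] := L w ws w1; have [a2 b2 c2] := L w' wt w1'.
  rewrite -E a1 in a2; rewrite -E b1 in b2; rewrite -E c1 in c2.
  by move: vs; rewrite es !inE => /orP[/orP[]|] /eqP->; apply: (mulIf n0).
have [P [Q [a [b [pa [pb [pab hs ht]]]]]]] := s_sep F sT tT st.
have e1 := area_wsum f P Q w1; have e2 := area_wsum f P Q w1'.
have g1 v : 0 <= w v * area P Q (f v).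
  have [vs|/ws->] := boolP (v \in s); last by rewrite mul0r.
  by rewrite mulr_ge0 //; case: (hs v vs).
have g2 v : 0 <= - (w' v * area P Q (f v)).
  rewrite -mulrN; have [vt|/wt->] := boolP (v \in t); last by rewrite mul0r.
  by rewrite mulr_ge0 // oppr_ge0; case: (ht v vt).
have s1 : 0 <= \sum_v w v * area P Q (f v) by apply: sumr_ge0.
have s2 : 0 <= \sum_v - (w' v * area P Q (f v)) by apply: sumr_ge0.
have z1 : \sum_v w v * area P Q (f v) = 0.
  by move: s2; rewrite sumrN -e2 -E e1; lra.
have z2 : \sum_v - (w' v * area P Q (f v)) = 0 by rewrite sumrN -e2 -E e1 z1 oppr0.
have k1 v : w v * area P Q (f v) = 0.
  by apply/eqP; move/eqP: z1; rewrite psumr_eq0 // => /allP/(_ v (mem_index_enum _)).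
have k2 v : w' v * area P Q (f v) = 0.
  by apply/eqP; move/eqP: z2; rewrite psumr_eq0 // => /allP/(_ v (mem_index_enum _)); rewrite oppr_eq0.
have on1 v : w v != 0 -> (v = a /\ f v = pa) \/ (v = b /\ f v = pb).
  move=> n; have vs : v \in s by apply: contraNT n => /ws->.
  case: (hs v vs) => _; apply; apply/eqP; move/eqP: (k1 v).
  by rewrite mulf_eq0 (negbTE n).
have on2 v : w' v != 0 -> (v = a /\ f v = pa) \/ (v = b /\ f v = pb).
  move=> n; have vt : v \in t by apply: contraNT n => /wt->.
  case: (ht v vt) => _; apply; apply/eqP; move/eqP: (k2 v).
  by rewrite mulf_eq0 (negbTE n).
have two (u : V -> R) : (forall v, u v != 0 -> (v = a /\ f v = pa) \/ (v = b /\ f v = pb)) ->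
    \sum_v u v = 1 -> (a != b -> u a + u b = 1 /\ wsum f u = u a *: pa + u b *: pb) /\
      (a = b -> u a = 1) /\ (forall v, v != a -> v != b -> u v = 0).
  move=> on u1; have out v : v != a -> v != b -> u v = 0.
    move=> va vb; apply/eqP/negPn/negP=> /on[[ev _]|[ev _]]; first by rewrite ev eqxx in va.
    by rewrite ev eqxx in vb.
  split; last split=> //.
    move=> ab; split; first by rewrite -u1 (sum2_supp ab).
    rewrite /wsum (sum2_supp ab); last by move=> v va vb; rewrite out // scale0r.
    have sc v q : (u v != 0 -> f v = q) -> u v *: f v = u v *: q.
      by have [->|n] := eqVneq (u v) 0; [rewrite !scale0r|move=> ->].
    by congr (_ + _); apply: sc => /on[[h1 h2]|[h1 h2]] //; rewrite h1 eqxx in ab.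
  by move=> eab; rewrite -u1 (sum1_supp (x := a)) // => v va; apply: out; rewrite -?eab.
have [h1 [h2 h3]] := two w on1 w1; have [h1' [h2' h3']] := two w' on2 w1'.
suff K v : w v = w' v by rewrite /wsum; apply: eq_bigr => v _; rewrite K.
have [ab|ab] := eqVneq a b.
  have [->|va] := eqVneq v a; first by rewrite h2 ?h2'.
  by rewrite h3 ?h3' // -ab.
have [p1 q1] := h1 ab; have [p2 q2] := h1' ab.
have wa : w a = w' a.
  have : (w a - w' a) *: (pa - pb) = 0.
    have -> : (w a - w' a) *: (pa - pb) = wsum f w - wsum f w'.
      rewrite q1 q2; have -> : w b = 1 - w a by lra.
      have -> : w' b = 1 - w' a by lra.
      by apply: ptP; rewrite !mxE; ring.
    by rewrite E subrr.
  move/eqP; rewrite scaler_eq0 subr_eq0 (subr_eq0 pa) (negbTE pab) orbF => /eqP //.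
have [->//|va] := eqVneq v a; have [->|vb] := eqVneq v b; first by lra.
by rewrite h3 ?h3'.
Qed.

End Complex.

(** * Weights on vertices and edges *)

Section SmallWeights.
Variables (R : realFieldType) (V : finType).
Implicit Types (x u v : V) (k : R) (p : V -> 'rV[R]_2).

Definition weight1 x v : R := (v == x)%:R.

Lemma bary_weight1 x : bary [set x] (weight1 x).
Proof.
split; first by move=> v; rewrite ler0n.
  by move=> v; rewrite in_set1 /weight1 => /negbTE->.
by rewrite (sum1_supp (x := x)) /weight1 ?eqxx // => v /negbTE->.
Qed.

Lemma wsum_weight1 p x : wsum p (weight1 x) = p x.
Proof.
rewrite /wsum (sum1_supp (x := x)) /weight1 ?eqxx ?scale1r // => v /negbTE->; exact: scale0r.
Qed.

Definition weight2 u v k x : R := if x == u then 1 - k else if x == v then k else 0.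

Lemma weight2E u v k : u != v -> weight2 u v k u = 1 - k /\ weight2 u v k v = k.
Proof. by move=> uv; rewrite /weight2 !eqxx [v == u]eq_sym (negbTE uv). Qed.

Lemma weight2_out u v k x : x != u -> x != v -> weight2 u v k x = 0.
Proof. by rewrite /weight2 => /negbTE-> /negbTE->. Qed.

Lemma bary_weight2 u v k : u != v -> 0 <= k <= 1 -> bary [set u; v] (weight2 u v k).
Proof.
move=> uv /andP[k0 k1]; split.
- by move=> x; rewrite /weight2; case: ifP => _; [lra|case: ifP].
- by move=> x; rewrite !inE negb_or => /andP[]; exact: weight2_out.
rewrite (sum2_supp uv); last exact: weight2_out.
by have [-> ->] := weight2E k uv; rewrite subrK.
Qed.

Lemma wsum_weight2 p u v k : u != v -> wsum p (weight2 u v k) = p u + k *: (p v - p u).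
Proof.
move=> uv; rewrite /wsum (sum2_supp uv) => [|x xu xv]; last by rewrite weight2_out ?scale0r.
by have [-> ->] := weight2E k uv; apply: ptP; rewrite !mxE; ring.
Qed.

Lemma bary2_wsum p u v w : u != v -> bary [set u; v] w ->
  0 <= w v <= 1 /\ wsum p w = p u + w v *: (p v - p u).
Proof.
move=> uv [w0 ws w1]; have out x : x != u -> x != v -> w x = 0.
  by move=> xu xv; apply: ws; rewrite !inE negb_or xu.
have h : w u + w v = 1 by rewrite -w1 (sum2_supp uv).
have [h1 h2] := (w0 u, w0 v).
split; first by apply/andP; lra.
rewrite /wsum (sum2_supp uv) => [|x xu xv]; last by rewrite out ?scale0r.
have -> : w u = 1 - w v by lra.
by apply: ptP; rewrite !mxE; ring.
Qed.

Lemma bary_mono (s t : {set V}) (w : V -> R) : s \subset t -> bary s w -> bary t w.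
Proof.
move=> /subsetP st [w0 ws w1]; split=> // v vt; apply: ws; apply: contra vt; exact: st.
Qed.

Lemma bary_meet (s t : {set V}) (w w' : V -> R) : bary s w -> bary t w' -> w =1 w' ->
  bary (s :&: t) w.
Proof.
move=> [w0 ws w1] [_ wt _] e; split=> // v; rewrite inE negb_and => /orP[/ws//|/wt].
by rewrite e.
Qed.

Lemma bary_pos (s : {set V}) (w : V -> R) : bary s w -> exists2 v, v \in s & 0 < w v.
Proof.
move=> [w0 ws w1]; have [v wv|h] := pickP (fun v => 0 < w v).
  by exists v => //; apply: contraTT wv => /ws->; rewrite ltxx.
suff : \sum_v w v = 0 by rewrite w1 => /eqP; rewrite oner_eq0.
by apply: big1 => v _; apply/le_anti; rewrite w0 leNgt h.
Qed.

Lemma wsum_sub1 p z (s : {set V}) w : bary s w -> s \subset [set z] -> wsum p w = p z.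
Proof.
move=> bw sz; have [_ ws w1] := bary_mono sz bw.
rewrite /wsum (sum1_supp (x := z)); last by move=> v vz; rewrite ws ?scale0r // in_set1.
rewrite -[RHS]scale1r -w1 (sum1_supp (x := z)) // => v vz.
by rewrite ws // in_set1.
Qed.

Lemma wsum_proper_edge p u v (s : {set V}) w : bary s w -> s \proper [set u; v] ->
  wsum p w = p u \/ wsum p w = p v.
Proof.
move=> bw; rewrite properE => /andP[s1 s2].
have [us|us] := boolP (u \in s); last first.
  right; apply: (wsum_sub1 p bw); apply/subsetP => a sa.
  by have := subsetP s1 a sa; rewrite !inE => /orP[/eqP e|//]; rewrite -e sa in us.
left; apply: (wsum_sub1 p bw); apply/subsetP => a sa.
have := subsetP s1 a sa; rewrite !inE => /orP[//|/eqP e]; case/negP: s2.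
by apply/subsetP => b; rewrite !inE => /orP[] /eqP->; rewrite // -e.
Qed.

End SmallWeights.

From mathcomp Require Import all_classical all_reals all_analysis.
Import numFieldNormedType.Exports.
Local Open Scope classical_set_scope.
Local Open Scope ring_scope.

(** * Disks in the plane *)

Section PlaneTopology.
Variable R : realType.
Local Notation plane := 'rV[R]_2.
Implicit Types (x y p q n : plane) (A : set plane).

Lemma area_continuous p q : continuous (area p q).
Proof.
move=> x; have c i : (fun y : plane => y 0 i) @ x --> x 0 i.
  exact: (@coord_continuous R 1 2 0 i x).
have d i : (fun y : plane => y 0 i - p 0 i) @ x --> x 0 i - p 0 i.
  exact: cvgB (c i) (cvg_cst _).
exact: cvgB (cvgM (cvg_cst _) (d 1)) (cvgM (cvg_cst _) (d 0)).
Qed.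

Lemma line_continuous x n : continuous (fun k : R => x + k *: n).
Proof.
by move=> k; apply: cvgD; [exact: cvg_cst|apply: cvgZr_tmp; exact: cvg_id].
Qed.

Lemma nbhs_dir x n A : nbhs x A -> exists2 e : R, 0 < e & forall k, `|k| <= e -> A (x + k *: n).
Proof.
move=> xA; have : nbhs (0 : R) [set k | A (x + k *: n)].
  by apply: line_continuous; rewrite scale0r addr0.
move/nbhs_ballP=> [e /= e0 eA]; exists (e / 2); first by rewrite divr_gt0.
move=> k ke; apply: eA; rewrite -ball_normE /= sub0r normrN.
by apply: le_lt_trans ke _; lra.
Qed.

Lemma closed_area_ge0 p q : closed [set x | 0 <= area p q x].
Proof.
have := (continuous_closedP (area p q)).1 (@area_continuous p q) [set r | 0 <= r].
by apply; exact: closed_ge.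
Qed.

Lemma closed_area_le0 p q : closed [set x | area p q x <= 0].
Proof.
have := (continuous_closedP (area p q)).1 (@area_continuous p q) [set r | r <= 0].
by apply; exact: closed_le.
Qed.

Lemma nbhs_area_gt0 p q x : 0 < area p q x -> nbhs x [set y | 0 < area p q y].
Proof.
move=> h; apply: open_nbhs_nbhs; split=> //.
have := (continuousP (area p q)).1 (@area_continuous p q) [set r | 0 < r].
by apply; exact: open_gt.
Qed.

End PlaneTopology.

(** * Two points do not separate a disk *)

Section DiskTopology.
Variable R : realType.
Local Notation plane := 'rV[R]_2.
Implicit Types (x y p q m : plane).

Lemma unit_diskE x : unit_disk x = (x 0 0 ^+ 2 + x 0 1 ^+ 2 <= 1) :> Prop.
Proof.
rewrite /unit_disk /= !big_ord_recl big_ord0 addr0.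
by have -> : lift 0 0 = 1 :> 'I_2 by apply/val_inj.
Qed.

Lemma unit_disk_segment x y (k : R) : unit_disk x -> unit_disk y -> 0 <= k <= 1 ->
  unit_disk (x + k *: (y - x)).
Proof.
rewrite !unit_diskE !mxE => hx hy /andP[k0 k1].
have h0 : 0 <= k * (1 - k) * ((x 0 0 - y 0 0) ^+ 2 + (x 0 1 - y 0 1) ^+ 2).
  apply: mulr_ge0; last by rewrite addr_ge0 ?sqr_ge0.
  by rewrite mulr_ge0 //; lra.
have h1 : 0 <= k * (1 - (y 0 0 ^+ 2 + y 0 1 ^+ 2)) by rewrite mulr_ge0 //; lra.
have h2 : 0 <= (1 - k) * (1 - (x 0 0 ^+ 2 + x 0 1 ^+ 2)) by rewrite mulr_ge0 //; lra.
lra.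
Qed.

(** Its roots are the parameters at which the parabola [(s, s^2)] meets the line [xp]. *)
Let pline x p : {poly R} :=
  (p 0 0 - x 0 0) *: ('X^2 - (x 0 1)%:P) - (p 0 1 - x 0 1) *: ('X - (x 0 0)%:P).

Let pline_neq0 x p : x != p -> pline x p != 0.
Proof.
move=> xp; apply/eqP=> h.
have h2 := congr1 (fun r : {poly R} => r`_2) h; have h1 := congr1 (fun r : {poly R} => r`_1) h.
move: h1 h2; rewrite /pline !coefE /= => h1 h2; case/eqP: xp; apply: ptP; lra.
Qed.

Let pline_size x p : (size (pline x p) <= 3)%N.
Proof.
apply: leq_trans (size_polyD _ _) _; rewrite geq_max size_polyN; apply/andP; split.
  apply: leq_trans (size_scale_leq _ _) _.
  apply: leq_trans (size_polyD _ _) _; rewrite geq_max size_polyXn size_polyN.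
  by apply: leq_trans (size_polyC_leq1 _) _.
apply: leq_trans (size_scale_leq _ _) _; by rewrite size_XsubC.
Qed.

Let parab (s : R) : plane := \row_(i < 2) (if i == 0 then s else s ^+ 2).

Let area_parab x p s : area x p (parab s) = (pline x p).[s].
Proof. rewrite /area /pline !hornerE /= !mxE /=; ring. Qed.

(* The four lines through x or y and p or q meet a parabola in at most 8 points. *)
Lemma detour x y p q : x != p -> x != q -> y != p -> y != q ->
  exists m, unit_disk m /\ forall k : R, [/\ x + k *: (m - x) <> p, x + k *: (m - x) <> q,
    y + k *: (m - y) <> p & y + k *: (m - y) <> q].
Proof.
move=> xp xq yp yq.
pose P := pline x p * pline x q * (pline y p * pline y q).
have P0 : P != 0 by rewrite !mulf_neq0 ?pline_neq0.
have sP : (size P <= 9)%N.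
  have mul3 (f g : {poly R}) a b : (size f <= a.+1)%N -> (size g <= b.+1)%N -> (size (f * g)%R <= (a + b).+1)%N.
    move=> ha hb; apply: leq_trans (size_polyMleq _ _) _.
    by rewrite -subn1 leq_subLR add1n -addSn -addnS; apply: leq_add.
  by apply: (mul3 _ _ 4 4); apply: (mul3 _ _ 2 2); apply: pline_size.
(* [P] has degree at most 8, so one of nine parameters is not a root; the denominator keeps them
   below 1/2 and the points inside the unit disk. *)
pose s := [seq (i%:R / 20%:R : R) | i <- iota 0 9].
have us : uniq s.
  rewrite map_inj_in_uniq ?iota_uniq // => i j _ _ /(divIf _) h.
  by apply/eqP; rewrite -(eqr_nat R); apply/eqP; apply: h; rewrite pnatr_eq0.
have [r rs nr] : exists2 r, r \in s & ~~ root P r.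
  apply/hasP; rewrite -[has _ _]negbK -all_predC.
  apply/negP=> al; have : all (root P) s by apply: sub_all al => r /=; rewrite negbK.
  by move=> al'; have := max_poly_roots P0 al' us; rewrite size_map size_iota ltnNge sP.
move: nr; rewrite /root /P !hornerM !mulf_eq0 !negb_or -!area_parab.
move=> /andP[/andP[n1 n2] /andP[n3 n4]].
exists (parab r); split.
  have [r0 r1] : 0 <= r /\ r <= 1 / 2.
    case/mapP: rs => i; rewrite mem_iota /= add0n => i9 ->.
    split; first by rewrite divr_ge0 ?ler0n.
    rewrite ler_pdivrMr ?ltr0n //; have : i%:R <= 9%:R :> R by rewrite ler_nat ltnW.
    by lra.
  rewrite unit_diskE !mxE /=.
  have h : r ^+ 2 <= 1 / 4 by rewrite expr2; nra.
  have h0 := sqr_ge0 r.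
  have : (r ^+ 2) ^+ 2 <= 1 / 4 by rewrite [_ ^+ 2 ^+ 2]expr2; nra.
  lra.
move=> k; have K u v : area u v (parab r) != 0 -> u + k *: (parab r - u) <> v.
  move=> n e; move: n; rewrite -e /area !mxE /=; move/eqP; apply; ring.
by split; apply: K.
Qed.

(** In [C] the set [U] is closed, and open as the complement of [W]. *)
Lemma connected_in (T : topologicalType) (C U W : set T) : connected C -> closed U -> closed W ->
  C `<=` U `|` W -> (forall z, C z -> U z -> W z -> False) ->
  (C `&` U) !=set0 -> C `<=` U.
Proof.
move=> cC cU cW sub dis ne; suff : C `&` U = C by move=> <- z [].
apply: cC => //; last by exists U.
exists (~` W); first exact: closed_openC.
rewrite eqEsubset; split=> z [Cz h]; split=> //; first by move=> /(dis z Cz h).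
by case: (sub z Cz).
Qed.

(** In the unit disk the images of [x] and [y] are joined by two segments through a point [m] from
    [detour] that avoid the images of [p] and [q]. Pulled back to [X], each segment lies in [U] by
    connectedness, and so does [y]. *)
Lemma disk_no_cut (X U W : set plane) p q x y : is_disk X -> closed U -> closed W ->
  X `<=` U `|` W -> (forall z, X z -> U z -> W z -> z = p \/ z = q) ->
  X p -> X q -> X x -> U x -> x <> p -> x <> q -> X y -> W y -> y <> p -> y <> q -> False.
Proof.
move=> [h [k [[hX kB] ch ck kh hk]]] cU cW sub dis Xp Xq Xx Ux xp xq Xy Wy yp yq.
have hinj a b : X a -> X b -> a <> b -> h a != h b.
  by move=> Xa Xb ab; apply/eqP=> e; apply: ab; rewrite -(kh a Xa) -(kh b Xb) e.
have [m [Bm av]] := detour (hinj _ _ Xx Xp xp) (hinj _ _ Xx Xq xq)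
  (hinj _ _ Xy Xp yp) (hinj _ _ Xy Xq yq).
pose seg (a : plane) : set plane := (fun t : R => a + t *: (m - a)) @` `[0, 1].
have segB a : unit_disk a -> seg a `<=` @unit_disk R.
  move=> Ba z [t /=]; rewrite in_itv /= => t01 <-; exact: unit_disk_segment.
have cseg a : unit_disk a -> connected (k @` seg a).
  move=> Ba; apply: connected_continuous_connected; last first.
    exact: continuous_subspaceW (segB a Ba) ck.
  apply: connected_continuous_connected; first exact: segment_connected.
  exact/continuous_subspaceT/line_continuous.
have segX a : unit_disk a -> k @` seg a `<=` X.
  by move=> Ba z [u /(segB a Ba) Bu <-]; apply: kB.
have seg0 a : unit_disk a -> (k @` seg a) (k a).
  move=> Ba; exists a => //; exists 0; rewrite ?scale0r ?addr0 //=.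
  by rewrite in_itv /= lexx ler01.
have seg1 a : unit_disk a -> (k @` seg a) (k m).
  move=> Ba; exists m => //; exists 1; rewrite ?scale1r ?[a + _]addrC ?subrK //=.
  by rewrite in_itv /= lexx ler01.
have [Bx By] := (hX _ Xx, hX _ Xy).
have avoid a : unit_disk a -> (forall t : R, a + t *: (m - a) <> h p /\ a + t *: (m - a) <> h q) ->
    forall z, (k @` seg a) z -> U z -> W z -> False.
  move=> Ba nab z Cz Uz Wz; have Xz := segX a Ba z Cz.
  case: Cz => u su kuz; have hz : h z = u by rewrite -kuz hk //; apply: segB su.
  case: su => t _ ut; case: (nab t) => n1 n2.
  by case: (dis z Xz Uz Wz) => e; [apply: n1|apply: n2]; rewrite ut -hz e.
have C1 : k @` seg (h x) `<=` U.
  apply: (connected_in (cseg _ Bx) cU cW).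
  - by move=> z /(segX _ Bx); apply: sub.
  - by apply: avoid => // t; case: (av t).
  - by exists x; split=> //; rewrite -{2}(kh x Xx); apply: seg0.
have C2 : k @` seg (h y) `<=` U.
  apply: (connected_in (cseg _ By) cU cW).
  - by move=> z /(segX _ By); apply: sub.
  - by apply: avoid => // t; case: (av t).
  - by exists (k m); split; [exact: seg1|apply: C1; apply: seg1].
have Uy : U y by apply: C2; rewrite -{2}(kh y Xy); apply: seg0.
by case: (dis y Xy Uy Wy).
Qed.

End DiskTopology.

(** * The complex of a triangulation *)

Section ImageHull.
Variables (R : realType) (V : finType).
Local Notation plane := 'rV[R]_2.
Implicit Types (phi : V -> plane) (s : {set V}) (w : V -> R).

Lemma sum_imfset (M : nmodType) phi s (F : plane -> M) : {in s &, injective phi} ->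
  \sum_(v <- [fset phi x | x in s]%fset) F v = \sum_(x in s) F (phi x).
Proof. by move=> h; rewrite big_imfset //= big_enum. Qed.

Lemma hull_imfsetP phi s q : {in s &, injective phi} ->
  hull [fset phi x | x in s]%fset q <-> exists2 w, bary s w & q = wsum phi w.
Proof.
move=> inj; split=> [[w [w0 w1 ->]]|[w [w0 ws w1] ->]].
  exists (fun x => if x \in s then w (phi x) else 0); first split.
  - by move=> x; case: ifP => // xs; apply: w0; apply/imfsetP; exists x.
  - by move=> x /negbTE->.
  - by rewrite -w1 sum_imfset // [RHS]big_mkcond.
  rewrite sum_imfset // /wsum big_mkcond; apply: eq_bigr => x _.
  by case: ifP; rewrite ?scale0r.
(* Weights must be given on points of the plane; injectivity leaves a single term at each point of
   the simplex. *)
pose W q := \sum_(x in s | phi x == q) w x.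
have WE x : x \in s -> W (phi x) = w x.
  move=> xs; rewrite /W (big_pred1 x) // => y /=.
  apply/andP/eqP => [[ys /eqP/inj]|->]; last by rewrite eqxx.
  by apply.
exists W; split.
- by move=> v /imfsetP[x /= xs ->]; rewrite WE.
- rewrite sum_imfset // (eq_bigr _ WE) -w1 [RHS](bigID (mem s)) /=.
  by rewrite [X in _ = _ + X]big1 ?addr0 // => x /ws.
rewrite sum_imfset // /wsum (bigID (mem s)) /= [X in _ + X]big1 ?addr0 => [|x /ws->].
  by apply: eq_bigr => x xs; rewrite WE.
by rewrite scale0r.
Qed.

End ImageHull.

Section ComplexOfTriangulation.
Variables (R : realType).
Local Notation plane := 'rV[R]_2.
Variable K : {fset {fset plane}}.
Hypothesis TK : triangulation K.

Definition vertices : {fset plane} := (\bigcup_(s <- K) s)%fset.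
Local Notation V := (vertices : finType).

Definition vpos (x : V) : plane := val x.

Definition simplex_of (s : {set V}) : {fset plane} := [fset vpos x | x in s]%fset.

Definition verts_of (s : {fset plane}) : {set V} := [set x : V | vpos x \in s]%SET.

Definition simp (s : {set V}) : bool := simplex_of s \in K.

Lemma vpos_inj : injective vpos. Proof. exact: val_inj. Qed.

Lemma mem_simplex_of s x : (vpos x \in simplex_of s) = (x \in s).
Proof.
apply/imfsetP/idP => [[y /= ys /vpos_inj->] //|xs]; by exists x.
Qed.

Lemma verts_ofK s : s \in K -> simplex_of (verts_of s) = s.
Proof.
move=> sK; apply/fsetP => q; apply/imfsetP/idP => [[x /=]|qs].
  by rewrite inE => xs ->.
have qV : q \in vertices by apply/bigfcupP; exists s; rewrite ?sK.
by exists [` qV]%fset; rewrite ?inE.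
Qed.

Lemma simp_verts s : s \in K -> simp (verts_of s).
Proof. by move=> sK; rewrite /simp verts_ofK. Qed.

Lemma hullP s q : hull (simplex_of s) q <-> exists2 w, bary s w & q = wsum vpos w.
Proof. by apply: hull_imfsetP => x y _ _; apply: vpos_inj. Qed.

Lemma simplex_ofI s t : (simplex_of s `&` simplex_of t)%fset = simplex_of (s :&: t)%SET.
Proof.
apply/fsetP => q; apply/fsetIP/imfsetP => /=.
  move=> [/imfsetP[x /= xs ->]]; rewrite mem_simplex_of => xt.
  by exists x; rewrite // inE xs.
by move=> [x]; rewrite inE => /andP[xs xt] ->; rewrite !mem_simplex_of.
Qed.

Lemma simplex_indep s (c : V -> R) : simp s -> (forall v, v \notin s -> c v = 0) ->
  \sum_v c v = 0 -> wsum vpos c = 0 -> forall v, c v = 0.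
Proof.
move=> ss supp c0 cp v; have [vs|/supp//] := boolP (v \in s).
have [_ ai] := let: And3 h _ _ := TK in h _ ss.
pose C q := if insub q is Some x then c x else 0.
have CE x : C (vpos x) = c x by rewrite /C valK.
have inj : {in s &, injective vpos} by move=> x y _ _; apply: vpos_inj.
rewrite -CE; apply: ai; last by rewrite mem_simplex_of.
  rewrite sum_imfset // -[RHS]c0 [RHS](bigID (mem s)) /= [X in _ = _ + X]big1 ?addr0.
    by apply: eq_bigr => x _; rewrite CE.
  by move=> x /supp.
rewrite sum_imfset // -[RHS]cp /wsum [RHS](bigID (mem s)) /= [X in _ = _ + X]big1 ?addr0.
  by apply: eq_bigr => x _; rewrite CE.
by move=> x /supp->; rewrite scale0r.
Qed.

(** The common point has weights on the common face; affine independence in each of the two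
    simplices identifies them with both given systems. *)
Lemma simp_bary_inj s t w w' : simp s -> simp t -> bary s w -> bary t w' ->
  wsum vpos w = wsum vpos w' -> forall v, w v = w' v.
Proof.
move=> ss st bw bw' E; have [_ _ I] := TK.
have : (hull (simplex_of s) `&` hull (simplex_of t)) (wsum vpos w).
  by split; apply/hullP; [exists w|exists w'].
rewrite I // simplex_ofI => /hullP[w'' [h0 hI h1] E''].
have K2 (u : V -> R) r : simp r -> bary r u -> (s :&: t)%SET \subset r ->
    wsum vpos u = wsum vpos w'' -> forall v, u v = w'' v.
  move=> sr [u0 ur u1] sub Eu v; apply/eqP; rewrite -subr_eq0; apply/eqP.
  apply: (simplex_indep (c := fun v => u v - w'' v) sr) => [x xr||].
  - by rewrite ur // hI ?subrr //; apply: contra xr; apply: (fintype.subsetP sub).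
  - by rewrite sumrB u1 h1 subrr.
  rewrite /wsum; under eq_bigr do rewrite scalerBl.
  by rewrite sumrB -/(wsum vpos u) -/(wsum vpos w'') Eu subrr.
move=> v; rewrite (K2 w s ss bw) ?finset.subsetIl //.
by rewrite (K2 w' t st bw') ?finset.subsetIr // -E.
Qed.

Lemma simp_subset (s t : {set V}) : simp s -> t \subset s -> t != finset.set0 -> simp t.
Proof.
move=> ss ts t0; have [_ cl _] := TK; apply: cl ss _ _.
  by apply/fsubsetP=> q /imfsetP[x /= /(fintype.subsetP ts) xs ->]; rewrite mem_simplex_of.
case/finset.set0Pn: t0 => x xt e; have : vpos x \in simplex_of t by rewrite mem_simplex_of.
by rewrite e inE.
Qed.

Lemma polyhedronP q : polyhedron K q <-> exists s w, [/\ simp s, bary s w & q = wsum vpos w].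
Proof.
split=> [[s sK hs]|[s [w [ss bw ->]]]].
  move: hs; rewrite -(verts_ofK sK) => /hullP[w bw ->].
  by exists (verts_of s), w; split=> //; apply: simp_verts.
by exists (simplex_of s) => //; apply/hullP; exists w.
Qed.

Lemma simp1 (x : V) : simp [set x]%SET.
Proof.
have /bigfcupP[s /andP[sK _] xs] : vpos x \in vertices by exact: fsvalP.
apply: (simp_subset (simp_verts sK)).
  by rewrite finset.sub1set inE.
by apply/finset.set0Pn; exists x; rewrite inE.
Qed.

End ComplexOfTriangulation.

(** * Convex disks *)

Section ConvexDisk.
Variable R : realType.
Local Notation plane := 'rV[R]_2.
Implicit Types (x y p q m o d : plane) (A D : set plane).

Lemma plane_hausdorff : hausdorff_space plane.
Proof. exact: norm_hausdorff. Qed.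

Lemma affine_continuous (M : 'M[R]_2) (b : plane) : continuous (fun q : plane => q *m M + b).
Proof.
have -> : (fun q : plane => q *m M + b) = (fun q : plane => q 0 0 *: row 0 M + q 0 1 *: row 1 M + b).
  apply/funext => q; apply/rowP => j; rewrite !mxE !big_ord_recl big_ord0 addr0.
  by have -> : lift 0 0 = 1 :> 'I_2 by apply/val_inj.
move=> q; have c i : (fun y : plane => y 0 i) @ q --> q 0 i.
  exact: (@coord_continuous R 1 2 0 i q).
have d i r : {for q, continuous (fun y : plane => y 0 i *: r : plane)}.
  by have := @continuousZr_tmp R (plane : normedModType R) (plane : topologicalType) (fun y : plane => y 0 i) r q (c i).
have e : {for q, continuous (fun y : plane => y 0 0 *: row 0 M + y 0 1 *: row 1 M)}.
  exact: (continuousD (d 0 _) (d 1 _)).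
by apply: (continuousD e); exact: cst_continuous.
Qed.

Lemma unit_disk_compact : compact (@unit_disk R).
Proof.
apply: bounded_closed_compact.
  exists 1; split; [exact: num_real|move=> M M1 x]; rewrite unit_diskE => h.
  have h0 := sqr_ge0 (x 0 0); have h1 := sqr_ge0 (x 0 1).
  have K (t : R) : t ^+ 2 <= 1 -> `|t| <= M.
    move=> t1; apply: le_trans (ltW M1).
    by rewrite -(ler_pXn2r (n := 2)) ?nnegrE // expr1n real_normK ?num_real.
  rewrite /Num.norm /= mx_normrE; apply/bigmax_leP; split=> /=; first by apply: le_trans (ltW M1).
  move=> [i j] _ /=; rewrite (ord1 i).
  have [->|->] : j = 0 \/ j = 1.
    by case: (unliftP 0 j) => [k ->|->]; [right|left]; rewrite // (ord1 k); apply/val_inj.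
  - by apply: K; lra.
  - by apply: K; lra.
have -> : @unit_disk R = [set x | x 0 0 ^+ 2 + x 0 1 ^+ 2 <= 1].
  by apply/seteqP; split=> x; rewrite unit_diskE.
have c i : continuous (fun y : plane => y 0 i) by exact: (@coord_continuous R 1 2 0 i).
have C : continuous (fun x : plane => x 0 0 ^+ 2 + x 0 1 ^+ 2).
  move=> x; under eq_fun do rewrite !expr2.
  exact: cvgD (cvgM (c 0 x) (c 0 x)) (cvgM (c 1 x) (c 1 x)).
have := (continuous_closedP _).1 C [set r | r <= 1].
by apply; exact: closed_le.
Qed.

Lemma disk_compact D : is_disk D -> compact D.
Proof.
move=> [h [k [[hD kB] ch ck kh hk]]].
have -> : D = k @` (@unit_disk R).
  apply/seteqP; split=> [x Dx|_ [u Bu <-]]; last exact: kB.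
  by exists (h x); [exact: hD|exact: kh].
exact: continuous_compact ck unit_disk_compact.
Qed.

Lemma disk_closed D : is_disk D -> closed D.
Proof. move=> /disk_compact; exact: compact_closed plane_hausdorff. Qed.

Variable D : set plane.
Hypotheses (diskD : is_disk D) (convD : convex_set D).

Lemma convexP x y (k : R) : D x -> D y -> 0 <= k <= 1 -> D (x + k *: (y - x)).
Proof.
move=> Dx Dy /andP[k0 k1].
have := convD (Itv01 k0 k1) (mem_set Dy) (mem_set Dx) => /set_mem.
by congr D; rewrite /conv /= /unstable.onem; apply: ptP; rewrite !mxE; ring.
Qed.

Lemma convex3 x y z (a b c : R) : D x -> D y -> D z -> 0 <= a -> 0 <= b -> 0 <= c ->
  a + b + c = 1 -> D (a *: x + b *: y + c *: z).
Proof.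
move=> Dx Dy Dz a0 b0 c0 h; have [c1|c1] := eqVneq c 1.
  have -> : a = 0 by lra.
  have -> : b = 0 by lra.
  by rewrite c1 !scale0r !add0r scale1r.
have ab : 0 < a + b by rewrite lt_def addr_ge0 // andbT; apply: contra_neq c1; lra.
have -> : a *: x + b *: y + c *: z =
    (x + (b / (a + b)) *: (y - x)) + c *: (z - (x + (b / (a + b)) *: (y - x))).
  have -> : c = 1 - (a + b) by lra.
  by apply: ptP; rewrite !mxE; field; apply: lt0r_neq0.
apply: convexP => //; last by apply/andP; split=> //; lra.
apply: convexP => //; rewrite divr_ge0 ?(ltW ab) //= ler_pdivrMr // mul1r; lra.
Qed.

(** [F] is the homothety with centre [y] that takes the given point to [o]. A point [q] near the
    former lies on the segment from [F q], which is in [D], to [y]. *)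
Lemma interior_cone o y (t : R) : D° o -> D y -> 0 <= t < 1 -> D° (o + t *: (y - o)).
Proof.
move=> oD Dy /andP[t0 t1].
pose F (q : plane) : plane := (1 - t)^-1 *: (q - t *: y).
have nz : 1 - t != 0 by apply: lt0r_neq0; lra.
have cF : continuous F.
  have -> : F = fun q : plane => q *m (1 - t)^-1%:M + - ((1 - t)^-1 * t) *: y.
    by apply/funext => q; rewrite mul_mx_scalar; apply: ptP; rewrite /F !mxE; ring.
  exact: affine_continuous.
have e : F (o + t *: (y - o)) = o.
  by rewrite /F; apply: ptP; rewrite !mxE; field.
have : nbhs (o + t *: (y - o)) (F @^-1` D) by apply: cF; rewrite e.
apply: filterS => q /= DF.
have -> : q = F q + t *: (y - F q).
  by rewrite /F; apply: ptP; rewrite !mxE; field.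
by apply: convexP; rewrite // t0 ltW.
Qed.

Lemma interior_triangle x y z q : D x -> D y -> D z ->
  0 < area x y q -> 0 < area y z q -> 0 < area z x q -> D° q.
Proof.
move=> Dx Dy Dz h1 h2 h3; apply: filterS3 (nbhs_area_gt0 h1) (nbhs_area_gt0 h2) (nbhs_area_gt0 h3).
move=> u /= k1 k2 k3; have A0 : 0 < area x y z by rewrite -(area_sum x y z u); lra.
have -> : u = (area y z u / area x y z) *: x + (area z x u / area x y z) *: y
    + (area x y u / area x y z) *: z.
  have := lt0r_neq0 A0; rewrite /area => n0.
  by apply: ptP; rewrite !mxE; field.
apply: convex3 => //; try by rewrite divr_ge0 // ltW.
by rewrite -!mulrDl area_sum divff // lt0r_neq0.
Qed.

Lemma interior_noncollinear x y z : D x -> D y -> D z -> area x y z != 0 -> exists o, D° o.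
Proof.
wlog A0 : x y / 0 < area x y z.
  move=> W Dx Dy Dz; rewrite neq_lt => /orP[n|p]; last by apply: (W x y); rewrite ?lt0r_neq0.
  by apply: (W y x); rewrite // areaC ?oppr_gt0 // oppr_eq0 lt_eqF.
move=> Dx Dy Dz _.
pose r := (3%:R)^-1 : R; have h : r + r + r = 1 by rewrite /r; field.
have r0 : 0 < r by rewrite invr_gt0 ltr0n.
exists (r *: x + r *: y + r *: z); apply: (interior_triangle Dx Dy Dz).
- by rewrite area_conv3 // area_pqp area_pqq !mulr0 !add0r mulr_gt0.
- by rewrite area_conv3 // area_pqp area_pqq !mulr0 !addr0 -area_cyc mulr_gt0.
- by rewrite area_conv3 // area_pqp area_pqq !mulr0 addr0 add0r area_cyc mulr_gt0.
Qed.

(** The perpendicular to [xy] at [m] would meet [D] in [m] alone, so a single point would separate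
    the disk. *)
Lemma collinear_no_cut x y (l : R) : (forall q, D q -> area x y q = 0) -> D x -> D y -> x != y ->
  0 < l < 1 -> False.
Proof.
move=> col Dx Dy xy /andP[l0 l1].
pose m := x + l *: (y - x).
pose n : plane := \row_(i < 2) (if i == 0 then - (y 0 1 - x 0 1) else y 0 0 - x 0 0).
have AE q : area m (m + n) q = - ((y 0 0 - x 0 0) * (q 0 0 - m 0 0) + (y 0 1 - x 0 1) * (q 0 1 - m 0 1)).
  by rewrite /area !mxE /=; ring.
have N0 : 0 < (y 0 0 - x 0 0) ^+ 2 + (y 0 1 - x 0 1) ^+ 2.
  rewrite lt_def addr_ge0 ?sqr_ge0 // andbT paddr_eq0 ?sqr_ge0 // !sqrf_eq0 !subr_eq0.
  by apply: contra xy => /andP[/eqP h1 /eqP h2]; apply/eqP/ptP.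
have Ax : area m (m + n) x = l * ((y 0 0 - x 0 0) ^+ 2 + (y 0 1 - x 0 1) ^+ 2).
  by rewrite AE !mxE; ring.
have Ay : area m (m + n) y = (l - 1) * ((y 0 0 - x 0 0) ^+ 2 + (y 0 1 - x 0 1) ^+ 2).
  by rewrite AE !mxE; ring.
have Dm : D m by apply: convexP; rewrite // !ltW.
have px : 0 < area m (m + n) x by rewrite Ax mulr_gt0.
have py : area m (m + n) y < 0 by rewrite Ay nmulr_rlt0 //; lra.
apply: (@disk_no_cut R D [set q | 0 <= area m (m + n) q] [set q | area m (m + n) q <= 0]
  m m x y) => //=; try exact: ltW.
- exact: closed_area_ge0.
- exact: closed_area_le0.
- by move=> q _; case: (lerP 0 (area m (m + n) q)) => [|/ltW]; [left|right].
- move=> q Dq h1 h2; left; have h : area m (m + n) q = 0 by apply/le_anti; rewrite h1 h2.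
  have [k qk] := collinear_param xy (col q Dq).
  rewrite qk; rewrite qk AE !mxE in h.
  have : (k - l) * ((y 0 0 - x 0 0) ^+ 2 + (y 0 1 - x 0 1) ^+ 2) = 0 by lra.
  by move=> /eqP; rewrite mulf_eq0 (gt_eqF N0) orbF subr_eq0 => /eqP->.
- by move=> e; rewrite -{1}e area_pqp ltxx in px.
- by move=> e; rewrite -{1}e area_pqp ltxx in px.
- by move=> e; rewrite -{1}e area_pqp ltxx in py.
- by move=> e; rewrite -{1}e area_pqp ltxx in py.
Qed.

Lemma disk_three : exists x y z, [/\ D x, D y, D z & [/\ x != y, y != z & x != z]].
Proof.
have [h [k [[hD kB] ch ck kh hk]]] := diskD.
pose u (t : R) : plane := \row_(i < 2) (if i == 0 then t else 0).
have Bu t : t ^+ 2 <= 1 -> unit_disk (u t).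
  by move=> t1; rewrite unit_diskE !mxE /= expr0n addr0.
have ne t t' : t ^+ 2 <= 1 -> t' ^+ 2 <= 1 -> t != t' -> k (u t) != k (u t').
  move=> t1 t1' n; apply: contra_neq n => e.
  have := hk _ (Bu _ t1); rewrite e hk; last exact: Bu.
  by move/(congr1 (fun x : plane => x 0 0)); rewrite !mxE.
have h0 : (0 : R) ^+ 2 <= 1 by rewrite expr0n.
have h1 : (1 : R) ^+ 2 <= 1 by rewrite expr1n.
have h2 : (- 1 : R) ^+ 2 <= 1 by rewrite sqrrN expr1n.
exists (k (u 0)), (k (u 1)), (k (u (- 1))); split; try by apply: kB; apply: Bu.
by split; apply: ne => //; apply/eqP; lra.
Qed.

Lemma interior_exists : exists o, D° o.
Proof.
have [x [y [z [Dx Dy Dz [xy yz xz]]]]] := disk_three.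
have [col|/existsNP[q /not_implyP[Dq /eqP n0]]] := pselect (forall q, D q -> area x y q = 0); last first.
  exact: interior_noncollinear Dx Dy Dq n0.
by case: (collinear_no_cut (l := 1 / 2) col Dx Dy xy); lra.
Qed.

Lemma frontier_D q : frontier D q -> D q /\ ~ D° q.
Proof. by case=> cq nq; split=> //; have := disk_closed diskD; rewrite closure_id => ->. Qed.

(** The supremum of the parameters at which the ray is in [D], finite because [D] is bounded. *)
Lemma ray_frontier o d : D° o -> d != 0 -> exists2 l : R, 0 < l & frontier D (o + l *: d).
Proof.
move=> oD d0; have Do := interior_subset oD.
pose S := [set l : R | D (o + l *: d)].
have [M [_ /(_ (M + 1)) MB]] := compact_bounded (disk_compact diskD).
have {}MB q : D q -> `|q| <= M + 1 by move=> Dq; apply: MB => //; lra.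
have dp : 0 < `|d| by rewrite normr_gt0.
have ubS : ubound S ((M + 1 + `|o|) / `|d|).
  move=> l /= /MB h; rewrite ler_pdivlMr //.
  have : `|l *: d| <= M + 1 + `|o|.
    have -> : l *: d = (o + l *: d) - o by rewrite addrC addKr.
    by apply: le_trans (ler_normB _ _) _; rewrite lerD2r.
  by rewrite normrZ; have := ler_norm l; nra.
have hS : has_sup S by split; [exists 0; rewrite /S /= scale0r addr0|eexists; exact: ubS].
have [e e0 he] := nbhs_dir d oD.
have Se : S e by apply: he; rewrite ger0_norm // ltW.
have ge := sup_upper_bound hS Se.
exists (sup S); first by lra.
split.
  move=> B Bn; have [r r0 hr] := nbhs_dir d Bn.
  have [l Sl ll] := sup_adherent r0 hS.
  exists (o + l *: d); split=> //.
  have -> : o + l *: d = o + sup S *: d + (l - sup S) *: d by apply: ptP; rewrite !mxE; ring.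
  apply: hr; have := sup_upper_bound hS Sl => h.
  by rewrite ler_norml; apply/andP; split; lra.
move=> iD; have [r r0 hr] := nbhs_dir d iD.
have : S (sup S + r).
  rewrite /S /=; have -> : o + (sup S + r) *: d = o + sup S *: d + r *: d by apply: ptP; rewrite !mxE; ring.
  by apply: hr; rewrite ger0_norm // ltW.
by move/(sup_upper_bound hS); lra.
Qed.

End ConvexDisk.

(** * The frontier polygon of a convex disk *)

Section ConvexCircle.
Variables (R : realType) (V : finType) (p : V -> 'rV[R]_2) (sb : pred {set V}) (D : set 'rV[R]_2).
Local Notation plane := 'rV[R]_2.
Hypothesis sb_card : forall s, sb s -> (0 < #|s| <= 2)%N.
Hypothesis sb_sub : forall s t : {set V}, sb s -> t \subset s -> t != finset.set0 -> sb t.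
Hypothesis sb_inj : forall s t w w', sb s -> sb t -> bary s w -> bary t w' ->
  wsum p w = wsum p w' -> forall v, w v = w' v.
Hypotheses (diskD : is_disk D) (convD : convex_set D).
Hypothesis frontierP : forall q,
  frontier D q <-> exists s w, [/\ sb s, bary s w & q = wsum p w].

Let B : {set V} := [set x | sb [set x]%SET]%SET.
Let B_sb x : (x \in B) = sb [set x]%SET. Proof. by rewrite /B inE. Qed.

Let mem_sb s x : sb s -> x \in s -> x \in B.
Proof.
move=> ss xs; rewrite B_sb; apply: sb_sub ss _ _; first by rewrite finset.sub1set.
by apply/finset.set0Pn; exists x; rewrite finset.in_set1.
Qed.

Let sb_l u v : sb [set u; v]%SET -> u \in B.
Proof. by move/mem_sb; apply; rewrite !inE eqxx. Qed.

Let sb_r u v : sb [set u; v]%SET -> v \in B.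
Proof. by move/mem_sb; apply; rewrite !inE eqxx orbT. Qed.

Let pinj : {in B &, injective p}.
Proof.
move=> x y; rewrite !B_sb => xB yB e.
have := sb_inj xB yB (bary_weight1 R x) (bary_weight1 R y); rewrite !wsum_weight1 => /(_ e x).
by rewrite /weight1 eqxx; case: eqP => // _ /eqP; rewrite oner_eq0.
Qed.

Let p_neq x y : x \in B -> y \in B -> x != y -> p x != p y.
Proof. by move=> xB yB; apply: contra_neq; apply: pinj. Qed.

Let no_inside u v w (k : R) : sb [set u; v]%SET -> u != v -> w \in B -> 0 < k < 1 ->
  p w <> p u + k *: (p v - p u).
Proof.
move=> suv uv; rewrite B_sb => wB /andP[k0 k1] e.
have k01 : 0 <= k <= 1 by rewrite !ltW.
have := sb_inj suv wB (bary_weight2 uv k01) (bary_weight1 R w).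
rewrite wsum_weight1 wsum_weight2 // => /(_ (esym e) v).
rewrite /weight2 eq_sym (negbTE uv) eqxx /weight1.
by case: eqP => _ kE; move: k0 k1; rewrite kE ltxx.
Qed.

Let fr_edge u v (k : R) : sb [set u; v]%SET -> u != v -> 0 <= k <= 1 ->
  frontier D (p u + k *: (p v - p u)).
Proof.
move=> suv uv k01; apply/frontierP; exists [set u; v]%SET, (weight2 u v k).
by split=> //; [exact: bary_weight2|rewrite wsum_weight2].
Qed.

Let fr_vertex u : u \in B -> frontier D (p u).
Proof.
by rewrite B_sb => uB; apply/frontierP; exists [set u]%SET, (weight1 R u);
  split=> //; [exact: bary_weight1|rewrite wsum_weight1].
Qed.

Let frD q : frontier D q -> D q /\ ~ D° q. Proof. exact: frontier_D. Qed.

Let Dp u : u \in B -> D (p u). Proof. by move/fr_vertex/frD => []. Qed.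

Variable o : plane.
Hypothesis oD : D° o.

Let Do : D o. Proof. exact: interior_subset oD. Qed.

(** Of two frontier points on one ray from [o], the nearer one would be interior by
    [interior_cone]. *)
Let radial q q' (k : R) : frontier D q -> frontier D q' -> 0 < k -> q' = o + k *: (q - o) -> k = 1.
Proof.
move=> fq fq' k0 e; apply/eqP; have [k1|k1|//] := ltgtP k 1; exfalso.
  by case: (frD fq') => _; apply; rewrite e; apply: (interior_cone convD oD (frD fq).1); rewrite k1 ltW.
case: (frD fq) => _; apply; have -> : q = o + k^-1 *: (q' - o).
  by rewrite e; apply: ptP; rewrite !mxE; field; apply: lt0r_neq0.
apply: (interior_cone convD oD (frD fq').1); apply/andP; split; first by rewrite invr_ge0 ltW.
by rewrite invf_lt1.
Qed.

Let step u v := [&& sb [set u; v]%SET, u != v & 0 < area o (p u) (p v)].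

(** An edge on a line through [o] has its ends on one ray, against [radial], or contains [o], which
    is interior. *)
Let edge_area u v : sb [set u; v]%SET -> u != v -> area o (p u) (p v) != 0.
Proof.
move=> suv uv; apply/eqP=> h.
have [uB vB] := (sb_l suv, sb_r suv).
have [nu nv] := ((frD (fr_vertex uB)).2, (frD (fr_vertex vB)).2).
have ou : o != p u by apply/eqP=> e; apply: nu; rewrite -e.
have [k e] := collinear_param ou h.
have k1 : k != 1.
  by apply: contra_neq (p_neq uB vB uv) => k1; rewrite e k1 scale1r addrC subrK.
have [k0|k0] := ltrP 0 k.
  by move/eqP: k1; apply; apply: radial (fr_vertex uB) (fr_vertex vB) k0 e.
have n0 : 1 - k != 0 by apply: lt0r_neq0; lra.
have : frontier D (p u + (1 - k)^-1 *: (p v - p u)).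
  apply: fr_edge => //; apply/andP; split; [rewrite invr_ge0; lra|rewrite invf_le1; lra].
have -> : p u + (1 - k)^-1 *: (p v - p u) = o.
  by rewrite e; apply: ptP; rewrite !mxE; field.
by move/frD => [_]; apply.
Qed.

(** If [x] is right of the edge, the line from [x] through its midpoint [m] enters the triangle
    [o u v] at interior points of [D]; then [m] is interior too, although it is on the frontier. *)
Let step_supp u v x : step u v -> D x -> 0 <= area (p u) (p v) x.
Proof.
move=> /and3P[suv uv A0] Dx; rewrite leNgt; apply/negP=> xn.
pose m := p u + 2^-1 *: (p v - p u).
have fm : frontier D m by apply: fr_edge => //; apply/andP; lra.
have [uB vB] := (sb_l suv, sb_r suv).
have h1 : 0 < area (p v) o m.
  rewrite /m area_line area_pqp mulr0 addr0 (area_cyc (p v)) mulr_gt0 //; lra.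
have h2 : 0 < area o (p u) m.
  rewrite /m area_line area_pqq mulr0 add0r mulr_gt0 //; lra.
have N : nbhs m ([set y | 0 < area (p v) o y] `&` [set y | 0 < area o (p u) y]).
  by apply: filterI; apply: nbhs_area_gt0.
have [e e0 he] := nbhs_dir (m - x) N.
have [] /= := he e; first by rewrite ger0_norm // ltW.
set y := m + e *: (m - x) => y1 y2.
have y3 : 0 < area (p u) (p v) y.
  have -> : area (p u) (p v) y = - (e * area (p u) (p v) x).
    by rewrite /y /m /area !mxE; field.
  by rewrite oppr_gt0 nmulr_llt0.
have iy : D° y by apply: (interior_triangle convD (Dp uB) (Dp vB) Do).
case: (frD fm) => _; apply.
have -> : m = y + (e / (1 + e)) *: (x - y).
  by rewrite /y; apply: ptP; rewrite !mxE; field; apply: lt0r_neq0; lra.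
apply: (interior_cone convD iy Dx); apply/andP; split; [apply: divr_ge0; lra|rewrite ltr_pdivrMr; lra].
Qed.

Let edge_param u v v' k : u \in B -> sb [set u; v]%SET -> sb [set u; v']%SET -> u != v -> u != v' ->
  0 < k -> p v' = p u + k *: (p v - p u) -> v = v'.
Proof.
move=> uB s1 s2 uv uv' k0 e.
have [vB vB'] := (sb_r s1, sb_r s2).
have [k1|k1|k1] := ltrgtP k 1.
- by case: (no_inside s1 uv vB' (k := k)); rewrite ?k0.
- case: (no_inside s2 uv' vB (k := k^-1)).
    by rewrite invr_gt0 k0 invf_lt1.
  by rewrite e; apply: ptP; rewrite !mxE; field; apply: lt0r_neq0.
by apply: (pinj vB vB'); rewrite e k1 scale1r addrC subrK.
Qed.

(** By [step_supp] each of the two ends is weakly left of the other edge, so the edges are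
    collinear; having [o] on their left, they have the same direction. *)
Let step_fun u v v' : step u v -> step u v' -> v = v'.
Proof.
move=> st st'; have /and3P[s1 uv A1] := st; have /and3P[s2 uv' A2] := st'.
have [[uB vB] vB'] := (sb_l s1, sb_r s1, sb_r s2).
have := step_supp st (Dp vB'); have := step_supp st' (Dp vB); rewrite areaC23 => h1 h2.
have h : area (p u) (p v) (p v') = 0 by lra.
have [k e] := collinear_param (p_neq uB vB uv) h.
have k0 : 0 < k by move: A2; rewrite e area_line area_pqq mulr0 add0r pmulr_lgt0.
exact: edge_param uB s1 s2 uv uv' k0 e.
Qed.

Let step_inj u u' v : step u v -> step u' v -> u = u'.
Proof.
move=> st st'; have /and3P[s1 uv A1] := st; have /and3P[s2 uv' A2] := st'.
have [[uB vB] uB'] := (sb_l s1, sb_r s1, sb_l s2).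
have := step_supp st (Dp uB'); have := step_supp st' (Dp uB); rewrite areaC13 => h1 h2.
have h : area (p v) (p u) (p u') = 0 by rewrite areaC; lra.
rewrite eq_sym in uv; rewrite eq_sym in uv'; rewrite finset.setUC in s1; rewrite finset.setUC in s2.
have [k e] := collinear_param (p_neq vB uB uv) h.
have k0 : 0 < k.
  move: A2; rewrite e areaC23 area_line area_pqq mulr0 add0r -mulrN -areaC23.
  by rewrite pmulr_lgt0.
exact: edge_param vB s1 s2 uv uv' k0 e.
Qed.

(* A ray from o just to the left of the one through p a hits the edge leaving a. *)
Let step_ex a : a \in B -> exists v, step a v.
Proof.
move=> aB; have fa := fr_vertex aB.
have ao : p a != o by apply: contraPneq (frD fa).2 => e; apply; rewrite e.
pose Ar x := area o (p a) (p x).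
pose b x := (p a 0 0 - o 0 0) * (p x 0 0 - o 0 0) + (p a 0 1 - o 0 1) * (p x 0 1 - o 0 1).
pose S := \sum_x `|b x| / `|Ar x|.
have S0 : 0 <= S by apply: sumr_ge0 => x _; rewrite divr_ge0.
(* Turning the ray by so little passes no vertex: [e * b x < Ar x] whenever [Ar x] is positive. *)
pose e := (1 + S)^-1.
have e0 : 0 < e by rewrite invr_gt0; lra.
have eP x : 0 < Ar x -> e * b x < Ar x.
  move=> A0; have h : `|b x| / `|Ar x| <= S.
    by rewrite /S (bigD1 x) //= lerDl sumr_ge0 // => y _; rewrite divr_ge0.
  rewrite (gtr0_norm A0) ler_pdivrMr // in h.
  have h' := ler_norm (b x).
  rewrite mulrC ltr_pdivrMr; first nra; lra.
pose N := (p a 0 0 - o 0 0) ^+ 2 + (p a 0 1 - o 0 1) ^+ 2.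
have N0 : 0 < N.
  rewrite lt_def addr_ge0 ?sqr_ge0 // andbT paddr_eq0 ?sqr_ge0 // !sqrf_eq0 !subr_eq0.
  by apply: contra ao => /andP[/eqP h1 /eqP h2]; apply/eqP/ptP.
(* [p a - o] plus [e] times its rotation by a right angle. *)
pose d : plane := \row_(i < 2) (if i == 0 then (p a 0 0 - o 0 0) - e * (p a 0 1 - o 0 1)
  else (p a 0 1 - o 0 1) + e * (p a 0 0 - o 0 0)).
have dx x : area o (o + d) x = area o (p a) x - e * ((p a 0 0 - o 0 0) * (x 0 0 - o 0 0) + (p a 0 1 - o 0 1) * (x 0 1 - o 0 1)).
  by rewrite /area !mxE /=; ring.
have dN : area o (p a) (o + d) = e * N by rewrite /area !mxE /= /N; ring.
have d0 : d != 0.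
  apply/eqP=> h; move: dN; rewrite h addr0 area_pqp => /esym/eqP.
  by rewrite mulf_eq0 !gt_eqF.
have [l l0 fq] := ray_frontier diskD oD d0.
set q := o + l *: d in fq.
have q1 : area o (o + d) q = 0 by rewrite /q /area !mxE; ring.
have q2 : 0 < area o (p a) q.
  have -> : area o (p a) q = l * area o (p a) (o + d) by rewrite /q /area !mxE; ring.
  by rewrite dN !mulr_gt0.
have /frontierP[s [w [ss bw qE]]] := fq.
have [w0 ws w1] := bw.
have := sb_card ss; rewrite -(prednK (n := #|s|)); last by case/andP: (sb_card ss).
have c1 x : area o (o + d) (p x) = Ar x - e * b x by rewrite dx.
case E : #|s|.-1 => [|[|//]] _.
  have /eqP/cards1P[x sE] : #|s| = 1%N by move: (sb_card ss) E; case: #|s| => [|[]].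
  have qx : q = p x.
    rewrite qE /wsum (sum1_supp (x := x)).
      by rewrite -[RHS]scale1r -w1 (sum1_supp (x := x)) // => v vx; apply: ws; rewrite sE finset.in_set1.
    by move=> v vx; rewrite ws ?scale0r // sE finset.in_set1.
  by move: q2 q1; rewrite qx c1 => /eP; rewrite /Ar; lra.
have /eqP/cards2P[x [y [xy sE]]] : #|s| = 2%N by move: (sb_card ss) E; case: #|s| => [|[|[]]].
(* [q] is strictly left of the line from [o] to [p a], so an end of its edge with positive weight
   is; it is called [y]. *)
clear E; wlog Ay : x y xy sE / 0 < w y * Ar y.
  move=> W; have /(area_wsum p o (p a)) := w1; rewrite -qE (sum2_supp xy); last first.
    by move=> v vx vy; rewrite ws ?mul0r // sE !inE negb_or vx.
  move=> h; have [|h1] := ltrP 0 (w y * Ar y); first exact: (W x y xy sE).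
  apply: (W y x); [by rewrite eq_sym|by rewrite sE finset.setUC|].
  by move: q2 h1; rewrite h /Ar; lra.
have Ay' : 0 < Ar y.
  by rewrite ltNge; apply/negP=> h; move: Ay; rewrite ltNge mulr_ge0_le0.
have wy : 0 < w y by move: Ay; rewrite pmulr_lgt0.
have K (P Q : plane) : area P Q q = w x * area P Q (p x) + w y * area P Q (p y).
  rewrite qE area_wsum // (sum2_supp xy) // => v vx vy.
  by rewrite ws ?mul0r // sE !inE negb_or vx.
have cy : 0 < area o (o + d) (p y) by rewrite c1 subr_gt0 eP.
have cx : w x * area o (o + d) (p x) < 0.
  by have := K o (o + d); rewrite q1; have := mulr_gt0 wy cy; lra.
have cx' : area o (o + d) (p x) < 0.
  by rewrite ltNge; apply/negP=> h; move: cx; rewrite ltNge mulr_ge0.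
have Ax : Ar x <= 0.
  by rewrite leNgt; apply/negP=> /eP; move: cx'; rewrite c1; lra.
have xy0 : 0 < area o (p x) (p y).
  rewrite -(pmulr_rgt0 _ wy); have := K o (p x); rewrite area_pqq mulr0 add0r => <-.
  have -> : area o (p x) q = - (l * area o (o + d) (p x)) by rewrite /q /area !mxE; ring.
  by rewrite oppr_gt0 nmulr_llt0.
have sxy : step x y by apply/and3P; split=> //; rewrite -sE.
exists y; suff -> : a = x by [].
have xB : x \in B by apply: mem_sb ss _; rewrite sE !inE eqxx.
(* If [x] is on the line from [o] to [p a], it is on the same ray, hence equal to [a]. Otherwise the
   edge crosses that ray in its interior, at a frontier point, which is [p a]; but no vertex is
   inside an edge. *)
have [Ax0|Ax0] := eqVneq (Ar x) 0.
  have oa : o != p a by rewrite eq_sym.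
  have [k e1] := collinear_param oa Ax0.
  have k0 : 0 < k.
    have e2 : area o (p x) (p y) = k * Ar y by rewrite e1 /Ar /area !mxE; ring.
    by move: xy0; rewrite e2 pmulr_lgt0.
  apply: pinj => //; rewrite e1.
  by rewrite (radial fa (fr_vertex xB) k0 e1) scale1r addrC subrK.
have Axn : Ar x < 0 by rewrite lt_neqAle Ax0.
have AA : 0 < Ar y - Ar x by lra.
pose t := - Ar x / (Ar y - Ar x).
have t0 : 0 < t by apply: divr_gt0; lra.
have t1 : t < 1 by rewrite ltr_pdivrMr //; lra.
have sb2 : sb [set x; y]%SET by rewrite -sE.
have fr : frontier D (p x + t *: (p y - p x)) by apply: fr_edge => //; rewrite !ltW.
have tE : t * (Ar y - Ar x) = - Ar x by rewrite divfK // lt0r_neq0.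
have r0 : area o (p a) (p x + t *: (p y - p x)) = 0 by rewrite area_line; rewrite -/(Ar x) -/(Ar y); lra.
have oa : o != p a by rewrite eq_sym.
have [k e1] := collinear_param oa r0.
have xa0 : 0 < area o (p x) (p a) by rewrite areaC23 oppr_gt0.
have k0 : 0 < k.
  rewrite -(pmulr_lgt0 _ xa0).
  have -> : k * area o (p x) (p a) = area o (p x) (p x + t *: (p y - p x)).
    by rewrite e1 area_line area_pqp mulr0 add0r.
  by rewrite area_line area_pqq mulr0 add0r mulr_gt0.
have k1 := radial fa fr k0 e1.
by case: (no_inside sb2 xy aB (k := t)); rewrite ?t0 // e1 k1 scale1r addrC subrK.
Qed.

(** Otherwise the whole frontier is on one line; yet the two opposite rays from [o] normal to it
    both reach the frontier. *)
Let B_noncol x z : x \in B -> z \in B -> x != z ->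
  exists2 w, w \in B & area (p x) (p z) (p w) != 0.
Proof.
move=> xB zB xz.
have [[w wB n0]|al] := pselect (exists2 w, w \in B & area (p x) (p z) (p w) != 0); first by exists w.
have {}al w : w \in B -> area (p x) (p z) (p w) = 0.
  by move=> wB; apply/eqP; apply: contra_notT al => h; exists w.
have fz q : frontier D q -> area (p x) (p z) q = 0.
  move=> /frontierP[s [w [ss [w0 ws w1] ->]]]; rewrite area_wsum // big1 // => v _.
  by have [/(mem_sb ss)/al->|/ws->] := boolP (v \in s); rewrite ?mulr0 ?mul0r.
pose d : plane := \row_(i < 2) (if i == 0 then - (p z 0 1 - p x 0 1) else p z 0 0 - p x 0 0).
pose N := (p z 0 0 - p x 0 0) ^+ 2 + (p z 0 1 - p x 0 1) ^+ 2.
have dE l : area (p x) (p z) (o + l *: d) = area (p x) (p z) o + l * N.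
  by rewrite /area !mxE /= /N; ring.
have N0 : 0 < N.
  rewrite lt_def addr_ge0 ?sqr_ge0 // andbT paddr_eq0 ?sqr_ge0 // !sqrf_eq0 !subr_eq0.
  apply: contra (p_neq zB xB _) => [/andP[/eqP h1 /eqP h2]|]; last by rewrite eq_sym.
  by apply/eqP/ptP.
have d0 : d != 0.
  by apply/eqP=> h; have := dE 1; rewrite h scaler0 addr0; lra.
have [l l0 /fz] := ray_frontier diskD oD d0; rewrite dE => h1.
have nd0 : - d != 0 by rewrite oppr_eq0.
have [l' l0' /fz] := ray_frontier diskD oD nd0; rewrite scalerN -scaleNr dE => h2.
have := mulr_gt0 l0 N0; have := mulr_gt0 l0' N0; lra.
Qed.

(** The default [x] makes [nxt] injective on all of [V], as the theory of orbits requires. *)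
Let nxt x := if [pick v | step x v] is Some v then v else x.

Let nxtP x : x \in B -> step x (nxt x).
Proof.
by move=> /step_ex[v sv]; rewrite /nxt; case: pickP => // h; rewrite h in sv.
Qed.

Let nxt_out x : x \notin B -> nxt x = x.
Proof.
move=> xB; rewrite /nxt; case: pickP => // v /and3P[/sb_l]; by rewrite (negbTE xB).
Qed.

Let step_B u v : step u v -> u \in B /\ v \in B.
Proof. by move=> /and3P[s _ _]; rewrite (sb_l s) (sb_r s). Qed.

Let nxtB x : x \in B -> nxt x \in B.
Proof. by move=> /nxtP/step_B[]. Qed.

Let nxt_inj : injective nxt.
Proof.
move=> x y e; have [xB|xB] := boolP (x \in B); have [yB|yB] := boolP (y \in B).
- by apply: (@step_inj x y (nxt x)); [exact: nxtP|rewrite e; exact: nxtP].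
- by move: (nxtB xB); rewrite e nxt_out // (negbTE yB).
- by move: (nxtB yB); rewrite -e nxt_out // (negbTE xB).
by rewrite -(nxt_out xB) e nxt_out.
Qed.

Let edge_step u v : (u != v) && sb [set u; v]%SET = step u v || step v u.
Proof.
apply/andP/orP => [[uv s]|[/and3P[s uv _]|/and3P[s uv _]]]; last 2 first.
- by [].
- by rewrite eq_sym finset.setUC.
have := edge_area s uv; rewrite neq_lt => /orP[h|h]; [right|left]; apply/and3P; split=> //.
- by rewrite finset.setUC.
- by rewrite eq_sym.
- by rewrite areaC23 oppr_gt0.
Qed.

Let stepE u v : step u v = [&& u \in B, v \in B & v == nxt u].
Proof.
apply/idP/and3P => [s|[uB _ /eqP->]]; last exact: nxtP.
have [uB vB] := step_B s; split=> //; apply/eqP; exact: step_fun s (nxtP uB).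
Qed.

Let B_nonempty : exists a, a \in B.
Proof.
pose d : plane := const_mx 1.
have d0 : d != 0 by apply/eqP=> /(congr1 (fun x : plane => x 0 0)); rewrite !mxE => /eqP; rewrite oner_eq0.
have [l _ /frontierP[s [w [ss _ _]]]] := ray_frontier diskD oD d0.
have /andP[/card_gt0P[a a_s] _] := sb_card ss.
by exists a; apply: mem_sb a_s.
Qed.

Lemma cycle_around_interior : exists c : seq V,
  [/\ uniq c, (2 < size c)%N, weakly_convex p c & not_all_collinear p c] /\
  [/\ {in c &, injective p}, forall x, (x \in c) = sb [set x]%SET &
       forall u v, ce c u v = (u != v) && sb [set u; v]%SET].
Proof.
have [a aB] := B_nonempty.
have nn x : x \in B -> nxt x != x by move=> /nxtP/and3P[_]; rewrite eq_sym.
have supp x w : x \in B -> w \in B -> 0 <= area (p x) (p (nxt x)) (p w).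
  by move=> xB wB; apply: step_supp (Dp wB); apply: nxtP.
have nvi x w k : x \in B -> w \in B -> 0 < k < 1 -> p w <> p x + k *: (p (nxt x) - p x).
  by move=> xB wB k01; have /and3P[s n _] := nxtP xB; apply: no_inside.
have al := orbit_all nxtB nxt_inj pinj nn supp nvi B_noncol aB.
have sz := orbit_size nxtB nxt_inj pinj nn supp nvi B_noncol aB.
exists (orbit nxt a); split; split; [| exact: sz| | | | |].
- exact: orbit_uniq.
- move=> x y z s; exact: (orbit_WC nxtB nxt_inj pinj nn supp nvi B_noncol aB s).
- have [w wB n0] := B_noncol (nxtB aB) aB (nn _ aB).
  by exists (nxt a), a, w; rewrite !al nxtB.
- by move=> x y; rewrite !al; apply: pinj.
- by move=> x; rewrite al B_sb.
move=> u v; rewrite (orbit_ce nxtB nxt_inj pinj nn supp nvi B_noncol aB).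
by rewrite edge_step !stepE; case: (u \in B); case: (v \in B).
Qed.

End ConvexCircle.

Lemma convex_disk_cycle (R : realType) (V : finType) (p : V -> 'rV[R]_2) (sb : pred {set V})
    (D : set 'rV[R]_2) :
  (forall s, sb s -> (0 < #|s| <= 2)%N) ->
  (forall s t : {set V}, sb s -> t \subset s -> t != finset.set0 -> sb t) ->
  (forall s t w w', sb s -> sb t -> bary s w -> bary t w' ->
    wsum p w = wsum p w' -> forall v, w v = w' v) ->
  is_disk D -> convex_set D ->
  (forall q, frontier D q <-> exists s w, [/\ sb s, bary s w & q = wsum p w]) ->
  exists c : seq V,
  [/\ uniq c, (2 < size c)%N, weakly_convex p c & not_all_collinear p c] /\
  [/\ {in c &, injective p}, forall x, (x \in c) = sb [set x]%SET &
       forall u v, ce c u v = (u != v) && sb [set u; v]%SET].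
Proof.
move=> h1 h2 h3 h4 h5 h6; have [q qD] := interior_exists h4 h5.
by have := cycle_around_interior h1 h2 h3 h4 h5 h6 qD.
Qed.

(** * The simplices of a triangulated disk *)

Section HullCompact.
Variables (R : realType) (V : finType).
Local Notation plane := 'rV[R]_2.

(** A continuous image of the set of weights, which is closed and bounded in a finite-dimensional
    space. *)
Lemma bary_hull_compact (p : V -> plane) (s : {set V}) :
  compact [set q | exists2 w, bary s w & q = wsum p w].
Proof.
pose n := #|V|; pose W (u : 'rV[R]_n) (v : V) := u 0 (enum_rank v).
have cW v : continuous (fun u => W u v) by exact: coord_continuous.
pose C := [set u | bary s (W u)].
have -> : [set q | exists2 w, bary s w & q = wsum p w] = (fun u => wsum p (W u)) @` C.
  apply/seteqP; split=> [q [w bw ->]|q [u bu <-]]; last by exists (W u).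
  have E : W (\row_i w (enum_val i)) = w.
    by apply/funext => v; rewrite /W mxE enum_rankK.
  by exists (\row_i w (enum_val i)); rewrite /C /= E.
have sumC (U : normedModType R) (F : V -> 'rV[R]_n -> U) : (forall v, continuous (F v)) ->
    continuous (fun u => \sum_v F v u).
  by move=> cF; apply: continuous_big => //; exact: add_continuous.
apply: continuous_compact.
  apply: continuous_subspaceT; apply: sumC => v u.
  have := @continuousZr_tmp R (plane : normedModType R) ('rV[R]_n : topologicalType) (fun u => W u v) (p v) u (cW v u).
  by [].
apply: bounded_closed_compact.
  exists 1; split; [exact: num_real|move=> M M1 u [h0 hs h1]].
  rewrite /Num.norm /= mx_normrE; apply/bigmax_leP; split=> /=.
    exact: le_trans (ltW M1).
  move=> [i j] _ /=; rewrite (ord1 i) -(enum_valK j) -/(W u (enum_val j)).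
  rewrite ger0_norm //; apply: le_trans (ltW M1).
  by rewrite -h1 (bigD1 (enum_val j)) //= lerDl sumr_ge0.
have -> : C = (\bigcap_v [set u | 0 <= W u v]) `&` (\bigcap_(v in [set v | v \notin s]) [set u | W u v = 0])
    `&` [set u | \sum_v W u v = 1].
  apply/seteqP; split=> [u [h1 h2 h3]|u [[h1 h2] h3]].
    by split=> //; split=> [v _|v /= vs]; [exact: h1|exact: h2].
  by split=> [v|v vs|]; [exact: h1|exact: h2|exact: h3].
apply: closedI; first apply: closedI.
- apply: closed_bigI => v _; have := (continuous_closedP _).1 (cW v) [set r | 0 <= r].
  by apply; exact: closed_ge.
- apply: closed_bigI => v _; have := (continuous_closedP _).1 (cW v) [set r | r = 0].
  by apply; exact: closed_eq.
have := (continuous_closedP _).1 (sumC R^o (fun v u => W u v) cW) [set r | r = 1].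
by apply; exact: closed_eq.
Qed.
End HullCompact.

Section DiskComplex.
Variables (R : realType) (K : {fset {fset 'rV[R]_2}}).
Local Notation plane := 'rV[R]_2.
Local Notation V := (vertices K : finType).
Local Notation pos := (@vpos R K).
Implicit Types (s t : {set V}) (u v x : V) (q n : plane).
Hypotheses (TK : triangulation K) (diskK : is_disk (polyhedron K)).

Let inj := simp_bary_inj TK.
Let sub := simp_subset TK.

Lemma hull_closed s : closed (hull (simplex_of s)).
Proof.
have -> : hull (simplex_of s) = [set q | exists2 w, bary s w & q = wsum pos w].
  by apply/seteqP; split=> q /hullP.
apply: compact_closed; [exact: plane_hausdorff|exact: bary_hull_compact].
Qed.

Lemma hull_convex s : convex_set (hull (simplex_of s)).
Proof.
move=> x y l /set_mem/hullP[w [w0 ws w1] ->] /set_mem/hullP[w' [w0' ws' w1'] ->].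
have k0 : 0 <= l%:num by []. have k1 : l%:num <= 1 by [].
apply/mem_set/hullP; set k : R := l%:num in k0 k1 *; rewrite -subr_ge0 in k1.
exists (fun v => k * w v + (1 - k) * w' v).
  split; first by move=> v; rewrite addr_ge0 ?mulr_ge0.
    by move=> v vs; rewrite ws // ws' // !mulr0 addr0.
  by rewrite big_split /= -!mulr_sumr w1 w1'; ring.
rewrite /conv /= /unstable.onem -/k /wsum !scaler_sumr -big_split /=.
by apply: eq_bigr => v _; rewrite !scalerA -scalerDl.
Qed.

Lemma simp_neq0 s : simp s -> s != finset.set0.
Proof.
move=> ss; have [h _ _] := TK; have [n0 _] := h _ ss.
apply: contra_not_neq n0 => ->; apply/fsetP => q; apply/imfsetP; rewrite inE.
by case=> x /=; rewrite inE.
Qed.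

(** Simplices are closed and finite in number, so close to [q] only those that contain [q] occur. *)
Lemma move_simplex q n : (polyhedron K)° q -> exists (r : R) s,
  [/\ 0 < r, simp s, hull (simplex_of s) q & hull (simplex_of s) (q + r *: n)].
Proof.
move=> iq; have N : nbhs q [set q' | forall s, hull (simplex_of s) q' -> hull (simplex_of s) q].
  apply: (@filter_forall _ _ (fun s => [set q' | hull (simplex_of s) q' -> hull (simplex_of s) q]) _ (nbhs_filter q)) => s; have [h|h] := pselect (hull (simplex_of s) q).
    by apply: filterS (filterT) => q' _.
  have : nbhs q (~` hull (simplex_of s)).
    by apply: open_nbhs_nbhs; split=> //; apply: closed_openC; apply: hull_closed.
  by apply: filterS => q' /= h' /h'.
have [e e0 he] := nbhs_dir n (filterI N iq).
have [] := he e; first by rewrite ger0_norm // ltW.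
move=> h /polyhedronP[s [w [ss bw E]]].
have hs : hull (simplex_of s) (q + e *: n) by apply/hullP; exists w.
by exists e, s; split=> //; apply: h.
Qed.

Let hull_vpos s x : x \in s -> hull (simplex_of s) (pos x).
Proof.
move=> xs; apply/hullP; exists (weight1 R x); last by rewrite wsum_weight1.
by apply: bary_mono (bary_weight1 R x); rewrite finset.sub1set.
Qed.

Let poly_vpos x : polyhedron K (pos x).
Proof.
by apply/polyhedronP; exists [set x]%SET, (weight1 R x); rewrite wsum_weight1 simp1 //; split=> //; exact: bary_weight1.
Qed.

Let hull_poly s q : simp s -> hull (simplex_of s) q -> polyhedron K q.
Proof. by move=> ss hq; exists (simplex_of s). Qed.

Let vpos_neq x y : x != y -> pos x != pos y.
Proof. by apply: contra_neq; apply: vpos_inj. Qed.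

(** An interior point of the polyhedron inside the edge could be moved to its left within a simplex
    through that point. Such a simplex contains [u] and [v], and by hypothesis none of its vertices
    is left of [uv]. *)
Lemma edge_frontier u v : simp [set u; v]%SET -> u != v ->
  (forall w, simp [set u; v; w]%SET -> v != w -> u != w ->
    area (pos u) (pos v) (pos w) <= 0) ->
  hull (simplex_of [set u; v]%SET) `<=` frontier (polyhedron K).
Proof.
move=> suv uv H.
pose e k := pos u + k *: (pos v - pos u).
have inner (k : R) : 0 < k < 1 -> ~ (polyhedron K)° (e k).
  move=> /andP[k0 k1] ik.
  pose n : plane := \row_(i < 2) (if i == 0 then - (pos v 0 1 - pos u 0 1) else pos v 0 0 - pos u 0 0).
  have [t [s [t0 ss /hullP[w bw E] /hullP[w' bw' E']]]] := move_simplex n ik.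
  have k01 : 0 <= k <= 1 by rewrite !ltW.
  have b2 := bary_weight2 uv k01.
  have Ew : w =1 weight2 u v k by apply: (inj ss suv bw b2); rewrite wsum_weight2.
  have [wu wv] := weight2E k uv.
  have memw x : w x != 0 -> x \in s by case: bw => _ ws _; apply: contra_neqT => /ws.
  have us : u \in s by apply: memw; rewrite Ew wu; lra.
  have vs : v \in s by apply: memw; rewrite Ew wv; lra.
  have N0 : 0 < (pos v 0 0 - pos u 0 0) ^+ 2 + (pos v 0 1 - pos u 0 1) ^+ 2.
    rewrite lt_def addr_ge0 ?sqr_ge0 // andbT paddr_eq0 ?sqr_ge0 // !sqrf_eq0 !subr_eq0.
    apply: contra (vpos_neq uv) => /andP[/eqP h1 /eqP h2].
    by apply/eqP/ptP; rewrite ?h1 ?h2.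
  have A0 : 0 < area (pos u) (pos v) (e k + t *: n).
    have -> : area (pos u) (pos v) (e k + t *: n) =
        t * ((pos v 0 0 - pos u 0 0) ^+ 2 + (pos v 0 1 - pos u 0 1) ^+ 2).
      by rewrite /area !mxE /=; ring.
    exact: mulr_gt0.
  case: bw' => w0' ws' w1'; move: A0; rewrite E' area_wsum // ltNge => /negP; apply.
  apply: sumr_le0 => x _; have [xs|/ws'->] := boolP (x \in s); last by rewrite mul0r.
  rewrite mulr_ge0_le0 //.
  have [->|xu] := eqVneq x u; first by rewrite area_pqp.
  have [->|xv] := eqVneq x v; first by rewrite area_pqq.
  apply: H; rewrite 1?eq_sym //; apply: (sub ss).
    by apply/fintype.subsetP => y; rewrite !inE => /orP[/orP[]|] /eqP->.
  by apply/finset.set0Pn; exists u; rewrite !inE eqxx.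
move=> q hq; split; first by apply: subset_closure; apply: hull_poly hq.
move=> iq; case/hullP: hq => w bw E.
have [k01 Ek] := bary2_wsum pos uv bw.
have : nbhs q (polyhedron K)°.
  by apply: open_nbhs_nbhs; split=> //; exact: open_interior.
move=> /(nbhs_dir (e (1 / 2) - q))[d d0 hd].
(* An end of the edge is treated by a shift towards the midpoint: interior points form an open set,
   so a point strictly inside the edge would be interior as well. *)
pose d' := Num.min d (1 / 2).
have d'0 : 0 < d' by rewrite lt_min d0; lra.
have d'1 : d' <= 1 / 2 by rewrite ge_min lexx orbT.
have dd : d' <= d by rewrite ge_min lexx.
apply: (inner (w v + d' * (1 / 2 - w v))); last first.
  have -> : e (w v + d' * (1 / 2 - w v)) = q + d' *: (e (1 / 2) - q).
    by rewrite E Ek /e; apply: ptP; rewrite !mxE; ring.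
  by apply: hd; rewrite ger0_norm // ltW.
by case/andP: k01 => h0 h1; apply/andP; split; nra.
Qed.

Lemma maximal_simplex s : simp s -> exists2 t, simp t /\ s \subset t &
  forall t', simp t' -> t \subset t' -> t' = t.
Proof.
move=> ss; have := arg_maxnP (P := fun t => simp t && (s \subset t)) (fun t => #|t|) (i0 := s).
rewrite ss subxx => /(_ isT)[t /andP[st sub_st] mx].
exists t => // t' st' tt'; apply/esym/eqP; rewrite eqEcard tt' /=.
by apply: mx; rewrite st' (fintype.subset_trans sub_st).
Qed.

Hypothesis V3 : (2 < #|V|)%N.

(** A maximal simplex [t] that is not a triangle meets the simplices not containing it only in
    proper faces: in nothing if it is a vertex, in its ends if it is an edge. So at most two points
    would separate it from the rest of the disk. *)
Lemma simplex_in_triangle s : simp s -> exists2 t, t \in triangles (@simp R K) & s \subset t.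
Proof.
move=> ss; have [t [st sub_st] mx] := maximal_simplex ss.
exists t => //; rewrite !inE st /= eqn_leq (simp_card sub inj) //= leqNgt; apply/negP=> t2.
pose U := hull (simplex_of t).
pose W : set plane := \bigcup_(r in [set r : {set V} | simp r && ~~ (t \subset r)]) hull (simplex_of r).
have cW : closed W.
  by apply: closed_bigcup => [|r _]; [exact: finite_finset|exact: hull_closed].
have cov : polyhedron K `<=` U `|` W.
  move=> q /polyhedronP[r [w [sr bw E]]]; have [tr|tr] := boolP (t \subset r).
    by left; apply/hullP; exists w; rewrite // -(mx r).
  by right; exists r; rewrite /= ?sr //; apply/hullP; exists w.
have meet q : U q -> W q -> exists r w, [/\ bary r w, r \proper t & q = wsum pos w].
  move=> /hullP[w bw E] [r /= /andP[sr tr] /hullP[w' bw' E']].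
  exists (t :&: r)%SET, w; split=> //.
    by apply: (bary_meet bw bw'); apply: (inj st sr bw bw'); rewrite -E -E'.
  rewrite properE finset.subsetIl /=; apply: contra tr => h.
  exact: fintype.subset_trans h (finset.subsetIr _ _).
have Wv y : y \notin t -> W (pos y).
  move=> yt; exists [set y]%SET; last exact/hull_vpos/finset.set11.
  apply/andP; split; first exact: simp1.
  apply: contra yt => h.
  have /finset.set0Pn[x xt] := simp_neq0 st.
  by have := fintype.subsetP h x xt; rewrite finset.in_set1 => /eqP e; rewrite -e.
have : (0 < #|t|)%N by rewrite card_gt0 simp_neq0.
case tE : #|t| t2 => [|[|[|]]] // _ _.
  have /eqP/cards1P[x tx] := tE.
  have /card_gt1P[y [z [yt zt yz]]] : (1 < #|~: t|)%N.
    by rewrite -(leq_add2l #|t|) cardsC tE.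
  rewrite tx !inE in yt zt.
  (* Nothing has to be removed here; the points to be avoided are filled by a vertex [z] other than
     [x] and [y], for which three vertices are needed. *)
  apply: (@disk_no_cut R (polyhedron K) U W (pos z) (pos z) (pos x) (pos y)) => //.
  - exact: hull_closed.
  - move=> q _ Uq Wq; have [r [w [bw rt E]]] := meet q Uq Wq.
    have [v vr _] := bary_pos bw; move: rt; rewrite tx.
    rewrite properE => /andP[r1 /negP]; case.
    have := fintype.subsetP r1 v vr; rewrite finset.in_set1 => /eqP <-.
    by rewrite finset.sub1set.
  - by apply: hull_vpos; rewrite tx finset.set11.
  - by apply/eqP/vpos_neq; rewrite eq_sym.
  - by apply/eqP/vpos_neq; rewrite eq_sym.
  - by apply: Wv; rewrite tx finset.in_set1.
  - exact/eqP/vpos_neq.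
  - exact/eqP/vpos_neq.
have /eqP/cards2P[u [v [uv tuv]]] := tE.
have /card_gt0P[y yt] : (0 < #|~: t|)%N by rewrite -(leq_add2l #|t|) cardsC tE.
rewrite inE in yt.
have [yu yv] : y != u /\ y != v by move: yt; rewrite tuv !inE negb_or => /andP.
pose m := pos u + 2^-1 *: (pos v - pos u).
have h2 : 0 <= (2^-1 : R) <= 1 by apply/andP; lra.
have bm := bary_weight2 uv h2.
have Em : m = wsum pos (weight2 u v 2^-1) by rewrite wsum_weight2.
have Um : U m by apply/hullP; exists (weight2 u v 2^-1); rewrite ?tuv.
have mne x (k : R) : k != 2^-1 -> pos x = pos u + k *: (pos v - pos u) -> m <> pos x.
  move=> k2 e; rewrite e => /addrI/eqP; rewrite -subr_eq0 -scalerBl scaler_eq0 !subr_eq0.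
  rewrite eq_sym (negbTE k2) /= => /eqP; apply/eqP; rewrite eq_sym; exact: vpos_neq.
apply: (@disk_no_cut R (polyhedron K) U W (pos u) (pos v) m (pos y)) => //.
- exact: hull_closed.
- move=> q _ Uq Wq; have [r [w [bw rt E]]] := meet q Uq Wq.
  by rewrite E; apply: (wsum_proper_edge _ bw); rewrite -tuv.
- exact: hull_poly Um.
- by apply: (mne _ 0); rewrite ?scale0r ?addr0 //; apply/eqP; lra.
- by apply: (mne _ 1); rewrite ?scale1r 1?[RHS]addrC ?subrK //; apply/eqP; lra.
- exact: Wv.
- exact/eqP/vpos_neq.
- exact/eqP/vpos_neq.
Qed.

End DiskComplex.

(** * The boundary curve and its image *)

Section BoundaryCurve.
Variables (R : realType) (K : {fset {fset 'rV[R]_2}}) (f : 'rV[R]_2 -> 'rV[R]_2).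
Local Notation plane := 'rV[R]_2.
Local Notation V := (vertices K : finType).
Local Notation pos := (@vpos R K).
Implicit Types (s t : {set V}) (u v x : V) (q : plane).
Hypotheses (TK : triangulation K) (diskK : is_disk (polyhedron K)).
Hypothesis embf : SL_embedding (bd K) f.

Let inj := simp_bary_inj TK.
Let sub := simp_subset TK.

Definition bd_simp s : bool := simplex_of s \in bd K.

Definition bd_image x : plane := f (pos x).

Local Notation p := bd_image.

Lemma bd_simpP s : reflect (simp s /\ hull (simplex_of s) `<=` frontier (polyhedron K)) (bd_simp s).
Proof.
rewrite /bd_simp /bd !inE /=; apply: (iffP andP) => [[ss /asboolP]|[ss h]] //.
by split=> //; apply/asboolP.
Qed.

Lemma bd_simp_simp s : bd_simp s -> simp s.
Proof. by case/bd_simpP. Qed.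

Lemma bd_simp_sub s t : bd_simp s -> t \subset s -> t != finset.set0 -> bd_simp t.
Proof.
move=> /bd_simpP[ss fs] ts t0; apply/bd_simpP; split; first exact: sub ss ts t0.
move=> q /hullP[w bw E]; apply: fs; apply/hullP; exists w => //.
exact: bary_mono bw.
Qed.

(** A triangle has interior points, which are not on the frontier. *)
Lemma bd_simp_card s : bd_simp s -> (0 < #|s| <= 2)%N.
Proof.
move=> /bd_simpP[ss fs]; rewrite card_gt0 simp_neq0 //= leqNgt; apply/negP=> s3.
have sT : s \in triangles (@simp R K) by rewrite inE ss eqn_leq s3 (simp_card sub inj).
have [x [y [z [es xy yz xz]]]] := trianglesP sT.
have n0 : area (pos x) (pos y) (pos z) != 0 by apply: simp_area sub inj _ _ _ _ _ _ _; rewrite -?es.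
have hv v : v \in s -> hull (simplex_of s) (pos v).
  move=> vs; apply/hullP; exists (weight1 R v); last by rewrite wsum_weight1.
  by apply: bary_mono (bary_weight1 R v); rewrite finset.sub1set.
have [xs ys zs] : [/\ x \in s, y \in s & z \in s] by rewrite es !inE !eqxx !orbT.
have [q iq] := interior_noncollinear (@hull_convex R K s) (hv _ xs) (hv _ ys) (hv _ zs) n0.
have [_] := fs q (interior_subset iq); apply.
by apply: filterS iq => q' hq'; exists (simplex_of s).
Qed.

Lemma f_wsum s w : bd_simp s -> bary s w -> f (wsum pos w) = wsum p w.
Proof.
move=> ss bw; have [[_ aff] _] := embf; have [M [b MbE]] := aff _ ss.
have hv v : v \in s -> hull (simplex_of s) (pos v).
  move=> vs; apply/hullP; exists (weight1 R v); last by rewrite wsum_weight1.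
  by apply: bary_mono (bary_weight1 R v); rewrite finset.sub1set.
have [w0 ws w1] := bw.
rewrite MbE; last by apply/hullP; exists w.
rewrite /wsum mulmx_suml -[b in LHS]scale1r -w1 scaler_suml -big_split /=.
apply: eq_bigr => v _; rewrite -scalemxAl -scalerDr.
by have [/hv/MbE h|/ws->] := boolP (v \in s); rewrite ?scale0r // /p h.
Qed.

Lemma poly_bdP q : polyhedron (bd K) q <-> exists s w, [/\ bd_simp s, bary s w & q = wsum pos w].
Proof.
split=> [[S SK hS]|[s [w [ss bw ->]]]]; last by exists (simplex_of s) => //; apply/hullP; exists w.
have SK' : S \in K by move: SK; rewrite /bd !inE => /andP[].
rewrite -(verts_ofK SK') in hS SK; move/hullP: hS => [w bw E].
by exists (verts_of K S), w.
Qed.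

Lemma bd_image_inj s t w w' : bd_simp s -> bd_simp t -> bary s w -> bary t w' ->
  wsum p w = wsum p w' -> forall v, w v = w' v.
Proof.
move=> ss st bw bw'; rewrite -(f_wsum ss bw) -(f_wsum st bw') => E.
apply: (inj (bd_simp_simp ss) (bd_simp_simp st) bw bw').
have [_ injf] := embf; apply: injf => //; apply/mem_set/poly_bdP.
  by exists s, w.
by exists t, w'.
Qed.

Lemma image_simplex s : [fset f v | v in simplex_of s]%fset = [fset p x | x in s]%fset.
Proof.
apply/fsetP => z; apply/imfsetP/imfsetP => [[v /= /imfsetP[x /= xs ->] ->]|[x /= xs ->]].
  by exists x.
by exists (pos x) => //; apply/imfsetP; exists x.
Qed.

Lemma image_polyP q : polyhedron (image_triangulation f (bd K)) q <->
  exists s w, [/\ bd_simp s, bary s w & q = wsum p w].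
Proof.
have inj_s s : bd_simp s -> {in s &, injective p}.
  move=> ss x y xs ys e.
  have b1 z : z \in s -> bd_simp [set z]%SET.
    move=> zs; apply: bd_simp_sub ss _ _; first by rewrite finset.sub1set.
    by apply/finset.set0Pn; exists z; rewrite finset.set11.
  have := bd_image_inj (b1 _ xs) (b1 _ ys) (bary_weight1 R x) (bary_weight1 R y).
  rewrite !wsum_weight1 => /(_ e x); rewrite /weight1 eqxx.
  by case: eqP => // _ /eqP; rewrite oner_eq0.
split=> [[S /imfsetP[S' /= S'K ->]]|[s [w [ss bw ->]]]]; last first.
  exists [fset f v | v in simplex_of s]%fset.
    by apply/imfsetP; exists (simplex_of s).
  by rewrite image_simplex; apply/(hull_imfsetP _ (inj_s s ss)); exists w.
have SK' : S' \in K by move: S'K; rewrite /bd !inE => /andP[].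
rewrite -(verts_ofK SK') in S'K *; rewrite image_simplex => /(hull_imfsetP _ (inj_s _ S'K))[w bw E].
by exists (verts_of K S'), w.
Qed.

Hypothesis circle : convex_circle (image_triangulation f (bd K)).

(** The order comes from the image polygon and carries over, since a boundary simplex and its image
    have the same abstract vertices. *)
Lemma boundary_cycle : exists c : seq V,
  [/\ uniq c, (2 < size c)%N, weakly_convex p c & not_all_collinear p c] /\
  [/\ {in c &, injective p}, forall x, (x \in c) = bd_simp [set x]%SET &
      forall u v, ce c u v = (u != v) && bd_simp [set u; v]%SET].
Proof.
have [D [dD fD cD]] := circle.
apply: (convex_disk_cycle bd_simp_card bd_simp_sub bd_image_inj dD cD) => q.
by rewrite fD; exact: image_polyP.
Qed.

(** An edge of the boundary of [T] is in an odd number of triangles, hence in one. Directed so that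
    the third vertex is on its right, it satisfies [edge_frontier] and belongs to [c]. *)
Lemma disk_triangles c : uniq c -> (2 < size c)%N ->
  (forall u v, ce c u v = (u != v) && bd_simp [set u; v]%SET) ->
  disk (triangles (@simp R K)) c.
Proof.
move=> Uc sz cE.
have V3 : (2 < #|V|)%N.
  by apply: leq_trans sz _; rewrite cardE; apply: uniq_leq_size => // x _; rewrite mem_enum.
apply: (disk_of_complex sub inj Uc sz).
  case: c Uc sz cE => // x c _ _ _.
  have [t tT _] := simplex_in_triangle TK diskK V3 (simp1 TK x).
  by apply/finset.set0Pn; exists t.
move=> u v; rewrite bdT_card => od.
have := edge_triangles_le2 sub inj u v.
case E: #|_| od => [|[|[|]]] // _ _.
have /eqP/cards1P[t tE] := E.
have : t \in [set t in triangles (@simp R K) | te t u v]%SET by rewrite tE finset.set11.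
rewrite inE => /andP[tT tuv]; have uv : u != v by case/and3P: tuv.
have [w [tuvw vw uw]] := triangle_third tT tuv.
have uniq_w w' : simp [set u; v; w']%SET -> v != w' -> u != w' -> w' = w.
  move=> ss vw' uw'; have : [set u; v; w']%SET \in [set t in triangles (@simp R K) | te t u v]%SET.
    rewrite inE; apply/andP; split; last by rewrite /te uv !inE !eqxx orbT.
    by rewrite inE ss /= finset.setUC cardsU1 !inE negb_or ![w' == _]eq_sym uw' vw' cards2 uv.
  rewrite tE finset.in_set1 tuvw => /eqP e.
  have : w' \in [set u; v; w]%SET by rewrite -e !inE eqxx orbT.
  by rewrite !inE => /orP[/orP[]|] /eqP // h; rewrite h eqxx in vw' uw'.
have st : simp t by move: tT; rewrite inE => /andP[].
have suv : simp [set u; v]%SET.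
  apply: (sub st); first by rewrite tuvw finset.subsetUl.
  by apply/finset.set0Pn; exists u; rewrite !inE eqxx.
rewrite cE uv; apply/bd_simpP; split=> //.
have [h|h] := lerP (area (pos u) (pos v) (pos w)) 0.
  suff H w' : simp [set u; v; w']%SET -> v != w' -> u != w' -> area (pos u) (pos v) (pos w') <= 0.
    by have := edge_frontier TK suv uv H.
  by move=> s' vw' uw'; rewrite (uniq_w w').
suff H w' : simp [set v; u; w']%SET -> u != w' -> v != w' -> area (pos v) (pos u) (pos w') <= 0.
  rewrite finset.setUC in suv *; rewrite eq_sym in uv.
  by have := edge_frontier TK suv uv H.
move=> s' uw' vw'; rewrite (uniq_w w') //; last by rewrite [[set u; v]%SET]finset.setUC.
by rewrite areaC oppr_le0 ltW.
Qed.

End BoundaryCurve.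

(** * Flat arcs and obstructive edges *)

Section Arcs.
Variable R : realType.
Local Notation plane := 'rV[R]_2.
Implicit Types (a b d q : plane) (A B : set plane).

(** Unlike [is_arc] it asks for continuity on the whole line, which lets [arc_cat] compose with
    clamped parameters. *)
Definition cont_arc a b A := exists c : R -> plane,
  [/\ continuous c, set_inj `[0, 1] c, c 0 = a, c 1 = b & A = c @` `[0, 1]].

Lemma cont_arc_is_arc a b A : cont_arc a b A -> is_arc a b A.
Proof. by case=> c [cc ic c0 c1 e]; exists c; split=> //; exact: continuous_subspaceT. Qed.

Lemma segment_arc a b : a != b -> cont_arc a b [set a + k *: (b - a) | k in `[0, 1]].
Proof.
move=> ab; exists (fun k => a + k *: (b - a)); split=> //.
- exact: line_continuous.
- move=> k l _ _ /addrI/eqP; rewrite -subr_eq0 -scalerBl scaler_eq0 !subr_eq0.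
  by rewrite [b == a]eq_sym (negbTE ab) orbF => /eqP.
- by rewrite scale0r addr0.
by rewrite scale1r addrC subrK.
Qed.

(** While one arc is run through, the other rests at [b]; hence [g] is a sum of continuous maps, and
    no case distinction is needed for its continuity. *)
Lemma arc_cat a b d A B : cont_arc a b A -> cont_arc b d B ->
  (forall q, A q -> B q -> q = b) -> cont_arc a d (A `|` B).
Proof.
move=> [c [cc ic c0 c1 cA]] [e [ce ie e0 e1 eB]] AB.
pose h : R := 1 / 2.
(* al t = min (2t) 1 and be t = max (2t - 1) 0 *)
pose al (t : R) := t + h - `|t - h|; pose be (t : R) := t - h + `|t - h|.
pose g t := c (al t) + e (be t) - b.
have nc : continuous (fun t : R => `|t - h|).
  move=> t; apply: (@cvg_norm _ _ _ (nbhs t)).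
  by apply: cvgB; [exact: cvg_id|exact: cvg_cst].
have cal : continuous al.
  move=> t; apply: cvgB; last exact: nc.
  by apply: cvgD; [exact: cvg_id|exact: cvg_cst].
have cbe : continuous be.
  move=> t; apply: cvgD; last exact: nc.
  by apply: cvgB; [exact: cvg_id|exact: cvg_cst].
have hE : h + h = 1 by rewrite /h; lra.
have gl t : t <= h -> g t = c (t + t).
  move=> th; have E : `|t - h| = h - t by rewrite ler0_norm ?opprB // subr_le0.
  have -> : t + t = al t by rewrite /al E; ring.
  by rewrite /g (_ : be t = 0) ?e0 ?addrK // /be E; ring.
have gr t : h <= t -> g t = e (t + t - 1).
  move=> th; have E : `|t - h| = t - h by rewrite ger0_norm // subr_ge0.
  have -> : t + t - 1 = be t by rewrite /be E -hE; ring.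
  by rewrite /g (_ : al t = 1) ?c1 1?addrAC ?addrN ?add0r // /al E -hE; ring.
have I (t : R) : `[0, 1]%classic t -> 0 <= t <= 1 by rewrite /= in_itv.
have J (t : R) : 0 <= t <= 1 -> `[0, 1]%classic t by rewrite /= in_itv.
exists g; split.
- move=> t; apply: cvgB; last exact: cvg_cst.
  apply: cvgD; first exact: (continuous_comp (cal t) (cc _)).
  exact: (continuous_comp (cbe t) (ce _)).
- have cross s t : 0 <= s <= h -> h <= t <= 1 -> g s = g t -> s = t.
    move=> /andP[s0 sh] /andP[th t1]; rewrite gl // gr // => E.
    have Js : `[0, 1]%classic (s + s) by apply: J; apply/andP; lra.
    have Jt : `[0, 1]%classic (t + t - 1) by apply: J; apply/andP; lra.
    have q1 : c (s + s) = b by apply: AB; [rewrite cA; exists (s + s)|rewrite E eB; exists (t + t - 1)].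
    have s1 : s + s = 1.
      by apply: ic; rewrite ?inE //; [apply: J; apply/andP; lra|rewrite c1].
    have t2 : t + t - 1 = 0.
      by apply: ie; rewrite ?inE //; [apply: J; apply/andP; lra|rewrite -E q1 e0].
    by lra.
  move=> s t /set_mem/I/andP[s0 s1] /set_mem/I/andP[t0 t1].
  have [sh|sh] := lerP s h; have [th|th] := lerP t h.
  + rewrite !gl // => E; suff : s + s = t + t by lra.
    by apply: ic => //; rewrite inE; apply: J; apply/andP; lra.
  + by apply: cross; apply/andP; lra.
  + by move=> E; apply/esym; apply: cross => //; apply/andP; lra.
  + rewrite !gr ?ltW // => E; suff : s + s - 1 = t + t - 1 by lra.
    by apply: ie => //; rewrite inE; apply: J; apply/andP; lra.
- by rewrite gl ?addr0 // /h; lra.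
- by rewrite gr; [rewrite addrK|rewrite /h; lra].
rewrite cA eB; apply/seteqP; split=> [q [[t /I/andP[t0 t1] <-]|[t /I/andP[t0 t1] <-]]|q [t /I/andP[t0 t1] <-]].
- exists (t / 2); first by apply: J; apply/andP; lra.
  by rewrite gl; [congr c; lra|rewrite /h; lra].
- exists ((t + 1) / 2); first by apply: J; apply/andP; lra.
  by rewrite gr; [congr e; lra|rewrite /h; lra].
have [th|th] := lerP t h.
  by left; exists (t + t); [apply: J; apply/andP; lra|rewrite gl].
by right; exists (t + t - 1); [apply: J; apply/andP; lra|rewrite gr // ltW].
Qed.

End Arcs.

Lemma ce_consecutive (V : finType) (c s1 s2 : seq V) (u v : V) : uniq c -> (2 < size c)%N ->
  c = s1 ++ u :: v :: s2 -> ce c u v.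
Proof.
move=> Uc sz e; have e' : perm_eq c (u :: v :: (s2 ++ s1)).
  by rewrite e perm_sym -!cat_cons perm_catC.
rewrite e ce_rot -[_ ++ s1]/(u :: v :: (s2 ++ s1)).
have U : uniq (u :: v :: (s2 ++ s1)) by rewrite -(perm_uniq e').
have S : (2 < size (u :: v :: (s2 ++ s1)))%N by rewrite -(perm_size e').
rewrite ce_head // eqxx /=; case: (s2 ++ s1) U S => //= w l /and3P[_ vl _] _.
by apply: contraNneq vl => ->; rewrite mem_last.
Qed.

Lemma cycle_path (V : finType) (c l s1 s2 : seq V) (x : V) : uniq c -> (2 < size c)%N ->
  c = s1 ++ x :: l ++ s2 -> path (ce c) x l.
Proof.
move=> Uc sz; elim: l x s1 => //= y l IH x s1 e.
by rewrite (ce_consecutive Uc sz e); apply: (IH y (rcons s1 x)); rewrite cat_rcons.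
Qed.

(** * From one-sided inner edges to obstructive ones *)

Section Obstruction.
Variables (R : realType) (K : {fset {fset 'rV[R]_2}}) (f : 'rV[R]_2 -> 'rV[R]_2).
Local Notation plane := 'rV[R]_2.
Local Notation V := (vertices K : finType).
Local Notation pos := (@vpos R K).
Local Notation p := (@bd_image R K f).
Implicit Types (s t : {set V}) (u v x y : V) (q : plane).
Hypotheses (TK : triangulation K) (diskK : is_disk (polyhedron K)).
Hypothesis embf : SL_embedding (bd K) f.

Let inj := simp_bary_inj TK.

Lemma edge_hullP u v q : u != v -> hull (simplex_of [set u; v]%SET) q <->
  exists2 k, 0 <= k <= 1 & q = pos u + k *: (pos v - pos u).
Proof.
move=> uv; split=> [/hullP[w bw ->]|[k k01 ->]].
  by have [k01 ->] := bary2_wsum pos uv bw; exists (w v).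
by apply/hullP; exists (weight2 u v k); [exact: bary_weight2|rewrite wsum_weight2].
Qed.

Lemma edge_arc u v : u != v -> cont_arc (pos u) (pos v) (hull (simplex_of [set u; v]%SET)).
Proof.
move=> uv.
have -> : hull (simplex_of [set u; v]%SET) = [set pos u + k *: (pos v - pos u) | k in `[0, 1]].
  apply/seteqP; split=> q.
    by move=> /(edge_hullP _ uv)[k k01 ->]; exists k; rewrite /= ?in_itv.
  by move=> [k /=]; rewrite in_itv /= => k01 <-; apply/(edge_hullP _ uv); exists k.
by apply: segment_arc; apply: contra_neq uv; apply: vpos_inj.
Qed.

(** The first edge meets the later ones in common faces, and [x] does not occur again, so it meets
    the rest of the arc in [y] only. *)
Lemma path_arc (E : rel V) x l : (forall u v, E u v -> simp [set u; v]%SET) ->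
  uniq (x :: l) -> l != [::] -> path E x l ->
  exists A, cont_arc (pos x) (pos (last x l)) A /\ forall q, A q ->
    exists u v, [/\ u \in x :: l, v \in x :: l, E u v & hull (simplex_of [set u; v]%SET) q].
Proof.
move=> Es; elim: l x => // y l IH x /andP[xl U] _ /= /andP[xy pl].
have nxy : x != y by move: xl; rewrite inE negb_or => /andP[].
have aA := edge_arc nxy.
have [l0|l0] := eqVneq l [::].
  exists (hull (simplex_of [set x; y]%SET)); split; first by rewrite l0.
  by move=> q hq; exists x, y; rewrite !inE !eqxx ?orbT.
have [A [arcA AE]] := IH y U l0 pl.
exists (hull (simplex_of [set x; y]%SET) `|` A); split; last first.
  move=> q [hq|/AE[u [v [ul vl uv hq]]]]; first by exists x, y; rewrite !inE !eqxx ?orbT.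
  by exists u, v; split=> //; rewrite inE ?ul ?vl orbT.
apply: (arc_cat aA arcA) => q /hullP[w bw E1] /AE[u [v [ul vl uv /hullP[w' bw' E2]]]].
have bI : bary ([set x; y] :&: [set u; v])%SET w.
  by apply: (bary_meet bw bw'); apply: (inj (Es _ _ xy) (Es _ _ uv) bw bw'); rewrite -E1.
rewrite E1; apply: (wsum_sub1 _ bI); apply/fintype.subsetP => z; rewrite !inE.
move=> /andP[/orP[/eqP->|//] /orP[] /eqP e]; case/negP: xl; by rewrite e.
Qed.

Variable c : seq V.
Hypotheses (Uc : uniq c) (sz : (2 < size c)%N) (Wc : weakly_convex p c).
Hypothesis (injc : {in c &, injective p}).
Hypothesis c_vertex : forall x, (x \in c) = bd_simp [set x]%SET.
Hypothesis c_edge : forall u v, ce c u v = (u != v) && bd_simp [set u; v]%SET.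

(** A vertex between [x] and [y] in the cyclic order is weakly right of [xy] by convexity and weakly
    left by hypothesis. *)
Lemma flat_arc x y : x \in c -> y \in c -> x != y -> ~~ ce c x y ->
  (forall z, z \in c -> 0 <= area (p x) (p y) (p z)) ->
  exists l, [/\ uniq (x :: rcons l y), l != [::], path (ce c) x (rcons l y) &
    forall z, z \in x :: rcons l y -> z \in c /\ area (p x) (p y) (p z) = 0].
Proof.
move=> xc yc xy nxy ge0.
have [s1 [s2 e1]] : exists s1 s2 : seq V, c = s1 ++ x :: s2.
  by case/splitPr: xc => s1 s2; exists s1, s2.
have e2 : perm_eq c (x :: s2 ++ s1) by rewrite e1 perm_sym -cat_cons perm_catC.
have ys : y \in s2 ++ s1.
  by move: yc; rewrite (perm_mem e2) inE eq_sym (negbTE xy).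
have [l [r e3]] : exists l r : seq V, s2 ++ s1 = l ++ y :: r.
  by case/splitPr: ys => l r; exists l, r.
have e4 : x :: s2 ++ s1 = (x :: rcons l y) ++ r by rewrite e3 -cat_rcons.
have W' : weakly_convex p (x :: s2 ++ s1) by apply: (@weakly_convex_rot _ _ _ s1 (x :: s2)); rewrite -e1.
have U' : uniq (x :: s2 ++ s1) by rewrite -(perm_uniq e2).
have sz' : (2 < size (x :: s2 ++ s1))%N by rewrite -(perm_size e2).
have cE u v : ce c u v = ce (x :: s2 ++ s1) u v by rewrite e1 ce_rot.
have pl : path (ce c) x (rcons l y).
  rewrite (eq_path (e' := ce (x :: s2 ++ s1))) //.
  exact: (cycle_path (s1 := [::]) U' sz' e4).
have mem z : z \in x :: rcons l y -> z \in c.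
  by move=> h; rewrite (perm_mem e2) e4 mem_cat h.
exists l; split=> //.
- by move: U'; rewrite e4 cat_uniq => /and3P[].
- by apply: contra nxy => /eqP l0; move: pl; rewrite l0 /= andbT.
move=> z zl; split; first exact: mem.
move: (zl); rewrite inE mem_rcons inE => /or3P[/eqP->|/eqP->|zl'].
- by rewrite area_pqp.
- by rewrite area_pqq.
have := ge0 z (mem z zl).
have : 0 <= area (p x) (p z) (p y).
  apply: W'; rewrite e4; apply: subseq_trans (prefix_subseq _ _).
  rewrite /= eqxx -cats1 -[[:: z; y]]/([:: z] ++ [:: y]); apply: cat_subseq => //.
  by rewrite sub1seq.
by rewrite areaC23; lra.
Qed.

(** The first two edges of the flat arc are distinct, collinear and adjacent at [z1]. *)
Lemma strictly_convex_no_flat_arc x y l : strictly_convex_circle (image_triangulation f (bd K)) ->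
  uniq (x :: rcons l y) -> l != [::] -> path (ce c) x (rcons l y) ->
  p x != p y ->
  (forall z, z \in x :: rcons l y -> area (p x) (p y) (p z) = 0) -> False.
Proof.
move=> [_ sc]; case: l => // z1 l U _ pl pxy al.
have [z2 [l' el]] : exists z2 l', rcons l y = z2 :: l' by case: l {U pl al} => [|z l]; eexists; eexists.
rewrite /= el in U pl al.
case/and3P: pl => c1 c2 _.
have [x1 x2 z12] : [/\ x != z1, x != z2 & z1 != z2].
  by case/and3P: U; rewrite !inE !negb_or => /and3P[-> -> _] /andP[-> _].
have E u v : ce c u v -> bd_simp [set u; v]%SET by rewrite c_edge => /andP[].
have img u v : [fset p w | w in [set u; v]%SET]%fset = [fset p u; p v]%fset.
  apply/fsetP => q; rewrite !inE; apply/imfsetP/orP => [[w /=]|].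
    by rewrite !inE => /orP[] /eqP-> ->; [left|right].
  by move=> [/eqP->|/eqP->]; [exists u|exists v]; rewrite // !inE eqxx ?orbT.
have mem u v : ce c u v -> [fset p u; p v]%fset \in image_triangulation f (bd K).
  by move=> /E uv; rewrite -img -image_simplex; apply/imfsetP; exists (simplex_of [set u; v]%SET).
have ne u v : ce c u v -> u != v -> p u != p v.
  by move=> /ce_in[uc vc]; apply: contra_neq; apply: injc.
have n1 := ne _ _ c1 x1; have n2 := ne _ _ c2 z12.
apply: (sc (p z1) _ _ (mem _ _ c1) (mem _ _ c2)).
- by rewrite cardfs2 n1.
- by rewrite cardfs2 n2.
- move=> e; have : p x \in [fset p z1; p z2]%fset by rewrite -e !inE eqxx.
  rewrite !inE (negbTE n1) /= => /eqP e2; move/eqP: x2; apply.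
  by apply: injc e2; [have [] := ce_in c1|have [] := ce_in c2].
- by rewrite !inE eqxx orbT.
- by rewrite !inE eqxx.
exists (p x), (p y - p x); split; first by rewrite subr_eq0 eq_sym.
have H u v q : p u != p v -> area (p x) (p y) (p u) = 0 -> area (p x) (p y) (p v) = 0 ->
    hull [fset p u; p v]%fset q -> exists k, p x + k *: (p y - p x) = q.
  move=> uv au av; rewrite -img => /hull_imfsetP[|w [_ ws w1] qE].
    by move=> a b; rewrite !inE => /orP[] /eqP-> /orP[] /eqP-> // e; rewrite e eqxx in uv.
  have : area (p x) (p y) q = 0.
    rewrite qE area_wsum // big1 // => v' _; have [|/ws->] := boolP (v' \in [set u; v]%SET); last by rewrite mul0r.
    by rewrite !inE => /orP[] /eqP->; rewrite ?au ?av mulr0.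
  by move=> /(collinear_param pxy)[k ->]; exists k.
have [a1 [a2 a3]] : area (p x) (p y) (p x) = 0 /\ area (p x) (p y) (p z1) = 0 /\ area (p x) (p y) (p z2) = 0.
  by rewrite !al // !inE eqxx ?orbT.
by move=> q [/(H _ _ _ n1 a1 a2)|/(H _ _ _ n2 a2 a3)] [k e]; exists k.
Qed.

(** The edge is spanning: it is not in the boundary, so every boundary simplex meets it in a proper
    face. The arc is flat because [f] is affine on each of its edges. *)
Lemma flat_arc_obstructive x y l : simp [set x; y]%SET -> x \in c -> y \in c -> x != y ->
  ~~ ce c x y -> uniq (x :: rcons l y) -> path (ce c) x (rcons l y) ->
  (forall z, z \in x :: rcons l y -> area (p x) (p y) (p z) = 0) ->
  obstructive K f (simplex_of [set x; y]%SET).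
Proof.
move=> sxy xc yc xy nxy U pl al.
have E u v : ce c u v -> bd_simp [set u; v]%SET by rewrite c_edge => /andP[].
have Es u v : ce c u v -> simp [set u; v]%SET by move/E/bd_simp_simp.
have sE : simplex_of [set x; y]%SET = [fset pos x; pos y]%fset.
  apply/fsetP => q; rewrite !inE; apply/imfsetP/orP => [[w /=]|].
    by rewrite !inE => /orP[] /eqP-> ->; [left|right].
  by move=> [/eqP->|/eqP->]; [exists x|exists y]; rewrite // !inE eqxx ?orbT.
have pne : pos x != pos y by apply: contra_neq xy; apply: vpos_inj.
split.
  split=> //; first by rewrite sE cardfs2 pne.
  apply/seteqP; split=> [q /= /imfsetP[z /= zxy ->]|q [/hullP[w bw E1]]].
    split.
      apply/hullP; exists (weight1 R z); last by rewrite wsum_weight1.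
      by apply: bary_mono (bary_weight1 R z); rewrite finset.sub1set.
    apply/poly_bdP; exists [set z]%SET, (weight1 R z); split; last by rewrite wsum_weight1.
      rewrite -c_vertex; by move: zxy; rewrite !inE => /orP[] /eqP->.
    exact: bary_weight1.
  move=> /poly_bdP[t [w' [bt bw' E2]]].
  have e : w =1 w' by apply: (inj sxy (bd_simp_simp bt) bw bw'); rewrite -E1.
  have := bary_meet bw bw' e => bI.
  have pr : ([set x; y] :&: t)%SET \proper [set x; y]%SET.
    rewrite properE finset.subsetIl /=; apply: contra nxy => h.
    rewrite c_edge xy /=; apply: (bd_simp_sub TK bt).
      exact: fintype.subset_trans h (finset.subsetIr _ _).
    by apply/finset.set0Pn; exists x; rewrite !inE eqxx.
  rewrite /= sE !inE E1.
  by case: (wsum_proper_edge pos bI pr) => ->; rewrite eqxx ?orbT.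
have l0 : rcons l y != [::] by case: (l).
have [A [arcA AE]] := path_arc Es U l0 pl.
rewrite last_rcons in arcA.
exists (pos x), (pos y), A; split=> //; first exact: cont_arc_is_arc.
  by move=> q /AE[u [v [_ _ /E uv hq]]]; exists (simplex_of [set u; v]%SET).
have pxy : p x != p y by apply: contra_neq xy; apply: injc.
exists (p x), (p y - p x); split; first by rewrite subr_eq0 eq_sym.
move=> _ [q /AE[u [v [ul vl /E uv /hullP[w bw ->]]]] <-].
rewrite (f_wsum embf uv bw).
have [w0 ws w1] := bw.
have : area (p x) (p y) (wsum p w) = 0.
  rewrite area_wsum // big1 // => v' _; have [|/ws->] := boolP (v' \in [set u; v]%SET); last by rewrite mul0r.
  by rewrite !inE => /orP[] /eqP->; rewrite al ?mulr0.
by move=> /(collinear_param pxy)[k ->]; exists k.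
Qed.

(** If no vertex is strictly right of [xy], the arc from [x] to [y] is flat, which either hypothesis
    excludes; the left side follows by exchanging [x] and [y]. *)
Lemma no_flat_arc : strictly_convex_circle (image_triangulation f (bd K)) \/
    ~ (exists s : {fset plane}, obstructive K f s) ->
  unobstructed (triangles (@simp R K)) p c.
Proof.
move=> H.
have side x y : x \in c -> y \in c -> edge (triangles (@simp R K)) x y -> ~~ ce c x y ->
    exists2 z, z \in c & area (p x) (p y) (p z) < 0.
  move=> xc yc exy nxy; have [t tT /and3P[xy xt yt]] := edgeP _ _ _ exy.
  have st : simp t by move: tT; rewrite inE => /andP[].
  have sxy : simp [set x; y]%SET.
    apply: (simp_subset TK st).
      by apply/fintype.subsetP => z; rewrite !inE => /orP[] /eqP->.
    by apply/finset.set0Pn; exists x; rewrite !inE eqxx.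
  have [[z zc nz]|no] := pselect (exists2 z, z \in c & area (p x) (p y) (p z) < 0); first by exists z.
  have ge0 z : z \in c -> 0 <= area (p x) (p y) (p z).
    by move=> zc; rewrite leNgt; apply/negP=> h; apply: no; exists z.
  have [l [U l0 pl al]] := flat_arc xc yc xy nxy ge0.
  have pxy : p x != p y by apply: contra_neq xy; apply: injc.
  have al0 z (zl : z \in x :: rcons l y) := (al z zl).2.
  case: H => [sc|nob]; first by case: (strictly_convex_no_flat_arc sc U l0 pl pxy al0).
  by case: nob; exists (simplex_of [set x; y]%SET); apply: flat_arc_obstructive al0.
move=> x y xc yc exy nxy; have [z' zc' h'] := side x y xc yc exy nxy.
have eyx : edge (triangles (@simp R K)) y x.
  move: exy => /edgeP[t tT txy]; apply/edgeP; exists t => //; by rewrite te_sym.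
have nyx : ~~ ce c y x by rewrite ce_sym.
have [z zc h] := side y x yc xc eyx nyx.
by exists z, z'; split=> //; rewrite areaC oppr_gt0.
Qed.

End Obstruction.

(** * The extension *)

Section Extension.
Variables (R : realType) (K : {fset {fset 'rV[R]_2}}).
Local Notation plane := 'rV[R]_2.
Local Notation V := (vertices K : finType).
Local Notation pos := (@vpos R K).
Local Notation T := (triangles (@simp R K)).
Implicit Types (s t : {set V}) (q : plane) (w : V -> R).
Hypothesis TK : triangulation K.
Hypothesis cover : forall s, simp s -> exists2 t, t \in T & s \subset t.
Variable phi : V -> plane.
Hypothesis phi_inj : forall s t w w', s \in T -> t \in T -> bary s w -> bary t w' ->
  wsum phi w = wsum phi w' -> wsum pos w = wsum pos w'.

Let inj := simp_bary_inj TK.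
Let sub := simp_subset TK.
Let simpT t : t \in T -> simp t. Proof. by rewrite inE => /andP[]. Qed.

Lemma affine_map3 (P0 P1 P2 Q0 Q1 Q2 : plane) : area P0 P1 P2 != 0 ->
  exists (M : 'M[R]_2) (b : plane),
    [/\ P0 *m M + b = Q0, P1 *m M + b = Q1 & P2 *m M + b = Q2].
Proof.
move=> D0.
pose A : 'M[R]_2 := \matrix_(i < 2) (if i == 0 then P1 - P0 else P2 - P0).
pose B : 'M[R]_2 := \matrix_(i < 2) (if i == 0 then Q1 - Q0 else Q2 - Q0).
have uA : A \in unitmx.
  rewrite unitmxE unitfE (expand_det_row A 0) !big_ord_recl big_ord0 addr0.
  rewrite /cofactor !det_mx11 !mxE /=.
  have -> : lift (lift ord0 ord0) 0 = 0 :> 'I_2 by apply/val_inj.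
  have -> : lift ord0 0 = 1 :> 'I_2 by apply/val_inj.
  rewrite addn0 expr0 add0n expr1.
  by apply: contra_neq D0 => h; rewrite -[RHS]h /area; ring.
have AM : A *m (invmx A *m B) = B by rewrite mulKVmx.
have rE i : (row i A) *m (invmx A *m B) = row i B by rewrite -row_mul AM.
have := rE 0; have := rE 1; rewrite !rowK /= => r1 r0.
exists (invmx A *m B), (Q0 - P0 *m (invmx A *m B)); split.
- by rewrite addrC subrK.
- by rewrite addrCA -mulmxBl r0 addrC subrK.
- by rewrite addrCA -mulmxBl r1 addrC subrK.
Qed.

(** A point may lie in several triangles, but its weights are the same in all of them; the value 0
    elsewhere is a default. *)
Lemma extension_exists : exists g : plane -> plane, forall t w, t \in T -> bary t w ->
  g (wsum pos w) = wsum phi w.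
Proof.
have : forall q, exists q', forall t w, t \in T -> bary t w -> q = wsum pos w -> q' = wsum phi w.
  move=> q; have [[t [w [tT bw qE]]]|no] := pselect (exists t w, [/\ t \in T, bary t w & q = wsum pos w]).
    exists (wsum phi w) => t' w' t'T bw' qE'; apply: eq_bigr => v _.
    by rewrite (inj (simpT tT) (simpT t'T) bw bw') // -qE.
  by exists 0 => t w tT bw qE; case: no; exists t, w.
by move=> /choice[g gP]; exists g => t w tT bw; apply: gP bw _.
Qed.

Variable g : plane -> plane.
Hypothesis gE : forall t w, t \in T -> bary t w -> g (wsum pos w) = wsum phi w.

Lemma extension_affine t : t \in T -> exists (M : 'M[R]_2) b,
  forall q, hull (simplex_of t) q -> g q = q *m M + b.
Proof.
move=> tT; have [x [y [z [et xy yz xz]]]] := trianglesP tT.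
have st := simpT tT; rewrite et in st.
have [M [b [Mx My Mz]]] := affine_map3 (phi x) (phi y) (phi z) (simp_area sub inj xy yz xz st).
exists M, b => q /hullP[w bw ->]; rewrite (gE tT bw).
have [w0 ws w1] := bw.
rewrite /wsum mulmx_suml -[b in RHS]scale1r -w1 scaler_suml -big_split /=.
apply: eq_bigr => v _; rewrite -scalemxAl -scalerDr.
have [|/ws->] := boolP (v \in t); last by rewrite !scale0r.
by rewrite et !inE => /orP[/orP[]|] /eqP->; rewrite ?Mx ?My ?Mz.
Qed.

Lemma cover_point q : polyhedron K q -> exists t w, [/\ t \in T, bary t w & q = wsum pos w].
Proof.
move=> /polyhedronP[s [w [/cover[t tT st] bw ->]]].
by exists t, w; split=> //; apply: bary_mono bw.
Qed.

(** Finitely many closed triangles: near [x], each one either contains [x], and [g] is affine on it,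
    or is avoided. *)
Lemma extension_continuous : {within polyhedron K, continuous g}.
Proof.
apply/subspace_continuousP => x Kx N gN.
suff H : \forall q \near x, forall t : {set V}, t \in T -> hull (simplex_of t) q -> N (g q).
  apply: filterS H => q H Kq; have [t [w [tT bw e]]] := cover_point Kq.
  by apply: (H t tT); apply/hullP; exists w.
apply: (@filter_forall _ _ (fun t => [set q | t \in T -> hull (simplex_of t) q -> N (g q)]) _ (nbhs_filter x)) => t.
have [tT|tT] := boolP (t \in T); last by apply: filterS filterT.
have [M [b gM]] := extension_affine tT.
have [tx|tx] := pselect (hull (simplex_of t) x).
  have : nbhs x [set q | N (q *m M + b)].
    have gN' : nbhs (x *m M + b) N by rewrite -gM.
    exact: (@affine_continuous R M b x N gN').
  by apply: filterS => q Nq _ tq; rewrite gM.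
have : nbhs x (~` hull (simplex_of t)).
  by apply: open_nbhs_nbhs; split=> //; apply: closed_openC; apply: hull_closed.
by apply: filterS => q nq _ tq.
Qed.

Lemma extension_embedding : SL_embedding K g.
Proof.
split; first split.
- exact: extension_continuous.
- move=> S SK; have [t tT st] := cover (simp_verts SK).
  have [M [b gM]] := extension_affine tT; exists M, b => q.
  rewrite -(verts_ofK SK) => /hullP[w bw ->]; apply: gM.
  by apply/hullP; exists w => //; apply: bary_mono bw.
move=> q q' /set_mem/cover_point[t [w [tT bw ->]]] /set_mem/cover_point[t' [w' [tT' bw' ->]]].
by rewrite (gE tT bw) (gE tT' bw'); apply: phi_inj tT tT' bw bw'.
Qed.

Lemma extension_agrees s w (p : V -> plane) : simp s -> bary s w ->
  (forall v, v \in s -> phi v = p v) -> g (wsum pos w) = wsum p w.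
Proof.
move=> ss bw e; have [t tT st] := cover ss.
rewrite (gE tT (bary_mono st bw)); apply: eq_bigr => v _.
by have [/e->|vs] := boolP (v \in s); last by case: bw => _ -> //; rewrite !scale0r.
Qed.

End Extension.

Theorem theorem1 (R : realType) (K : {fset {fset 'rV[R]_2}})
    (f : 'rV[R]_2 -> 'rV[R]_2) :
  SL_disk K ->
  SL_embedding (bd K) f ->
  convex_circle (image_triangulation f (bd K)) ->
  strictly_convex_circle (image_triangulation f (bd K)) \/
    ~ (exists s : {fset 'rV[R]_2}, obstructive K f s) ->
  exists g : 'rV[R]_2 -> 'rV[R]_2,
    SL_embedding K g /\ forall x, polyhedron (bd K) x -> g x = f x.
Proof.
move=> [TK diskK] embf circle H.
have [c [[Uc sz Wc Nc] [injc cv cE]]] := boundary_cycle TK embf circle.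
have dT := disk_triangles TK diskK Uc sz cE.
have G : good (triangles (@simp R K)) c (@bd_image R K f).
  by split=> //; apply: no_flat_arc H.
have [phi S] := disk_embedding G.
have V3 : (2 < #|(vertices K : finType)|)%N.
  by apply: leq_trans sz _; rewrite cardE; apply: uniq_leq_size => // x _; rewrite mem_enum.
have cover s : simp s -> exists2 t, t \in triangles (@simp R K) & s \subset t.
  exact: simplex_in_triangle.
have phi_inj s t w w' : s \in triangles (@simp R K) -> t \in triangles (@simp R K) ->
    bary s w -> bary t w' -> wsum phi w = wsum phi w' -> wsum (@vpos R K) w = wsum (@vpos R K) w'.
  exact: solves_injective S.
have [g gE] := extension_exists TK phi.
have emb := extension_embedding TK cover phi_inj gE.
exists g; split=> //.
(* The vertices of a boundary simplex lie on [c], where [phi] equals [bd_image f]; so [g] and [f]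
   have the same barycentric formula on it. *)
move=> x /poly_bdP[s [w [bs bw ->]]].
rewrite (extension_agrees cover gE (bd_simp_simp bs) bw (p := bd_image f)).
  by rewrite (f_wsum embf bs bw).
move=> v vs; apply: (s_bd S); rewrite cv; apply: (bd_simp_sub TK bs).
  by rewrite finset.sub1set.
by apply/finset.set0Pn; exists v; rewrite finset.set11.
Qed.
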